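(* Let $X(t)_{t\ge 0}$ be a time homogeneous strong Markov process (in discrete or continuous time) with càdlàg paths, let $U$ be an open subset of state space, let $\rho$ be a quasistationary distribution (QSD) of $X(t)_{t\ge0}$ in $U$, and suppose that $T=\inf\{t\ge0:X(t)\notin U\}$ is finite almost surely when $\mathcal L(X(0))=\rho$. Let $R\ge1$ be an integer and $\Delta t>0$. Suppose $Y^r(t)_{t\ge0}$, $r=1,\ldots,R$, are independent copies of $X(t)_{t\ge0}$ with $\mathcal L(X(0))=\rho$. Let $(t_{wall}^r(m)_{m\ge0})^{1\le r\le R}$ be nonnegative random numbers such that: (i) $(t_{wall}^r(m)_{m\ge0})^{1\le r\le R}$ is independent of $(Y^r(t)_{t\ge0})^{1\le r\le R}$; (ii) almost surely, $t_{wall}^r(m)\le t_{wall}^r(n)$ whenever $m\le n$ and $1\le r\le R$; (iii) almost surely, there is a unique sequence $(r_k,m_k)_{k\ge1}$ whose range is $\{1,\ldots,R\}\times\{0,1,2,\ldots\}$ and such that $t_{wall}^{r_1}(m_1)<t_{wall}^{r_2}(m_2)<t_{wall}^{r_3}(m_3)<\cdots$. For $k\ge1$ define the trajectory fragments $$X_k(t)=Y^{r_k}(m_k\Delta t+t),\qquad 0\le t\le\Delta t .$$ Then the fragments can be extended to processes $X_k(t)_{t\ge0}$, $k\ge1$, by an appropriate definition of $X_k(t)$ for $t>\Delta t$ (possibly on an enlarged probability space), such that each $X_k(t)_{t\ge0}$ is a Markov process with the same transition law as $X$ and, with $T_k=\inf\{t\ge0:X_k(t)\notin U\}$: (a) for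 each $k\ge 2$, conditional on $X_k(0)$, the process $X_k(t)_{t\ge0}$ is independent of $(X_\ell(t)_{t\ge0})_{1\le \ell<k}$; (b) $\mathcal L(X_1(0))=\rho$, and $\mathcal L(X_k(0)\mid T_{k-1}>\Delta t,\ldots,T_1>\Delta t)=\rho$ for all $k\ge2$. Consequently, with $L=\inf\{k\ge1:T_k\le\Delta t\}$, $T_{par}=(L-1)\Delta t+T_L$, $X_{par}=X_L(T_L)$, and $X(t)_{t\ge0}$ started with $\mathcal L(X(0))=\rho$, one has $(T_{par},X_{par})\stackrel{\mathcal L}{=}(T,X(T))$, and for every bounded measurable real-valued function $g$ on state space, $$\mathbb E\left(\sum_{k=1}^{L}\ \sum_{t=0}^{T_k\wedge \Delta t-1} g(X_k(t))\right)=\mathbb E\left(\sum_{t=0}^{T-1}g(X(t))\right)$$ in the discrete time case, and $$\mathbb E\left(\sum_{k=1}^{L}\int_0^{T_k\wedge \Delta t} g(X_k(t))\,dt\right)=\mathbb E\left(\int_0^{T}g(X(t))\,dt\right)$$ in the continuous time case.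
   Context: State space is a topological space (standard Borel as a measurable space). Time is either discrete ($t\in\{0,1,2,\dots\}$, in which case $\Delta t$ is a positive integer) or continuous ($t\in[0,\infty)$). $\mathcal L$ denotes probability law, $\stackrel{\mathcal L}{=}$ equality in law, and $a\wedge b=\min\{a,b\}$. The number $t_{wall}^r(m)$ is interpreted as the wall-clock time it takes to compute $Y^r(t)_{t\ge0}$ up to time $t=m\Delta t$. A probability measure $\rho$ is a QSD of $X(t)_{t\ge0}$ in $U$ if $\rho(U)=1$ and, with $T=\inf\{t\ge0:X(t)\notin U\}$, $\rho(A)=\mathbb P(X(t)\in A\mid \mathcal L(X(0))=\rho,\ T>t)$ for every $t\ge0$ and measurable $A\subseteq U$. Standing assumption: the QSD of $X(t)_{t\ge0}$ in $U$ exists, is unique, and for any initial distribution of $X(0)$ supported in $U$ one has $\rho(A)=\lim_{t\to\infty}\mathbb P(X(t)\in A\mid X(s)\in U\text{ for } s\in[0,t])$ for all measurable $A\subseteq U$. Conditional laws given an event are understood when the event has positive probability. A process $X_k$ has the same transition law as $X$ if, conditional on $X_k(0)=x$, $X_k(t)_{t\ge0}$ has the law of $X(t)_{t\ge0}$ started at $x$. Note that $L$, $T_{par}$, $X_{par}$ and the sums/integrals above depend only on the fragments $X_k(t)_{0\le t\le\Delta t}$, not on the extension to $t>\Delta t$. *)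

(* Defs.v *)
From HB Require Import structures.
From mathcomp Require Import all_boot all_order all_algebra.
From mathcomp Require Import all_classical all_reals all_analysis.
From mathcomp Require Import measurable_realfun.

Set Implicit Arguments.
Unset Strict Implicit.
Unset Printing Implicit Defensive.

Import Order.TTheory GRing.Theory Num.Theory.
Import numFieldNormedType.Exports.

Local Open Scope classical_set_scope.
Local Open Scope ring_scope.

Inductive time_kind := Discrete | Continuous.

Definition time (R : realType) (k : time_kind) : Type :=
  match k with Discrete => nat | Continuous => {nonneg R} end.

Definition time_val (R : realType) (k : time_kind) : time R k -> R :=
  match k with
  | Discrete => fun n : nat => n%:R
  | Continuous => fun t : {nonneg R} => t%:num
  end.

Definition time_zero (R : realType) (k : time_kind) : time R k :=
  match k with Discrete => 0%N | Continuous => 0%:nng end.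

Definition time_add (R : realType) (k : time_kind) :
    time R k -> time R k -> time R k :=
  match k with
  | Discrete => fun m n : nat => (m + n)%N
  | Continuous => fun s t : {nonneg R} => (s%:num + t%:num)%:nng
  end.

Definition time_muln (R : realType) (k : time_kind) (t : time R k) (m : nat) :
  time R k := iter m (time_add t) (time_zero R k).

Lemma max0_ge0 (R : realType) (x : R) : 0 <= Num.max 0 x.
Proof. by rewrite le_max lexx. Qed.

(* Largest time below x when x >= 0: the integer part in discrete time, x itself
   in continuous time.  Negative reals are sent to time 0. *)
Definition time_of (R : realType) (k : time_kind) : R -> time R k :=
  match k return R -> time R k with
  | Discrete => fun x : R => Num.truncn x
  | Continuous => fun x : R => NngNum (max0_ge0 x)
  end.
Arguments time_of {R} k x.

Notation borel S := (g_sigma_algebraType (@open S)).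

(* Borel isomorphic to a Polish space. *)
Definition standard_borel (R : realType) (S : ptopologicalType) : Prop :=
  exists Q : completePseudoMetricType R,
    [/\ hausdorff_space Q, @second_countable Q &
      exists f : S -> Q, bijective f /\
        forall A : set Q, (measurable : set (set (borel Q))) A <->
                          (measurable : set (set (borel S))) (f @^-1` A)].

Section paths.
Context (R : realType) (k : time_kind) (S : ptopologicalType).

Definition cadlag (w : time R k -> S) : Prop :=
  match k with
  | Discrete => True
  | Continuous => forall t : time R k,
      (fun x : R => w (time_of k x)) @ (time_val t)^'+ --> w t /\
      (0 < time_val t ->
        exists l : S, (fun x : R => w (time_of k x)) @ (time_val t)^'- --> l)
  end.

Record path_space := Path { path_fun :> time R k -> S ; path_cadlag : cadlag path_fun }.

Lemma cadlag_cst (x : S) : cadlag (fun=> x).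
Proof.
rewrite /cadlag; case: k => // t; split; first exact: cvg_cst.
by move=> _; exists x; exact: cvg_cst.
Qed.

HB.instance Definition _ := gen_eqMixin path_space.
HB.instance Definition _ := gen_choiceMixin path_space.
HB.instance Definition _ := isPointed.Build path_space (Path (cadlag_cst point)).

Definition cylinders (I : set (time R k)) : set (set path_space) :=
  [set A | exists t (B : set (borel S)),
    [/\ I t, measurable B & A = [set w : path_space | B (w t)]]].

Definition path_measurable : set (set path_space) := <<s cylinders setT >>.

Let path_measurable0 : path_measurable set0.
Proof. exact: sigma_algebra0. Qed.

Let path_measurableC (A : set path_space) : path_measurable A -> path_measurable (~` A).
Proof. exact: sigma_algebraC. Qed.

Let path_measurableU (F : (set path_space)^nat) :
  (forall i, path_measurable (F i)) -> path_measurable (\bigcup_i F i).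
Proof. exact: sigma_algebra_bigcup. Qed.

Definition path_display : measure_display.
Proof. by constructor. Qed.

HB.instance Definition _ := @isMeasurable.Build path_display path_space path_measurable
  path_measurable0 path_measurableC path_measurableU.

Definition upto (t : time R k) : set (time R k) :=
  [set s | time_val s <= time_val t].

(* sigma(X(s), s <= t), for X the coordinate process on path space *)
Definition history (t : time R k) : set (set path_space) := <<s cylinders (upto t) >>.

Lemma cadlag_shift (s : time R k) (w : path_space) :
  cadlag (fun t => w (time_add s t)).
Proof.
case: w => w /=; move: s w; rewrite /cadlag; case: k => //= s w wD t.
have E (x : R) : 0 <= x -> (s%:num + (NngNum (max0_ge0 x))%:num)%:nng =
    NngNum (max0_ge0 (s%:num + x)) :> {nonneg R}.
  by move=> x0; apply/val_inj => /=; rewrite !max_r// addr_ge0.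
have [/= wr wl] := wD (s%:num + t%:num)%:nng.
have cs : continuous (fun x : R => s%:num + x).
  by move=> x; apply: cvgD; [exact: cvg_cst|exact: cvg_id].
split.
  move=> V /wr; rewrite /nbhs/= /at_right /within/= => wV.
  have {}wV : \forall x \near t%:num,
      s%:num + t%:num < s%:num + x -> V (w (time_of Continuous (s%:num + x))).
    exact: cs t%:num _ wV.
  near=> x => tx /=; rewrite E ?(le_trans _ (ltW tx))//.
  by move: tx; rewrite -(ltrD2l s%:num); near: x.
move=> t0; have [|l wl'] := wl; first by rewrite ltr_wpDl.
exists l => V /wl'; rewrite /nbhs/= /at_left /within/= => wV.
have {}wV : \forall x \near t%:num,
    s%:num + x < s%:num + t%:num -> V (w (time_of Continuous (s%:num + x))).
  exact: cs t%:num _ wV.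
near=> x => xt /=; rewrite E; last by apply: ltW; near: x; exact: lt_nbhsr.
by move: xt; rewrite -(ltrD2l s%:num); near: x.
Unshelve. all: by end_near. Qed.

Definition shift (s : time R k) (w : path_space) : path_space := Path (cadlag_shift s w).

End paths.
Arguments path_space : clear implicits.
Arguments history {R k S} t.
Arguments cylinders {R k S} I.

Section markov.
Context (R : realType) (k : time_kind) (S : ptopologicalType).
Local Open Scope ereal_scope.

Section law_from.
Context (K : R.-pker (borel S) ~> path_space R k S) (mu : probability (borel S) R).

Definition law_from (A : set (path_space R k S)) : \bar R := \int[mu]_x K x A.

Let law_from0 : law_from set0 = 0.
Proof.
by rewrite /law_from (eq_integral (cst 0)) ?integral0// => x _; rewrite measure0.
Qed.

Let law_from_ge0 A : 0 <= law_from A. Proof. exact: integral_ge0. Qed.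

Let law_from_sigma_additive : semi_sigma_additive law_from.
Proof.
move=> F mF tF mUF; rewrite [X in _ --> X](_ : _ =
  \int[mu]_x (\sum_(n <oo) K x (F n))); last first.
  apply: eq_integral => x _.
  by apply/esym/cvg_lim => //; exact/measure_semi_sigma_additive.
apply/cvg_closeP; split.
  by apply: is_cvg_nneseries => n _ _; exact: integral_ge0.
rewrite closeE// integral_nneseries// => n.
exact: (measurable_kernel K _ (mF n)).
Qed.

HB.instance Definition _ := isMeasure.Build _ _ R law_from
  law_from0 law_from_ge0 law_from_sigma_additive.

Let law_fromT : law_from setT = 1.
Proof.
rewrite /law_from (eq_integral (cst 1)); last by move=> x _; rewrite prob_kernel.
rewrite integral_cst// mul1e; exact: probability_setT.
Qed.

HB.instance Definition _ := Measure_isProbability.Build _ _ R law_from law_fromT.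

End law_from.

Definition stopping_time (tau : path_space R k S -> \bar R) : Prop :=
  (forall w, tau w = +oo \/ exists t : time R k, tau w = (time_val t)%:E) /\
  (forall t : time R k, history t [set w | tau w <= (time_val t)%:E]).

Definition before_stopping (tau : path_space R k S -> \bar R) : set (set (path_space R k S)) :=
  [set B | measurable B /\
    forall t : time R k, history t (B `&` [set w | tau w <= (time_val t)%:E])].

(* K x is the law on path space of the process started at x.  Progressive
   measurability of the coordinate process is automatic when S is metrizable;
   over a general topological space it is what makes X(tau) a random variable. *)
Record strong_markov (K : R.-pker (borel S) ~> path_space R k S) : Prop := {
  strong_markov_start : forall (x : borel S) (B : set (borel S)), measurable B ->
    K x [set w : path_space R k S | B (w (time_zero R k))] = \d_x B ;
  strong_markov_progressive : forall t : time R k,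
    measurable_fun ([set x | (0 <= x <= time_val t)%R] `*` setT)
      (fun xw : R * g_sigma_algebraType (@cylinders R k S (upto t)) =>
        (xw.2 : path_space R k S) (time_of k xw.1) : borel S) ;
  strong_markov_restart : forall (x : borel S) (tau : path_space R k S -> \bar R)
      (A B : set (path_space R k S)),
    stopping_time tau -> before_stopping tau B -> measurable A ->
    let D := B `&` [set w | tau w < +oo] in
    K x (D `&` [set w | A (shift (time_of k (fine (tau w))) w)]) =
    \int[K x]_(w in D) K (w (time_of k (fine (tau w)))) A }.

Section processes.
Context (K : R.-pker (borel S) ~> path_space R k S).
Context (d : measure_display) (Omega : measurableType d) (P : probability Omega R).

Definition same_transition_law (X : Omega -> path_space R k S) : Prop :=
  forall (C : set (borel S)) (A : set (path_space R k S)), measurable C -> measurable A ->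
    let D := [set o | C (X o (time_zero R k))] in
    P (D `&` X @^-1` A) = \int[P]_(o in D) K (X o (time_zero R k)) A.

Definition markov_process (X : Omega -> path_space R k S) : Prop :=
  forall (t : time R k) (A B : set (path_space R k S)), measurable A -> history t B ->
    P (X @^-1` (B `&` shift t @^-1` A)) = \int[P]_(o in X @^-1` B) K (X o t) A.

End processes.

End markov.

Section conditioning.
Context (R : realType) (d : measure_display) (Omega : measurableType d).
Context (P : probability Omega R).
Local Open Scope ereal_scope.

Definition generated (d' : measure_display) (T : measurableType d') (I : Type)
    (D : set I) (X : I -> Omega -> T) : set (set Omega) :=
  <<s [set X i @^-1` B | i in D & B in measurable] >>.

Definition independent (F G : set (set Omega)) : Prop :=
  forall A B, F A -> G B -> P (A `&` B) = P A * P B.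

(* f(Z) is a version of the conditional probability of A given Z. *)
Definition cond_version (d' : measure_display) (T : measurableType d')
    (Z : Omega -> T) (A : set Omega) (f : T -> R) : Prop :=
  [/\ measurable_fun setT f, forall z, (0 <= f z)%R &
    forall C, measurable C ->
      P (Z @^-1` C `&` A) = \int[P]_(o in Z @^-1` C) (f (Z o))%:E].

Definition cond_independent (d' : measure_display) (T : measurableType d')
    (Z : Omega -> T) (F G : set (set Omega)) : Prop :=
  forall A B, F A -> G B -> exists f g : T -> R,
    [/\ cond_version Z A f, cond_version Z B g &
        cond_version Z (A `&` B) (fun z => (f z * g z)%R)].

(* Hitting times of closed sets by cadlag paths are in general not measurable
   for the cylinder sigma-algebra, but only (by the measurable projection theorem)
   for its completion under each law.  mu_ext P, restricted to its
   Caratheodory-measurable sets, is the completion of P. *)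
Definition completed_event (A : set Omega) : Prop := (mu_ext P).-caratheodory A.

Definition cond_prob (A E : set Omega) : R :=
  (fine (mu_ext P (A `&` E)) / fine (mu_ext P E))%R.

End conditioning.

Definition equal_in_law (R : realType) (d1 d2 d : measure_display)
    (O1 : measurableType d1) (O2 : measurableType d2) (T : measurableType d)
    (P1 : probability O1 R) (P2 : probability O2 R)
    (X1 : O1 -> T) (X2 : O2 -> T) : Prop :=
  forall B, measurable B ->
    [/\ completed_event P1 (X1 @^-1` B), completed_event P2 (X2 @^-1` B) &
        mu_ext P1 (X1 @^-1` B) = mu_ext P2 (X2 @^-1` B)].

Section exit.
Context (R : realType) (k : time_kind) (S : ptopologicalType) (U : set S).
Local Open Scope ereal_scope.

Definition exit_time (w : path_space R k S) : \bar R :=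
  ereal_inf [set (time_val t)%:E | t in [set t | ~ U (w t)]].

(* Meaningful when exit_time w < +oo. *)
Definition exit_state (w : path_space R k S) : borel S :=
  w (time_of k (fine (exit_time w))).

Definition survives (x : R) : set (path_space R k S) := [set w | x%:E < exit_time w].

Definition is_qsd (K : R.-pker (borel S) ~> path_space R k S)
    (rho : probability (borel S) R) : Prop :=
  rho U = 1 /\
  forall t : time R k, 0 < mu_ext (law_from K rho) (survives (time_val t)) /\
    forall A : set (borel S), measurable A -> A `<=` U ->
      rho A = (cond_prob (law_from K rho)
        [set w : path_space R k S | A (w t)] (survives (time_val t)))%:E.

Definition qsd_attracts (K : R.-pker (borel S) ~> path_space R k S)
    (rho : probability (borel S) R) : Prop :=
  forall mu : probability (borel S) R, mu U = 1 ->
    let stays (t : time R k) :=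
      [set w : path_space R k S | forall s, upto t s -> U (w s)] in
    (forall t, 0 < mu_ext (law_from K mu) (stays t)) ->
    forall A : set (borel S), measurable A -> A `<=` U ->
      (cond_prob (law_from K mu)
        [set w : path_space R k S | A (w (time_of k x))] (stays (time_of k x)))%:E
      @[x --> +oo%R] --> rho A.

(* Sum of g(w(t)) over times t < a in discrete time, integral over [0, a[ in
   continuous time. *)
Definition occupation (g : S -> R) : path_space R k S -> \bar R -> \bar R :=
  match k return path_space R k S -> \bar R -> \bar R with
  | Discrete => fun w a =>
      \sum_(0 <= n <oo | (n%:R%:E < a)) (g (w n))%:E
  | Continuous => fun w a =>
      \int[lebesgue_measure]_(x in [set x | (0 <= x)%R /\ x%:E < a])
        (g (w (time_of Continuous x)))%:E
  end.

End exit.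

(* Sequences are indexed from 0: the k-th fragment of the usual numbering, with
   k >= 1, is the one of index k - 1 here. *)
Definition enumerates (R : realType) (N : nat) (t : 'I_N -> nat -> R)
    (s : nat -> 'I_N * nat) : Prop :=
  range s = setT /\ forall j, t (s j).1 (s j).2 < t (s j.+1).1 (s j.+1).2.

Section parallel_exit.
Context (R : realType) (k : time_kind) (S : ptopologicalType) (U : set S).
Context (Dt : time R k) (X : nat -> path_space R k S).
Local Open Scope ereal_scope.

(* L, with values in {1, 2, ...} or +oo *)
Definition first_exit : \bar R :=
  ereal_inf [set j.+1%:R%:E | j in [set j | exit_time U (X j) <= (time_val Dt)%:E]].

(* the fragment X_L; meaningful when L < +oo *)
Definition exit_fragment : path_space R k S := X (Num.truncn (fine first_exit)).-1.

Definition T_par : \bar R :=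
  (first_exit - 1) * (time_val Dt)%:E + exit_time U exit_fragment.

Definition X_par : borel S := exit_state U exit_fragment.

Definition occupation_par (g : S -> R) : \bar R :=
  \sum_(0 <= j <oo | (j.+1%:R%:E <= first_exit))
    occupation g (X j) (Order.min (exit_time U (X j)) (time_val Dt)%:E).

End parallel_exit.

(* Main.v *)
Require Import Defs.
From HB Require Import structures.
From mathcomp Require Import all_boot all_order all_algebra.
From mathcomp Require Import all_classical all_reals all_analysis.
From mathcomp Require Import measurable_realfun.
From mathcomp Require Import ring lra.

Set Implicit Arguments.
Unset Strict Implicit.
Unset Printing Implicit Defensive.

Import Order.TTheory GRing.Theory Num.Theory.
Import numFieldNormedType.Exports.
Import Defs.

Local Open Scope classical_set_scope.
Local Open Scope ring_scope.
Local Open Scope ereal_scope.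

(* Which fragment comes k-th depends on the wall-clock times alone, and the k-th fragment
   is either the next piece of a copy already used or the first piece of a new one.
   Prolonging each fragment Y^r(m Dt + .) beyond Dt by a fresh path started from
   Y^r((m + 1) Dt), on an Ionescu-Tulcea extension of Omega, turns it into a copy of X
   which, given its starting point, is independent of the earlier fragments.
   If c r fragments of copy r are among the first j ones, these j fragments survive
   when each copy r survives until c r * Dt. By independence of the copies and
   quasistationarity, the next fragment then starts from rho, whichever copy it belongs to.
   Hence P(X_1, ..., X_j survive and X_{j+1} in A) = p^j law(A) with p = P(T > Dt), and the
   law of (T_par, X_par) and the mean of the sums over fragments depend only on p and on
   the law of X. They are identified in the case R = 1, t_wall(m) = m, where the fragments
   are the successive pieces of a single path. *)

(** * Densities, completions and versions *)

(** If a fragment were continued by its own copy, it would determine the later fragments of that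
    copy, which would ruin (a); hence the fresh prolongations. Two difficulties shape the rest. The
    index of the k-th fragment is random. It is handled by cutting along the countably many values
    of ([counts], [next_copy]): on each of them the index is fixed, and the event depends on the
    wall clock alone, so it can be adjoined to the past of that fixed fragment. This past contains
    the other copies in full, which independence allows, so that the way in which the copies
    interleave does not matter. Secondly, exit times are measurable only up to null sets that depend
    on the law, and a fragment is known to have a law proportional to [law_from K rho] only on the
    survival of its predecessors. Survival events are therefore replaced by measurable versions, one
    fragment after the other. The case of a single copy spares a direct computation of the law of
    (T, X(T)); it also yields p < 1, since T is finite almost surely there, and p < 1 then forces an
    exit for any number of copies. *)

Section density.
Context d (T : measurableType d) (R : realType) (mu : {measure set T -> \bar R}).

(** The proofs [f0] and [mf] are arguments because the measure structure attached to [density f0 mf]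
    depends on them. *)
Definition density (f : T -> \bar R) (f0 : forall x, 0 <= f x)
  (mf : measurable_fun setT f) (A : set T) : \bar R := \int[mu]_(x in A) f x.

Context (f : T -> \bar R) (f0 : forall x, 0 <= f x) (mf : measurable_fun setT f).

Let density0 : density f0 mf set0 = 0. Proof. exact: integral_set0. Qed.

Let density_ge0 A : 0 <= density f0 mf A. Proof. exact: integral_ge0. Qed.

Let density_sigma_additive : semi_sigma_additive (density f0 mf).
Proof.
move=> F mF tF mUF; rewrite /density ge0_integral_bigcup//; last first.
  exact: measurable_funTS.
by apply: is_cvg_nneseries => n _ _; exact: integral_ge0.
Qed.

HB.instance Definition _ := isMeasure.Build _ _ _ (density f0 mf)
  density0 density_ge0 density_sigma_additive.

Import HBNNSimple.

Let integral_density_nnsfun (h : {nnsfun T >-> R}) :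
  \int[density f0 mf]_x (h x)%:E = \int[mu]_x ((h x)%:E * f x).
Proof.
under [in LHS]eq_integral do rewrite fimfunE -fsumEFin//.
under [in RHS]eq_integral.
  move=> x _; rewrite fimfunE -fsumEFin//.
  rewrite ge0_mule_fsuml; last by move=> r; rewrite EFinM nnfun_muleindic_ge0.
  over.
rewrite ge0_integral_fsum//; last 2 first.
  - by move=> r; exact/measurable_EFinP/measurableT_comp.
  - by move=> r z _; rewrite EFinM nnfun_muleindic_ge0.
rewrite ge0_integral_fsum//; last 2 first.
  - move=> r; apply: emeasurable_funM => //.
    exact/measurable_EFinP/measurableT_comp.
  - by move=> r z _; rewrite mule_ge0// EFinM nnfun_muleindic_ge0.
apply: eq_fsbigr => r _.
rewrite (integralZl_indic _ (fun r => h @^-1` [set r]))//; last first.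
  by move=> r0; rewrite preimage_nnfun0.
rewrite integral_indic// setIT /= /density.
under [in RHS]eq_integral do rewrite EFinM -muleA.
have [r0|r0] := leP 0%R r; last first.
  rewrite preimage_nnfun0// integral_set0 mule0.
  by rewrite integral0_eq// => x _; rewrite indic0 mul0e mule0.
rewrite ge0_integralZl//; last 2 first.
- apply: emeasurable_funM => //.
  exact/measurable_EFinP/measurable_indic.
- by move=> x _; rewrite mule_ge0// lee_fin.
congr (_ * _); rewrite -(setTI (h @^-1` _)) integral_mkcondr.
by apply: eq_integral => x _; rewrite epatch_indic setTI muleC.
Qed.

(** Monotone convergence along simple functions that increase to [g]; finiteness of [f] lets the
    limit pass through the product with [f x]. *)
Lemma integral_density (g : T -> \bar R) :
  (forall x, f x \is a fin_num) -> measurable_fun setT g -> (forall x, 0 <= g x) ->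
  \int[density f0 mf]_x g x = \int[mu]_x (g x * f x).
Proof.
move=> ffin mg g0; pose g_ := nnsfun_approx measurableT mg.
have gE x : limn (fun n => (g_ n x)%:E) = g x.
  by apply/cvg_lim => //; exact: cvg_nnsfun_approx.
transitivity (\int[density f0 mf]_x limn (fun n => (g_ n x)%:E)).
  by apply: eq_integral => x _; rewrite gE.
rewrite monotone_convergence//; last 3 first.
- by move=> n; exact/measurable_EFinP.
- by move=> n z _; rewrite lee_fin.
- by move=> z _ a b ab; rewrite lee_fin; exact/lefP/nd_nnsfun_approx.
under eq_fun do rewrite integral_density_nnsfun.
rewrite -monotone_convergence//; last 3 first.
- by move=> n; apply: emeasurable_funM => //; exact/measurable_EFinP.
- by move=> n z _; rewrite mule_ge0// lee_fin.
- move=> z _ a b ab; rewrite lee_pmul// ?lee_fin//.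
  exact/lefP/nd_nnsfun_approx.
apply: eq_integral => x _; apply/cvg_lim => //.
by apply: cvgeZr; [exact: ffin|exact: cvg_nnsfun_approx].
Qed.

End density.

Section sub_sigma_algebra.
Context d (T : measurableType d) (R : realType) (mu : {measure set T -> \bar R}).
Context (Pi : set (set T)) (mPi : Pi `<=` measurable) (PiI : setI_closed Pi)
  (PiT : Pi setT).

Lemma sub_generated_measurable : <<s Pi >> `<=` measurable.
Proof. by apply: smallest_sub => //; exact: sigma_algebra_measurable. Qed.

Lemma sub_generated_measurable_fun d' (T' : measurableType d') (g : T -> T') :
  measurable_fun setT (g : g_sigma_algebraType Pi -> T') -> measurable_fun setT g.
Proof.
by move=> mg _ B mB; apply: sub_generated_measurable; exact: mg.
Qed.

(** Typically [f1] is the indicator of an event and [f2] a conditional probability of it. The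
    measures with densities [f1] and [f2] agree on the pi-system, hence on the sigma-algebra that it
    generates, for which [g] is measurable. *)
Lemma eq_cond_expectation (f1 f2 : T -> \bar R) (g : T -> \bar R) :
  measurable_fun setT f1 -> measurable_fun setT f2 ->
  (forall x, 0 <= f1 x) -> (forall x, 0 <= f2 x) ->
  (forall x, f1 x \is a fin_num) -> (forall x, f2 x \is a fin_num) ->
  \int[mu]_x f1 x < +oo ->
  (forall A, Pi A -> \int[mu]_(x in A) f1 x = \int[mu]_(x in A) f2 x) ->
  measurable_fun setT (g : g_sigma_algebraType Pi -> \bar R) ->
  (forall x, 0 <= g x) ->
  \int[mu]_x (g x * f1 x) = \int[mu]_x (g x * f2 x).
Proof.
move=> mf1 mf2 f10 f20 f1fin f2fin f1oo f12 mg g0.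
have E A : <<s Pi >> A -> density mu f10 mf1 A = density mu f20 mf2 A.
  apply: (g_sigma_algebra_measure_unique Pi mPi (fun=> setT) (fun=> PiT) _
    (density mu f10 mf1) (density mu f20 mf2)) => //.
  by rewrite bigcup_const.
(* Pushing forward along the identity restricts both measures to the smaller sigma-algebra. There
   they are equal, although they may differ on the original one. *)
have mid : measurable_fun setT (idfun : T -> g_sigma_algebraType Pi).
  by move=> _ B mB; rewrite setTI preimage_id; exact: sub_generated_measurable.
rewrite -(integral_density _ f10 mf1)//; last exact: sub_generated_measurable_fun.
rewrite -(integral_density _ f20 mf2)//; last exact: sub_generated_measurable_fun.
transitivity (\int[pushforward (density mu f10 mf1)
    (idfun : T -> g_sigma_algebraType Pi)]_x g x).
  by rewrite ge0_integral_pushforward.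
transitivity (\int[pushforward (density mu f20 mf2)
    (idfun : T -> g_sigma_algebraType Pi)]_x g x); last first.
  by rewrite ge0_integral_pushforward.
by apply: eq_measure_integral => A mA _; exact: E.
Qed.

Lemma eq_cond_expectation_set (f1 f2 : T -> \bar R) (G : set T) :
  measurable_fun setT f1 -> measurable_fun setT f2 ->
  (forall x, 0 <= f1 x) -> (forall x, 0 <= f2 x) ->
  \int[mu]_x f1 x < +oo ->
  (forall A, Pi A -> \int[mu]_(x in A) f1 x = \int[mu]_(x in A) f2 x) ->
  <<s Pi >> G ->
  \int[mu]_(x in G) f1 x = \int[mu]_(x in G) f2 x.
Proof.
move=> mf1 mf2 f10 f20 f1oo f12 sG.
apply: (g_sigma_algebra_measure_unique Pi mPi (fun=> setT) (fun=> PiT) _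
  (density mu f10 mf1) (density mu f20 mf2)) => //.
by rewrite bigcup_const.
Qed.

End sub_sigma_algebra.

(** Used with [N] the random state that tells which fragment comes next: on each fibre this fragment
    has a deterministic index. *)
Lemma measure_countable_fibers d (T : measurableType d) (R : realType)
    (I : countType) (N : T -> I) (mu1 mu2 : {measure set T -> \bar R}) (A B : set T) :
  (forall i, measurable (N @^-1` [set i])) -> measurable A -> measurable B ->
  (forall i, mu1 (A `&` N @^-1` [set i]) = mu2 (B `&` N @^-1` [set i])) ->
  mu1 A = mu2 B.
Proof.
move=> mN mA mB AB.
(* [pickle_inv], unlike [unpickle], answers only at actual codes, so each [i] occurs for a single
   [n] and the [F n] are disjoint. *)
pose F n := if pickle_inv n is Some i then N @^-1` [set i] else set0.
have mF n : measurable (F n) by rewrite /F; case: pickle_inv.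
have FT : \bigcup_n F n = setT.
  apply/seteqP; split=> // x _; exists (pickle (N x)) => //.
  by rewrite /F pickleK_inv.
have tF C : trivIset setT (fun n => C `&` F n).
  apply/trivIsetP => m n _ _ mn; rewrite setIACA setIid.
  rewrite [F m `&` F n](_ : _ = set0) ?setI0//.
  apply/seteqP; split=> // x []; rewrite /F.
  have := @pickle_invK I m; have := @pickle_invK I n.
  case: (pickle_inv m) => //= i; case: (pickle_inv n) => //= j nj mi Ni Nj.
  by move: mn; rewrite -nj -mi -Ni -Nj eqxx.
have E (mu : {measure set T -> \bar R}) C : measurable C ->
    mu C = \sum_(n <oo) mu (C `&` F n).
  move=> mC; rewrite -measure_semi_bigcup//.
  - by rewrite -setI_bigcupr FT setIT.
  - by move=> n; exact: measurableI.
  - by rewrite -setI_bigcupr FT setIT.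
rewrite (E _ _ mA) (E _ _ mB); apply: eq_eseriesr => n _.
by rewrite /F; case: (pickle_inv _) => [i|]; rewrite ?setI0 ?measure0.
Qed.

Lemma ae_measure_eq d (T : measurableType d) (R : realType)
    (mu : {measure set T -> \bar R}) (A B : set T) : measurable A -> measurable B ->
  {ae mu, forall x, A x <-> B x} -> mu A = mu B.
Proof.
move=> mA mB [N [mN N0 sN]].
have E C : measurable C -> mu C = mu (C `\` N).
  move=> mC; rewrite (measureDI mu mC mN).
  rewrite [X in _ + X](_ : _ = 0) ?adde0//.
  by apply: subset_measure0 N0 => //; exact: measurableI.
rewrite (E _ mA) (E _ mB); congr (mu _).
by apply/seteqP; split=> x [Cx Nx]; split=> //;
  move/subsetC: sN => /(_ x Nx) /= /contrapT [h1 h2]; auto.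
Qed.

Section completion.
Context d (T : measurableType d) (R : realType) (P : probability T R).
Local Open Scope measure_scope.

Let null_completed (N S : set T) : measurable N -> P N = 0 -> S `<=` N ->
  completed_event P S /\ P^* S = 0.
Proof.
move=> mN N0 SN.
have S0 : P^* S = 0.
  apply/eqP; rewrite eq_le mu_ext_ge0// andbT -N0 -(measurable_mu_extE P mN).
  by apply: le_mu_ext.
split=> //; apply: le_caratheodory_measurable => X.
rewrite -[leRHS]add0e; apply: leeD.
  by rewrite -S0; apply: le_mu_ext; exact: subIsetr.
by apply: le_mu_ext; exact: subIsetl.
Qed.

(** Off a null set [N] the two sets coincide. Hence [S] is [V] minus [N] together with a subset of
    [N], and its outer measure lies between those of [V] minus [N] and of the union of [V] and
    [N]. *)
Lemma completed_event_ae (S V : set T) : measurable V ->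
  {ae P, forall o, S o <-> V o} -> completed_event P S /\ mu_ext P S = P V.
Proof.
move=> mV [N [mN N0 sN]].
have SV o : ~ N o -> (S o <-> V o).
  by move=> No; move/subsetC: sN => /(_ o No) /= /contrapT.
have SE : S = (V `\` N) `|` (S `&` N).
  apply/seteqP; split=> o.
    by move=> So; have [No|No] := pselect (N o); [right|left; split=> //; apply/SV].
  by case=> [[Vo No]|[]//]; apply/SV.
have mVN : measurable (V `\` N) by exact: measurableD.
have [cSN SN0] := null_completed mN N0 (@subIsetr _ S N).
split.
  rewrite SE; apply: caratheodory_measurable_setU => //.
  exact: caratheodory_measurable_mu_ext.
have VNE : P (V `\` N) = P V.
  apply: ae_measure_eq => //; exists N; split=> // o /= h.
  by apply: contrapT => No; apply: h; split=> // -[].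
apply/eqP; rewrite eq_le; apply/andP; split; last first.
  rewrite -VNE -(measurable_mu_extE P mVN); apply: le_mu_ext.
  by rewrite [X in _ `<=` X]SE; exact: subsetUl.
have VUE : P (V `|` N) = P V.
  apply: ae_measure_eq => //; first exact: measurableU.
  exists N; split=> // o /= h.
  by apply: contrapT => No; apply: h; split=> [[//|/No]|]; [|left].
rewrite -VUE -(measurable_mu_extE P (measurableU _ _ mV mN)).
apply: le_mu_ext; rewrite [X in X `<=` _]SE => o [[]|[]]; [by left|by right].
Qed.

(** The hull is the intersection of countable covers whose total mass exceeds the outer measure by
    at most 1/(n + 1). *)
Let measurable_hull (A : set T) : exists B, [/\ measurable B, A `<=` B & P B = P^* A].
Proof.
have finA : P^* A \is a fin_num.
  rewrite ge0_fin_numE ?mu_ext_ge0//; apply: le_lt_trans (ltry 1).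
  rewrite -(probability_setT P) -(measurable_mu_extE P measurableT).
  exact: le_mu_ext.
have /choice[B hB] n : exists B, [/\ measurable B, A `<=` B &
    P B <= P^* A + (n.+1%:R^-1)%:E].
  have [|_ [F [mF AF] <-] Fn] :=
    @lb_ereal_inf_adherent R _ (n.+1%:R^-1) _ finA; first by rewrite invr_gt0.
  exists (\bigcup_k F k); split=> //; first exact: bigcup_measurable.
  apply: le_trans (ltW Fn).
  apply: measure_sigma_subadditive => //; exact: bigcup_measurable.
exists (\bigcap_n B n); split.
- by apply: bigcap_measurable => // n _; have [] := hB n.
- by move=> x Ax n _; have [_ /(_ _ Ax)] := hB n.
apply/eqP; rewrite eq_le; apply/andP; split; last first.
  rewrite -(measurable_mu_extE P); last first.
    by apply: bigcap_measurable => // n _; have [] := hB n.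
  by apply: le_mu_ext => x Ax n _; have [_ /(_ _ Ax)] := hB n.
apply/lee_addgt0Pr => e e0.
have [n _ ne] : exists2 n, True & (n.+1%:R^-1 <= e)%R.
  have := @near_infty_natSinv_lt R (PosNum e0).
  by case=> n _ /(_ n (leqnn n))/ltW; exists n.
have [mBn _ Bn] := hB n.
apply: (@le_trans _ _ (P (B n))).
  apply: le_measure; rewrite ?inE//; last exact: bigcap_inf.
  by apply: bigcap_measurable => // k _; have [] := hB k.
by apply: le_trans Bn _; rewrite leeD2l// lee_fin.
Qed.

(** Let [B] and [C] be hulls of [S] and of its complement. The Caratheodory equation on the whole
    space gives P B + P C = 1, while [B] and [C] cover the space. So their intersection is null, and
    it contains [B] minus [S]. *)
Lemma completed_event_version (S : set T) : completed_event P S ->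
  exists V, measurable V /\ {ae P, forall o, S o <-> V o}.
Proof.
move=> cS.
have [B [mB SB PB]] := measurable_hull S.
have [C [mC SC PC]] := measurable_hull (~` S).
exists B; split=> //.
have BC1 : P B + P C = 1.
  rewrite PB PC -(probability_setT P) -(measurable_mu_extE P measurableT).
  by have := cS setT; rewrite !setTI => <-.
have BCT : B `|` C = setT.
  apply/seteqP; split=> // x _; have [Sx|nSx] := pselect (S x).
    by left; exact: SB.
  by right; exact: SC.
exists (B `&` C); split; first exact: measurableI.
  have CB : C `\` B = ~` B.
    apply/seteqP; split=> [x []//|x nBx]; split=> //.
    have : (B `|` C) x by rewrite BCT.
    by case.
  have CE : P C = P (C `\` B) + P (C `&` B) := measureDI P mC mB.
  have BE : P (~` B) = 1 - P B := probability_setC P mB.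
  move: BC1; rewrite CE CB BE.
  have : P B \is a fin_num by exact: fin_num_measure.
  have : P (C `&` B) \is a fin_num by apply: fin_num_measure; exact: measurableI.
  rewrite [B `&` C]setIC; case: (P (C `&` B)) => // s _; case: (P B) => // r _.
  by rewrite -EFinB -!EFinD => /eqP; rewrite eqe => /eqP h; congr (_%:E); lra.
move=> x /= nSB.
have [Sx|nSx] := pselect (S x); first by exfalso; apply: nSB; split=> // _; exact: SB.
split; last exact: SC.
by apply: contrapT => nBx; apply: nSB.
Qed.

End completion.

Section integral_version.
Context d (T : measurableType d) (R : realType) (mu : {measure set T -> \bar R}).

Import HBNNSimple.

Let ge0_integral_version (f F : T -> \bar R) : measurable_fun setT F ->
  (forall x, 0 <= f x) -> (forall x, 0 <= F x) ->
  {ae mu, forall x, f x = F x} -> \int[mu]_x f x = \int[mu]_x F x.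
Proof.
move=> mF f0 F0 fF; apply/eqP; rewrite eq_le; apply/andP; split.
  rewrite ge0_integralTE//; apply: ge_ereal_sup => _ [h /= hf <-].
  have -> : sintegral mu h = \int[mu]_x (h x)%:E by rewrite integral_nnsfun// patch_setT.
  apply: ae_ge0_le_integral => //.
  - by move=> x _; rewrite lee_fin.
  - exact/measurable_EFinP.
  - by apply: filterS fF => x fx _; rewrite -fx.
(* Conversely, a simple function below [F] set to zero on the null set [N] lies below [f] at every
   point, as the supremum that defines the integral of the nonmeasurable [f] requires. *)
case: fF => N [mN N0 sN].
rewrite (ge0_negligible_integral mN)// setTD integral_mkcond ge0_integralTE; last first.
  by move=> x; rewrite erestrict_ge0.
rewrite (ge0_integralTE _ f0); apply: ereal_sup_le => _ [h /= hF <-].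
exists h => // x; apply: le_trans (hF x) _; rewrite /patch; case: ifPn => // /set_mem Nx.
by have /contrapT -> : ~ ~ (f x = F x) by move/subsetC: sN => /(_ x Nx).
Qed.

(* The integral of a nonmeasurable f is defined from suprema over simple
   functions below its positive and negative parts. *)
Lemma integral_version (f F : T -> \bar R) : measurable_fun setT F ->
  {ae mu, forall x, f x = F x} -> \int[mu]_x f x = \int[mu]_x F x.
Proof.
move=> mF fF; rewrite integralE [RHS]integralE; congr (_ - _).
- apply: ge0_integral_version => //; first exact: measurable_funepos.
  by apply: filterS fF => x fx; rewrite !funeposE fx.
- apply: ge0_integral_version => //; first exact: measurable_funeneg.
  by apply: filterS fF => x fx; rewrite !funenegE fx.
Qed.

End integral_version.

(** * Times, exit times and path space *)

(** A countable base of the Polish space, pulled back along the Borel isomorphism, separates points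
    because that space is Hausdorff. This makes the equality of two random points of [S] an event,
    and reduces almost sure equality to countably many sets. *)
Lemma standard_borel_separating (R : realType) (S : ptopologicalType) :
  standard_borel R S -> exists C : nat -> set (borel S),
    (forall n, measurable (C n)) /\
    forall x y, (forall n, C n x <-> C n y) -> x = y.
Proof.
case=> Q [hQ [Bs cB [oB bB]] [f [bf mf]]].
have [g injg] : exists g : set Q -> nat, {in Bs &, injective g}.
  exact/countable_injP.
pose D n := [set x | exists B, [/\ Bs B, g B = n & B x]].
have mD n : (measurable : set (set (borel Q))) (D n).
  have [[B [BB gB]]|nB] := pselect (exists B, Bs B /\ g B = n); last first.
    rewrite (_ : D n = set0); first exact: measurable0.
    by apply/seteqP; split=> // x [B [BB gB _]]; apply: nB; exists B.
  rewrite (_ : D n = B).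
    by apply: sub_sigma_algebra; exact: oB.
  apply/seteqP; split=> x; last by move=> Bx; exists B.
  move=> [B' [BB' gB' B'x]]; rewrite (_ : B = B')//.
  by apply: injg; rewrite ?inE// gB gB'.
exists (fun n => f @^-1` D n); split=> [n|x y xy]; first exact/mf.
apply: (bij_inj bf); apply: contrapT => /eqP nfxy.
move: hQ; rewrite open_hausdorff => /(_ _ _ nfxy)[[A A'] /= [fxA fyA] [oA oA' AA']].
have /bB[B [BB Bx] BA] : nbhs (f x) A by apply: open_nbhs_nbhs; split=> //; exact/set_mem.
have /(xy (g B)).1 : D (g B) (f x) by exists B.
case=> B' [BB' gB' B'y].
have B'B : B' = B by apply: injg; rewrite ?inE.
have : (A `&` A') (f y) by split; [apply: BA; rewrite -B'B|exact/set_mem].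
by rewrite (eqP AA').
Qed.

Section time_lemmas.
Context (R : realType) (k : time_kind).
Implicit Types s t u : time R k.

Lemma tv_ge0 t : (0 <= time_val t)%R.
Proof. by move: t; case: k => /= t. Qed.

Lemma tv_inj t s : time_val t = time_val s -> t = s.
Proof.
move: t s; case: k => /= t s; last exact: val_inj.
by move=> /eqP; rewrite eqr_nat => /eqP.
Qed.

Lemma tv0 : time_val (time_zero R k) = 0%R.
Proof. by case: k. Qed.

Lemma tvD s t : time_val (time_add s t) = (time_val s + time_val t)%R.
Proof. by move: s t; case: k => //= s t; rewrite natrD. Qed.

Lemma tv_muln t n : time_val (time_muln t n) = (n%:R * time_val t)%R.
Proof.
elim: n => [|n IH]; first by rewrite mul0r tv0.
by rewrite /time_muln iterS tvD -/(time_muln t n) IH -add1n natrD mulrDl mul1r.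
Qed.

Lemma time_ofK t : time_of k (time_val t) = t.
Proof.
apply: tv_inj; move: t; case: k => /= t; first by rewrite natrK.
by rewrite max_r.
Qed.

Lemma time_of_le0 (x : R) : (x <= 0)%R -> time_of k x = time_zero R k.
Proof.
move=> x0; apply: tv_inj; rewrite tv0; case: k => /=; last by rewrite max_l.
suff -> : Num.truncn x = 0%N by [].
by apply/truncn0Pn; rewrite -ltNge (le_lt_trans x0).
Qed.

Lemma tv_of_nat n : time_val (time_of k (n%:R : R)) = n%:R.
Proof. by case: k => /=; [rewrite natrK|rewrite max_r]. Qed.

Lemma tv_sub s t : (time_val s <= time_val t)%R ->
  time_val (time_of k (time_val t - time_val s)) = (time_val t - time_val s)%R.
Proof.
move: s t; case: k => /= s t st; last by rewrite max_r// subr_ge0.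
by rewrite -natrB ?natrK// -(ler_nat R).
Qed.

Lemma time_le_add s t : (time_val s <= time_val t)%R ->
  exists u, t = time_add s u.
Proof.
move=> st; exists (time_of k (time_val t - time_val s)).
by apply: tv_inj; rewrite tvD tv_sub// addrC subrK.
Qed.

Lemma time_addA s t u : time_add s (time_add t u) = time_add (time_add s t) u.
Proof. by apply: tv_inj; rewrite !tvD addrA. Qed.

Lemma time_add0 t : time_add t (time_zero R k) = t.
Proof. by apply: tv_inj; rewrite tvD tv0 addr0. Qed.

End time_lemmas.

Section exit_lemmas.
Context (R : realType) (k : time_kind) (S : ptopologicalType) (U : set S).
Hypothesis oU : open U.
Implicit Types (w : path_space R k S) (t : time R k).

Lemma exit_le w t : ~ U (w t) -> exit_time U w <= (time_val t)%:E.
Proof. by move=> nU; apply: ereal_inf_lbound; exists t. Qed.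

(** In discrete time the infimum is a minimum. In continuous time, were the path in the open set [U]
    at the infimum [t], right continuity would keep it there until some [t + e], whereas there are
    times outside [U] below [t + e]. *)
Lemma exit_attained w : exit_time U w < +oo ->
  exists t, exit_time U w = (time_val t)%:E /\ ~ U (w t).
Proof.
move=> /ereal_inf_lt[_ [t0 /= nU0 <-] _].
suff [t [nUt ht]] : exists t, ~ U (w t) /\
    forall s, ~ U (w s) -> (time_val t <= time_val s)%R.
  exists t; split=> //; apply/eqP; rewrite eq_le exit_le//=.
  by apply: le_ereal_inf_tmp => _ [s /= nUs <-]; rewrite lee_fin ht.
case: k w t0 nU0 => [w t0 nU0|w t0 nU0].
  have exn : exists n : nat, `[< ~ U (w n) >] by exists t0; exact/asboolP.
  exists (ex_minn exn : time R Discrete); case: ex_minnP => m /asboolP nUm mmin.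
  by split=> // s nUs; rewrite ler_nat mmin//; exact/asboolP.
pose A := [set x : R | exists2 t : {nonneg R}, ~ U (w (t : time R Continuous)) & t%:num = x].
have A0 : A !=set0 by exists t0%:num, t0.
have lA : has_lbound A by exists 0%R => _ [t _ <-].
have i0 : (0 <= inf A)%R by apply: lb_le_inf => // _ [t _ <-].
pose t : time R Continuous := NngNum i0.
have mint s : ~ U (w s) -> (time_val t <= time_val s)%R.
  by move=> nUs; apply: ge_inf => //; exists s.
exists t; split=> // Ut.
have [/= wr _] := path_cadlag w t.
have : nbhs (w t) U by apply: open_nbhs_nbhs.
move=> /wr; rewrite /nbhs/= /at_right /within/= => /nbhs_ballP[e /= e0 We].
have [_ [s nUs <-] se] := inf_adherent e0 (conj A0 lA).
have ts : (time_val t <= s%:num)%R := mint _ nUs.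
apply: nUs; rewrite -(time_ofK (s : time R Continuous)).
move: ts; rewrite le_eqVlt => /orP[/eqP tsE|ts].
  by rewrite (_ : s = t :> time R Continuous) ?time_ofK//; exact: tv_inj.
apply: We => //; rewrite /ball/= ltr0_norm ?subr_lt0// opprB.
by rewrite ltrBlDl.
Qed.

(** The inequality can be strict because the infimum is attained: a path that stays in [U] on all of
    [0, t] cannot have exit time [t]. *)
Lemma exit_gtP w t : (time_val t)%:E < exit_time U w <->
  forall s, (time_val s <= time_val t)%R -> U (w s).
Proof.
split=> [tw s st|h].
  apply: contrapT => /exit_le; apply/negP; rewrite -ltNge.
  by apply: le_lt_trans tw; rewrite lee_fin.
rewrite ltNge; apply/negP => le.
have [|s [sE nUs]] := exit_attained (w := w); first exact: le_lt_trans le (ltry _).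
by apply: nUs; apply: h; rewrite -lee_fin -sE.
Qed.

Lemma exit_ge0 w : 0 <= exit_time U w.
Proof. by apply: le_ereal_inf_tmp => _ [s _ <-]; rewrite lee_fin tv_ge0. Qed.

End exit_lemmas.

Section path_measurability.
Context (R : realType) (k : time_kind) (S : ptopologicalType).
Notation E := (path_space R k S).
Implicit Types (s t u : time R k).

Lemma measurable_path d (T : measurableType d) (f : T -> E) :
  (forall t, measurable_fun setT (fun x => f x t : borel S)) ->
  measurable_fun setT f.
Proof.
move=> mf; apply: (measurability (@cylinders R k S setT)) => // _ [_ [t [B [_ mB ->]]] <-].
exact: mf.
Qed.

Lemma measurable_eval t : measurable_fun setT (fun w : E => w t : borel S).
Proof.
move=> _ B mB; rewrite setTI; apply: sub_sigma_algebra; exists t, B.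
by split.
Qed.

Lemma measurable_shift t : measurable_fun setT (shift t : E -> E).
Proof. by apply: measurable_path => s; exact: measurable_eval. Qed.

Lemma history_sub t : @history R k S t `<=` measurable.
Proof.
apply: smallest_sub; first exact: smallest_sigma_algebra.
by move=> _ [s [B [_ mB ->]]]; apply: sub_sigma_algebra; exists s, B.
Qed.

Lemma history_mono s t : (time_val s <= time_val t)%R ->
  @history R k S s `<=` history t.
Proof.
move=> st; apply: smallest_sub; first exact: smallest_sigma_algebra.
move=> _ [r [B [rs mB ->]]]; apply: sub_sigma_algebra; exists r, B.
by split=> //; exact: le_trans rs st.
Qed.

Lemma history_eval s t (B : set (borel S)) : (time_val s <= time_val t)%R ->
  measurable B -> history t [set w : E | B (w s)].
Proof. by move=> st mB; apply: sub_sigma_algebra; exists s, B. Qed.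

Lemma historyT t : @history R k S t setT.
Proof. exact: (@measurableT _ (g_sigma_algebraType (@cylinders R k S (upto t)))). Qed.

Lemma historyI t : setI_closed (@history R k S t).
Proof.
by move=> A B hA hB; apply: (@measurableI _ (g_sigma_algebraType (cylinders (upto t)))).
Qed.

(** The sets that do not distinguish [w] from [w'] form a sigma-algebra, and it contains the
    generating cylinders. *)
Lemma history_agree t (B : set E) (w w' : E) : history t B ->
  (forall s, (time_val s <= time_val t)%R -> w s = w' s) -> B w <-> B w'.
Proof.
move=> hB ww'; move: hB; rewrite /history => hB.
pose F := [set A : set E | A w <-> A w'].
suff : F B by [].
apply: (smallest_sub _ _ hB) => [|_ [s [C [st mC ->]]]]; last by rewrite /F/= ww'.
split=> [//|A|A hA]; rewrite /F/=.
  by move=> h; split=> -[_ nA]; split=> // /h.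
by split=> -[n _ An]; exists n => //; apply/hA.
Qed.

Lemma history_shift s t (B : set E) : history t B ->
  history (time_add s t) (shift s @^-1` B).
Proof.
pose F := [set A : set E | history (time_add s t) (shift s @^-1` A)].
move=> hB; suff : F B by [].
apply: (smallest_sub _ _ hB) => [|_ [r [C [rt mC ->]]]].
  pose H := g_sigma_algebraType (@cylinders R k S (upto (time_add s t))).
  split=> [|A hA|A hA]; rewrite /F/=.
  - by rewrite preimage_set0; exact: (@measurable0 _ H).
  - by rewrite setTD preimage_setC; exact: (@measurableC _ H).
  - by rewrite preimage_bigcup; by apply: sigma_algebra_bigcup => i; exact: hA.
rewrite /F/=; apply: (history_eval (s := time_add s r)) => //.
by rewrite !tvD lerD2l.
Qed.

(** A generating pi-system adapted to pasted paths: with [t] the length of a fragment, [A1] only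
    sees the piece of the copy and [A2] only sees the prolongation. *)
Definition split_sets t : set (set E) :=
  [set H | exists A1 A2, [/\ history t A1, measurable A2 &
     H = A1 `&` shift t @^-1` A2]].

Lemma split_setsE t : (measurable : set (set E)) = <<s split_sets t >>.
Proof.
apply/seteqP; split.
  apply: smallest_sub; first exact: smallest_sigma_algebra.
  move=> _ [s [B [_ mB ->]]]; apply: sub_sigma_algebra.
  have [st|ts] := leP (time_val s) (time_val t).
    exists [set w : E | B (w s)], setT; split=> //; first exact: history_eval.
    by rewrite preimage_setT setIT.
  have [u ->] := time_le_add (ltW ts).
  exists setT, [set w : E | B (w u)]; split=> //; first exact: historyT.
    by rewrite -[X in measurable X]setTI; exact: measurable_eval.
  by rewrite setTI.
apply: sub_generated_measurable => _ [A1 [A2 [hA1 mA2 ->]]].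
apply: measurableI; first exact: (history_sub hA1).
by rewrite -[X in measurable X]setTI; exact: measurable_shift.
Qed.

Lemma split_setsI t : setI_closed (split_sets t).
Proof.
move=> _ _ [A1 [A2 [hA1 mA2 ->]]] [B1 [B2 [hB1 mB2 ->]]].
exists (A1 `&` B1), (A2 `&` B2); split; first exact: historyI.
  exact: measurableI.
by rewrite preimage_setI setIACA.
Qed.

Lemma split_setsT t : split_sets t setT.
Proof. by exists setT, setT; split=> //; [exact: historyT|rewrite preimage_setT setIT]. Qed.

(** Progressive measurability on each [0, n], and a union over [n]; negative reals are treated
    apart, as [time_of] sends them to time 0. This makes X(T) a random variable and gives access to
    Tonelli for occupation integrals. *)
Lemma measurable_joint_eval (K : R.-pker (borel S) ~> E) : strong_markov K ->
  measurable_fun setT (fun xw : R * E => xw.2 (time_of k xw.1) : borel S).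
Proof.
move=> sK _ B mB; rewrite setTI.
pose D n : set (R * E) := [set x | (0 <= x <= n%:R)%R] `*` setT.
pose f (xw : R * E) := xw.2 (time_of k xw.1) : borel S.
have mI n : measurable [set x : R | (0 <= x <= n%:R)%R].
  rewrite (_ : [set _ | _] = [set` `[0%R, n%:R]]); first exact: measurable_itv.
  by apply/seteqP; split=> x /=; rewrite in_itv.
have mD n : measurable (D n `&` f @^-1` B).
  pose t := time_of k (n%:R : R); pose H := g_sigma_algebraType (@cylinders R k S (upto t)).
  have mid : measurable_fun setT (fun xw : R * E => (xw.1, xw.2 : H)).
    apply: measurable_fun_pair => // mT A mA.
    have mA' : measurable (A : set E) by exact: (@history_sub t).
    exact: (measurable_snd mT _ mA').
  have := @strong_markov_progressive _ _ _ _ sK t; rewrite tv_of_nat => mf.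
  have mD' : measurable ([set x : R | (0 <= x <= n%:R)%R] `*` [set: H]).
    by apply: measurableX.
  have := mid measurableT _ (mf mD' B mB); rewrite setTI.
  by [].
have mN : measurable ([set xw : R * E | (xw.1 < 0)%R] `&` [set xw : R * E | B (xw.2 (time_zero R k))]).
  apply: measurableI.
    rewrite (_ : [set _ | _] = setT `&` fst @^-1` [set` `]-oo, 0%R[]).
      by apply: measurable_fst.
    by apply/seteqP; split=> -[x w] /=; rewrite in_itv //= => -[].
  rewrite -[X in measurable X]setTI.
  exact: (measurableT_comp (@measurable_eval (time_zero R k)) measurable_snd).
rewrite (_ : _ @^-1` B = (\bigcup_n (D n `&` f @^-1` B)) `|`
  ([set xw : R * E | (xw.1 < 0)%R] `&` [set xw : R * E | B (xw.2 (time_zero R k))])).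
  by apply: measurableU => //; exact: bigcup_measurable.
apply/seteqP; split=> [[x w] /= Bx|[x w]].
  have [x0|x0] := leP 0%R x; last by right; split=> //; rewrite time_of_le0// ltW in Bx.
  left; exists (Num.truncn x).+1 => //; split=> //; split=> //=.
  by rewrite x0/= ltW// truncnS_gt.
by case=> [[n _ []]//|/= [x0]]; rewrite time_of_le0// ltW.
Qed.

End path_measurability.

Definition glue (R : realType) (k : time_kind) (S : ptopologicalType)
    (D : time R k) (w z : path_space R k S) (t : time R k) : S :=
  if (time_val t <= time_val D)%R then w t
  else z (time_of k (time_val t - time_val D)).

Section concatenation.
Context (R : realType) (k : time_kind) (S : ptopologicalType).
Notation E := (path_space R k S).

(** The junction is the delicate time: there the left limit comes from [w] and the right limit from
    [z], and the assumption on the start of [z] matches the latter with the value [w D]. *)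
Lemma cadlag_glue (D : time R k) (w z : E) :
  z (time_zero R k) = w D -> cadlag (glue D w z).
Proof.
rewrite /cadlag; move: D w z; case: k => // D w z zw t.
have gE (x : R) : (0 <= x)%R -> glue D w z (time_of Continuous x) =
    if (x <= D%:num)%R then w (time_of Continuous x)
    else z (time_of Continuous (x - D%:num)).
  move=> x0; have xE : time_val (time_of Continuous x) = x by rewrite /= max_r.
  by rewrite /glue xE.
have [wr wl] := path_cadlag w t.
have cs : continuous (fun x : R => x - D%:num)%R.
  by move=> x; apply: cvgB; [exact: cvg_id|exact: cvg_cst].
have zshift (V : set S) (u : time R Continuous) :
    time_val u = (t%:num - D%:num)%R -> nbhs (z u) V ->
    \forall x \near t%:num, (t%:num < x)%R ->
      V (z (time_of Continuous (x - D%:num))).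
  move=> ut Vu; have [zr _] := path_cadlag z u.
  move: Vu => /zr; rewrite /nbhs/= /at_right /within/= -/(time_val u) ut => /cs h.
  have {}h : \forall x \near t%:num, (t%:num - D%:num < x - D%:num)%R ->
      V (z (time_of Continuous (x - D%:num))) := h.
  by apply: filterS h => x h tx; apply: h; rewrite ltrD2r.
have zshiftl (V : set S) (u : time R Continuous) (l : S) :
    time_val u = (t%:num - D%:num)%R ->
    (fun x : R => z (time_of Continuous x)) @ (time_val u)^'- --> l -> nbhs l V ->
    \forall x \near t%:num, (x < t%:num)%R ->
      V (z (time_of Continuous (x - D%:num))).
  move=> ut zl /zl; rewrite /nbhs/= /at_left /within/= -/(time_val u) ut => /cs h.
  have {}h : \forall x \near t%:num, (x - D%:num < t%:num - D%:num)%R ->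
      V (z (time_of Continuous (x - D%:num))) := h.
  by apply: filterS h => x h tx; apply: h; rewrite ltrD2r.
have wr' (V : set S) : nbhs (w t) V -> \forall x \near t%:num, (t%:num < x)%R ->
    V (w (time_of Continuous x)).
  by move=> /wr; rewrite /nbhs/= /at_right /within.
have wl' : (0 < t%:num)%R -> exists l : S, forall V : set S, nbhs l V ->
    \forall x \near t%:num, (x < t%:num)%R -> V (w (time_of Continuous x)).
  move=> t0; have [l hl] := wl t0; exists l => V /hl; by rewrite /nbhs/= /at_left /within.
suff [gr gl] : (forall V : set S, nbhs (glue D w z t) V ->
      \forall x \near t%:num, (t%:num < x)%R -> V (glue D w z (time_of Continuous x))) /\
    ((0 < t%:num)%R -> exists l : S, forall V : set S, nbhs l V ->
      \forall x \near t%:num, (x < t%:num)%R -> V (glue D w z (time_of Continuous x))).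
  split; first by move=> V /gr; rewrite /nbhs/= /at_right /within.
  by move=> t0; have [l h] := gl t0; exists l => V /h; rewrite /nbhs/= /at_left /within.
have [tD|Dt|tD] := ltgtP t%:num D%:num.
- have near_le : \forall x \near t%:num, (x <= D%:num)%R.
    by near=> x; apply: ltW; near: x; exact: lt_nbhsl.
  split.
    have -> : glue D w z t = w t by rewrite /glue ifT// ltW.
    move=> V /wr' wV; near=> x => tx.
    have xD : (x <= D%:num)%R by near: x.
    by rewrite gE ?(le_trans _ (ltW tx))// xD; apply: (near wV x).
  move=> t0; have [l hl] := wl' t0; exists l => V /hl wV.
  near=> x => tx.
  have xD : (x <= D%:num)%R by near: x.
  have x0 : (0 <= x)%R by apply: ltW; near: x; exact: lt_nbhsr.
  by rewrite gE// xD; apply: (near wV x).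
- pose u := time_of Continuous (t%:num - D%:num).
  have ut : time_val u = (t%:num - D%:num)%R by rewrite /= max_r// subr_ge0 ltW.
  have near_gt : \forall x \near t%:num, (D%:num < x)%R by exact: lt_nbhsr.
  split.
    have -> : glue D w z t = z u by rewrite /glue ifF//; apply/negbTE; rewrite -ltNge.
    move=> V /(zshift V u ut) zV; near=> x => tx.
    have Dx : (D%:num < x)%R by near: x.
    by rewrite gE ?(le_trans _ (ltW tx))// leNgt Dx/=; apply: (near zV x).
  move=> t0; have [_ zl] := path_cadlag z u.
  have [|l zl'] := zl; first by rewrite ut subr_gt0.
  exists l => V /(zshiftl V u l ut zl') zV; near=> x => tx.
  have Dx : (D%:num < x)%R by near: x.
  by rewrite gE ?(le_trans _ (ltW Dx))// leNgt Dx/=; apply: (near zV x).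
split.
  have -> : glue D w z t = z (time_zero R Continuous).
    have -> : t = D by apply: val_inj.
    by rewrite zw /glue lexx.
  have u0 : time_val (time_zero R Continuous) = (t%:num - D%:num)%R.
    by rewrite tv0 tD subrr.
  move=> V /(zshift V _ u0) zV; near=> x => tx.
  by rewrite gE ?(le_trans _ (ltW tx))// leNgt -tD tx/= tD; apply: (near zV x).
move=> t0; have [l hl] := wl' t0; exists l => V /hl wV.
near=> x => tx.
have x0 : (0 <= x)%R by apply: ltW; near: x; exact: lt_nbhsr.
by rewrite gE// -tD ltW//; apply: (near wV x).
Unshelve. all: by end_near. Qed.

Variable (D : time R k).

(* The pasted path requires z to start at w D.  Otherwise, w is frozen at time D. *)
Definition continuation (w z : E) : E :=
  if `[< z (time_zero R k) = w D >] then z else Path (@cadlag_cst R k S (w D)).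

Lemma continuation0 (w z : E) : continuation w z (time_zero R k) = w D.
Proof. by rewrite /continuation; case: asboolP. Qed.

Definition concat (w z : E) : E := Path (cadlag_glue (continuation0 w z)).

Lemma concat_le (w z : E) t : (time_val t <= time_val D)%R -> concat w z t = w t.
Proof. by move=> tD; rewrite /concat /= /glue tD. Qed.

Lemma concat_gt (w z : E) t : (time_val D < time_val t)%R -> concat w z t =
  if `[< z (time_zero R k) = w D >]
  then z (time_of k (time_val t - time_val D)) else w D.
Proof. by move=> Dt; rewrite /concat /= /glue leNgt Dt/= /continuation; case: asboolP. Qed.

Lemma shift_concat (w z : E) : z (time_zero R k) = w D ->
  forall t, shift D (concat w z) t = z t.
Proof.
move=> zw t; rewrite /shift/=; have [t0|t0] := leP (time_val t) 0%R.
  have -> : t = time_zero R k.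
    by apply: tv_inj; rewrite tv0; apply/eqP; rewrite eq_le t0 tv_ge0.
  by rewrite /glue time_add0 lexx.
rewrite /glue tvD leNgt ltrDl t0/= /continuation asboolT//.
by rewrite addrAC subrr add0r time_ofK.
Qed.

End concatenation.

(** * Ionescu-Tulcea extension *)

Section pullback_kernel.
Context d1 d2 d3 (X : measurableType d1) (Y : measurableType d2)
  (Z : measurableType d3) (R : realType).
Variables (f : X -> Y) (k : R.-pker Y ~> Z).

Definition pullback_kernel (mf : measurable_fun setT f) (x : X)
  : {measure set Z -> \bar R} := k (f x).

Hypothesis mf : measurable_fun setT f.

Let pullback_kernel_measurable A : measurable A ->
  measurable_fun setT (pullback_kernel mf ^~ A).
Proof. by move=> mA; exact: (measurableT_comp (measurable_kernel k _ mA) mf). Qed.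

HB.instance Definition _ := isKernel.Build _ _ _ _ _ (pullback_kernel mf)
  pullback_kernel_measurable.

Let pullback_kernel_prob x : pullback_kernel mf x setT = 1.
Proof. exact: prob_kernel. Qed.

HB.instance Definition _ := Kernel_isProbability.Build _ _ _ _ _
  (pullback_kernel mf) pullback_kernel_prob.

End pullback_kernel.

Lemma nonincreasing_cvg0 (R : realType) (u : (\bar R)^nat) :
  (forall n, 0 <= u n) -> (forall n m, (n <= m)%N -> u m <= u n) ->
  ~ (exists e : R, (0 < e)%R /\ forall n, e%:E <= u n) -> u n @[n --> \oo] --> 0.
Proof.
move=> u0 nu h.
have nu' : nonincreasing_seq u by move=> n m; exact: nu.
have := ereal_nonincreasing_cvgn nu'.
suff -> : ereal_inf (range u) = 0 by [].
apply/eqP; rewrite eq_le; apply/andP; split; last first.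
  by apply: le_ereal_inf_tmp => _ [n _ <-].
apply/lee_addgt0Pr => e e0; rewrite add0e.
have [n un] : exists n, u n < e%:E.
  apply: contrapT => nex; apply: h; exists e; split=> // n.
  by rewrite leNgt; apply/negP => un; apply: nex; exists n.
by apply: le_trans (ltW un); apply: ereal_inf_lbound; exists n.
Qed.

Lemma cvg_integral0 d (T : measurableType d) (R : realType)
    (mu : {measure set T -> \bar R}) (u : nat -> T -> \bar R) :
  mu setT < +oo ->
  (forall n x, 0 <= u n x <= 1) -> (forall n, measurable_fun setT (u n)) ->
  (forall x, u n x @[n --> \oo] --> 0) -> \int[mu]_x u n x @[n --> \oo] --> 0.
Proof.
move=> muoo u01 mu_ u0.
have -> : 0 = \int[mu]_x (cst 0 x) :> \bar R by rewrite integral0.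
apply: (@dominated_cvg _ _ _ mu setT measurableT u (cst 0) (cst 1)) => //.
- by move=> x _; exact: u0.
- apply/integrableP; split; first exact: measurable_cst.
  under eq_integral do rewrite /= normr1.
  by rewrite integral_cst// mul1e.
- by move=> n x _; have /andP[u0' u1] := u01 n x; rewrite gee0_abs.
Qed.

Section sequence_extension.
Context d (O : measurableType d) d' (E : measurableType d').

Definition seq_ext_sets : set (set (O * (nat -> E))%type) :=
  [set A | (exists2 G : set O, measurable G & A = fst @^-1` G) \/
    exists n (B : set E), measurable B /\ A = [set x | B (x.2 n)]].

Definition seq_ext := g_sigma_algebraType seq_ext_sets.

(** The codomain is arbitrary so that sets, seen as predicates, and numerical functions are covered
    alike. *)
Definition determined (T : Type) (m : nat) (f : O * (nat -> E) -> T) :=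
  forall x y, x.1 = y.1 -> (forall i, (i < m)%N -> x.2 i = y.2 i) -> f x = f y.

(* A copy of seq_ext whose measurable sets are only those determined by finitely many
   coordinates, on which the measure to be extended is defined. *)
Definition seq_ext_alg : Type := (O * (nat -> E))%type.

HB.instance Definition _ := Pointed.on seq_ext_alg.

Definition finitely_determined : set (set seq_ext_alg) :=
  [set A | measurable (A : set seq_ext) /\ exists m, determined m (A : _ -> Prop)].

Let finitely_determined0 : finitely_determined set0.
Proof. by split; [exact: measurable0|exists 0%N]. Qed.

Let finitely_determinedU : setU_closed finitely_determined.
Proof.
move=> A B [mA [m dA]] [mB [n dB]]; split; first exact: measurableU.
exists (maxn m n) => x y xy h; rewrite /setU/=; congr (_ \/ _).
  by apply: dA => // i im; apply: h; rewrite leq_max im.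
by apply: dB => // i im; apply: h; rewrite leq_max im orbT.
Qed.

Let finitely_determinedD : setD_closed finitely_determined.
Proof.
move=> A B [mA [m dA]] [mB [n dB]]; split; first exact: measurableD.
exists (maxn m n) => x y xy h; rewrite /setD/=; congr (_ /\ ~ _).
  by apply: dA => // i im; apply: h; rewrite leq_max im.
by apply: dB => // i im; apply: h; rewrite leq_max im orbT.
Qed.

Definition seq_ext_alg_display : measure_display. Proof. by constructor. Qed.

HB.instance Definition _ := @isRingOfSets.Build seq_ext_alg_display seq_ext_alg
  finitely_determined finitely_determined0 finitely_determinedU finitely_determinedD.

Lemma measurable_seq_ext_fst : measurable_fun setT (fst : seq_ext -> O).
Proof.
by move=> _ G mG; rewrite setTI; apply: sub_sigma_algebra; left; exists G.
Qed.

Lemma measurable_seq_ext_coord n : measurable_fun setT (fun x : seq_ext => x.2 n).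
Proof.
by move=> _ G mG; rewrite setTI; apply: sub_sigma_algebra; right; exists n, G.
Qed.

Definition upd (x : seq_ext) n (e : E) : seq_ext :=
  (x.1, fun i => if i == n then e else x.2 i).

Lemma measurable_into_seq_ext d0 (T : measurableType d0) (f : T -> seq_ext) :
  measurable_fun setT (fun t => (f t).1) ->
  (forall n, measurable_fun setT (fun t => (f t).2 n)) -> measurable_fun setT f.
Proof.
move=> mf1 mf2.
apply: (@measurability _ _ _ (seq_ext : measurableType _) _ _ seq_ext_sets) => //.
by move=> _ [A [[G mG ->]|[i [B [mB ->]]]] <-]; [exact: mf1|exact: mf2].
Qed.

Lemma measurable_upd n : measurable_fun setT (fun xe : seq_ext * E => upd xe.1 n xe.2).
Proof.
apply: measurable_into_seq_ext => [|i] /=.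
  exact: (measurableT_comp measurable_seq_ext_fst measurable_fst).
case: (i == n); first exact: measurable_snd.
exact: (measurableT_comp (measurable_seq_ext_coord i) measurable_fst).
Qed.

Lemma measurable_upd_point x n : measurable_fun setT (upd x n).
Proof. exact: (measurableT_comp (measurable_upd n) (measurable_pair1 x)). Qed.

End sequence_extension.

Section ionescu_tulcea.
Context d (O : measurableType d) d' (E : measurableType d') (R : realType).
Context (P : probability O R) (kap : nat -> R.-pker O ~> E).
Notation W := (seq_ext O E).
Implicit Types (f g : W -> \bar R) (x y : W) (A B : set (seq_ext_alg O E)).

Definition avg n f x : \bar R := \int[kap n x.1]_e f (upd x n e).

(** Integrates out the coordinates [j], ..., [j + k - 1], the last one first. Each kernel sees the
    base point only. *)
Fixpoint avgs k j f : W -> \bar R :=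
  if k is k'.+1 then avg j (avgs k' j.+1 f) else f.

Let nnmeas f := (forall x, 0 <= f x) /\ measurable_fun setT f.

Let avg_nnmeas n f : nnmeas f -> nnmeas (avg n f).
Proof.
move=> [f0 mf]; split; first by move=> x; exact: integral_ge0.
pose K := pullback_kernel (kap n) (@measurable_seq_ext_fst _ O _ E).
apply: (measurable_fun_integral_sfinite_kernel (fun xe : W * E => f (upd xe.1 n xe.2)) K).
  by move=> [x e].
exact: (measurableT_comp mf (measurable_upd n)).
Qed.

Let avgs_nnmeas k j f : nnmeas f -> nnmeas (avgs k j f).
Proof. by elim: k j => //= k IH j /(IH j.+1)/avg_nnmeas. Qed.

Let measurable_slice f x n : measurable_fun setT f ->
  measurable_fun setT (fun e => f (upd x n e)).
Proof. by move=> mf; exact: (measurableT_comp mf (measurable_upd_point x n)). Qed.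

Let avg_le n f g : nnmeas f -> nnmeas g -> (forall x, f x <= g x) ->
  forall x, avg n f x <= avg n g x.
Proof.
move=> [f0 mf] [g0 mg] fg x; apply: ge0_le_integral => //;
by [exact: measurable_slice|move=> e _; exact: fg].
Qed.

Let avgs_le k j f g : nnmeas f -> nnmeas g -> (forall x, f x <= g x) ->
  forall x, avgs k j f x <= avgs k j g x.
Proof.
move=> nf ng fg; elim: k j => //= k IH j x.
by apply: avg_le => // *; apply: avgs_nnmeas.
Qed.

Let avg_cst n f x c : (forall e, f (upd x n e) = c) -> avg n f x = c.
Proof.
move=> h; rewrite /avg (eq_integral (cst c)); last by move=> e _; rewrite h.
by rewrite integral_cst//= prob_kernel mule1.
Qed.

Let avgs_le1 k j f : nnmeas f -> (forall x, f x <= 1) -> forall x, avgs k j f x <= 1.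
Proof.
move=> nf f1; elim: k j => //= k IH j x.
rewrite -(@avg_cst j (cst 1) x 1)//; apply: avg_le => //.
exact: avgs_nnmeas.
Qed.

Let determined_le T (m n : nat) (f : O * (nat -> E) -> T) :
  determined m f -> (m <= n)%N -> determined n f.
Proof. by move=> df mn x y xy h; apply: df => // i im; apply: h; exact: leq_trans mn. Qed.

Let avg_id m j f : determined m f -> (m <= j)%N -> avg j f = f.
Proof.
move=> df mj; apply/funext => x; apply: avg_cst => e; apply: df => //= i im.
by rewrite ltn_eqF// (leq_trans im).
Qed.

Let avg_determined j f : determined j.+1 f -> determined j (avg j f).
Proof.
move=> df x y xy h; rewrite /avg xy; apply: eq_integral => e _.
apply: df => //= i; rewrite ltnS leq_eqVlt => /orP[/eqP ->|ij]; first by rewrite eqxx.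
by rewrite ltn_eqF// h.
Qed.

Let avgs_determined k j f : determined (j + k) f -> determined j (avgs k j f).
Proof.
elim: k j => [|k IH] j; first by rewrite addn0.
by rewrite addnS -addSn => /IH/avg_determined.
Qed.

Let avgsS k j f m : determined m f -> (m <= j + k)%N -> avgs k.+1 j f = avgs k j f.
Proof.
move=> df; elim: k j => [|k IH] j mjk; first by rewrite addn0 in mjk; exact: avg_id mjk.
by rewrite -[LHS]/(avg j (avgs k.+1 j.+1 f)) IH// addSn -addnS.
Qed.

Let avgs_stable k k' j f m : determined m f -> (m <= j + k)%N -> (k <= k')%N ->
  avgs k' j f = avgs k j f.
Proof.
move=> df mjk /subnK <-; elim: (k' - k)%N => // n IH.
by rewrite addSn (avgsS df) ?IH// (leq_trans mjk)// leq_add2l leq_addl.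
Qed.

Let avgs_id k j f m : determined m f -> (m <= j)%N -> avgs k j f = f.
Proof.
by move=> df mj; rewrite (@avgs_stable 0 k j f m)// addn0.
Qed.

Let avgsD k j f g : nnmeas f -> nnmeas g ->
  avgs k j (f \+ g) = avgs k j f \+ avgs k j g.
Proof.
move=> nf ng; elim: k j => //= k IH j; rewrite IH; apply/funext => x.
have [f0 mf] := avgs_nnmeas k j.+1 nf; have [g0 mg] := avgs_nnmeas k j.+1 ng.
by rewrite /avg ge0_integralD//; exact: measurable_slice.
Qed.

Let x0 (o : O) : W := (o, fun=> point).

Let measurable_x0 : measurable_fun setT x0.
Proof. by apply: measurable_into_seq_ext => [|n]; [exact: measurable_id|exact: measurable_cst]. Qed.

Let ind A : W -> \bar R := fun x => (\1_A x)%:E.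

Let ind_nnmeas A : measurable (A : set W) -> nnmeas (ind A).
Proof.
by move=> mA; split=> [x|]; [rewrite lee_fin|exact/measurable_EFinP/measurable_indic].
Qed.

Let ind_determined m A : determined m (A : _ -> Prop) -> determined m (ind A).
Proof. move=> dA x y xy h; rewrite /ind !indicE; congr (_%:R%:E).
have AE := dA x y xy h; congr nat_of_bool.
by apply/idP/idP => /set_mem Ax; apply/mem_set; rewrite ?AE// -AE.
Qed.

(** Some number of coordinates that determine [A], not the least one; by [seq_ext_contentE] any such
    number yields the same content. *)
Let height A := xget 0%N [set m | determined m (A : _ -> Prop)].

Definition seq_ext_content A : \bar R := \int[P]_o avgs (height A) 0 (ind A) (x0 o).

Let height_determined A : measurable A -> determined (height A) (ind A).
Proof. by move=> [_ [m dA]]; apply: ind_determined; by apply: (@xgetPex _ 0%N [set m | determined m (A : _ -> Prop)]); exists m. Qed.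

Let seq_ext_contentE m A : measurable A -> determined m (ind A) ->
  seq_ext_content A = \int[P]_o avgs m 0 (ind A) (x0 o).
Proof.
move=> mA dA; have dh := height_determined mA; rewrite /seq_ext_content.
rewrite -(@avgs_stable (height A) (maxn m (height A)) _ _ _ dh) ?leq_maxr//.
by rewrite (@avgs_stable m _ _ _ _ dA) ?leq_maxl.
Qed.

Let seq_ext_content0 : seq_ext_content set0 = 0.
Proof.
rewrite (@seq_ext_contentE 0)//.
by apply: integral0_eq => o _; rewrite /= /ind indic0.
Qed.

Let seq_ext_content_ge0 A : 0 <= seq_ext_content A.
Proof.
apply: integral_ge0 => o _; have : forall x, 0 <= ind A x by move=> x; rewrite lee_fin.
move: (height A) 0%N (ind A) (x0 o) => k; elim: k => //= k IH j f x f0.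
by apply: integral_ge0 => e _; exact: IH.
Qed.

Let comp_x0 f : nnmeas f -> measurable_fun setT (f \o x0).
Proof. by case=> _ mf; exact: (measurableT_comp mf measurable_x0). Qed.

Let seq_ext_contentU A B : measurable A -> measurable B -> A `&` B = set0 ->
  seq_ext_content (A `|` B) = seq_ext_content A + seq_ext_content B.
Proof.
move=> mA mB AB; have mAB := measurableU _ _ mA mB.
pose M := maxn (height (A `|` B)) (maxn (height A) (height B)).
have dAB : determined M (ind (A `|` B)).
  by apply: determined_le (height_determined mAB) _; rewrite leq_maxl.
have dA : determined M (ind A).
  by apply: determined_le (height_determined mA) _; rewrite !leq_max leqnn orbT.
have dB : determined M (ind B).
  by apply: determined_le (height_determined mB) _; rewrite !leq_max leqnn !orbT.
rewrite !(@seq_ext_contentE M)//.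
have -> : ind (A `|` B) = ind A \+ ind B.
  apply/funext => x; rewrite /ind !indicE -EFinD; congr (_%:E).
  rewrite in_setU; have : ~ (A x /\ B x) by move=> h; rewrite -[False]/(set0 x) -AB.
  case: (boolP (x \in A)) => [/set_mem Ax|_]; case: (boolP (x \in B)) => [/set_mem Bx|_] //=.
  - by case; split.
  - by rewrite addr0.
  - by rewrite add0r.
  - by rewrite addr0.
rewrite avgsD; [|exact: ind_nnmeas mA.1|exact: ind_nnmeas mB.1].
have nA := avgs_nnmeas M 0 (ind_nnmeas mA.1); have nB := avgs_nnmeas M 0 (ind_nnmeas mB.1).
rewrite ge0_integralD//.
- by move=> o _; case: nA.
- exact: comp_x0.
- by move=> o _; case: nB.
- exact: comp_x0.
Qed.

(** The heart of the extension theorem. If at every base point the averages of the indicators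
    decrease to 0, dominated convergence concludes. Otherwise they stay above some e > 0 at one base
    point; by dominated convergence again, coordinates can be chosen one by one so that a positive
    lower bound persists, and the resulting point lies in every [B n]. *)
Let seq_ext_content_cvg0 (B : nat -> set (seq_ext_alg O E)) :
  (forall n, measurable (B n)) -> (forall n m, (n <= m)%N -> B m `<=` B n) ->
  \bigcap_n B n = set0 -> seq_ext_content (B n) @[n --> \oo] --> 0.
Proof.
move=> mB nB B0; pose m n := height (B n); pose g n j := avgs (m n) j (ind (B n)).
have dB n : determined (m n) (ind (B n)) by exact: height_determined.
have nBi n : nnmeas (ind (B n)) by exact: ind_nnmeas (mB n).1.
have ng n j : nnmeas (g n j) by exact: avgs_nnmeas.
have g01 n j x : 0 <= g n j x <= 1.
  rewrite (ng n j).1 andTb avgs_le1// => y.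
  by rewrite /ind indicE lee_fin lern1 leq_b1.
have gS n j : avg j (g n j.+1) = g n j.
  rewrite -[LHS]/(avgs (m n).+1 j (ind (B n))).
  by rewrite (@avgs_stable (m n) _ _ _ _ (dB n)) ?leq_addl.
have gle n n' j x : (n <= n')%N -> g n' j x <= g n j x.
  move=> nn'; pose M := maxn (m n) (m n').
  rewrite /g -(@avgs_stable (m n) M _ _ _ (dB n)) ?leq_addl ?leq_maxl//.
  rewrite -(@avgs_stable (m n') M _ _ _ (dB n')) ?leq_addl ?leq_maxr//.
  apply: avgs_le => // y; rewrite /ind !indicE lee_fin ler_nat.
  by case: (boolP (y \in B n')) => // /set_mem/(nB _ _ nn')/mem_set ->.
have gd n j : determined j (g n j).
  by apply: avgs_determined; apply: determined_le (dB n) _; rewrite leq_addl.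
(* The bound is uniform in [n] but may get smaller at each choice of a coordinate; positivity at
   each stage suffices, since each [B n] is reached after finitely many choices. *)
pose pos j x := exists e : R, (0 < e)%R /\ forall n, e%:E <= g n j x.
have [|npos] := pselect (exists om, pos 0%N (x0 om)); last first.
  apply: (@cvg_integral0 _ _ _ P (fun n o => g n 0%N (x0 o))) => // [|n|o].
    exact: le_lt_trans (probability_le1 P measurableT) (ltry _).
    exact: comp_x0.
  apply: nonincreasing_cvg0 => [n|n n' nn'|h]; first by case/andP: (g01 n 0%N (x0 o)).
    exact: gle.
  by apply: npos; exists o.
case=> om pos_o.
have posS j x : pos j x -> exists e, pos j.+1 (upd x j e).
  move=> [eps [e0 he]]; apply: contrapT => nex.
  have : \int[kap j x.1]_e g n j.+1 (upd x j e) @[n --> \oo] --> 0.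
    apply: cvg_integral0 => // [|n|e]; first by apply: (@le_lt_trans _ _ 1); rewrite ?prob_kernel ?ltry.
      exact: measurable_slice (ng n j.+1).2.
    apply: nonincreasing_cvg0 => [n|n n' nn'|h].
    - by case/andP: (g01 n j.+1 (upd x j e)).
    - exact: gle.
    - by apply: nex; exists e.
  move=> h; have : eps%:E <= 0.
    rewrite -(cvg_lim (@ereal_hausdorff R) h).
    apply: lime_ge; first exact: cvgP h.
    by apply: nearW => n; rewrite -[leRHS]/(avg j (g n j.+1) x) gS.
  by rewrite lee_fin leNgt e0.
have /choice[c hc] : forall jx : nat * W, exists e, pos jx.1 jx.2 ->
    pos jx.1.+1 (upd jx.2 jx.1 e).
  move=> [j x]; have [/posS[e he]|npx] := pselect (pos j x); first by exists e.
  by exists point.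
pose xs := fix xs j := if j is j'.+1 then upd (xs j') j' (c (j', xs j')) else x0 om.
have pos_xs j : pos j (xs j) by elim: j => //= j IH; exact: (hc (j, xs j)).
have xs1 j : (xs j).1 = om by elim: j.
pose z : W := (om, fun i => (xs i.+1).2 i).
have xsz j i : (i < j)%N -> (xs j).2 i = z.2 i.
  elim: j => // j IH; rewrite ltnS leq_eqVlt => /orP[/eqP ->//|ij] /=.
  by rewrite (ltn_eqF ij) IH.
(* Once [m n] coordinates are fixed, averaging no longer acts: the positive lower bound bears on the
   indicator of [B n] itself, at a point which agrees with [z] on the coordinates that matter. *)
suff : (\bigcap_n B n) z by rewrite B0.
move=> n _; have [e [e0 /(_ n)]] := pos_xs (m n).
rewrite /g (avgs_id _ (dB n))//= (dB n _ z)//; last exact: xsz.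
rewrite /ind indicE; case: (boolP (z \in B n)) => [/set_mem//|_].
by rewrite lee_fin leNgt e0.
Qed.

(** Finite additivity and continuity at the empty set, the latter applied to the decreasing
    remainders [U] minus [D n]. *)
Let seq_ext_content_sigma_additive : semi_sigma_additive seq_ext_content.
Proof.
move=> F mF tF mU; set U := \bigcup_n F n.
pose D n := \big[setU/set0]_(i < n) F i.
have mD n : measurable (D n) by exact: bigsetU_measurable.
have DE n : seq_ext_content (D n) = \sum_(0 <= i < n) seq_ext_content (F i).
  elim: n => [|n IH]; first by rewrite /D big_ord0 big_nil seq_ext_content0.
  rewrite /D big_ord_recr/= seq_ext_contentU//; first by rewrite big_nat_recr//= -IH.
    exact: mD.
  apply/seteqP; split=> // x []; rewrite -bigcup_mkord => -[i /= ni Fi] Fn.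
  move/trivIsetP : tF => /(_ i n I I); rewrite (ltn_eqF ni) => /(_ isT).
  by move=> /seteqP[+ _]; apply; split; [exact: Fi|exact: Fn].
have UE n : seq_ext_content U = seq_ext_content (D n) + seq_ext_content (U `\` D n).
  rewrite -seq_ext_contentU//; [|exact: measurableD|by rewrite setDIK].
  rewrite setDUK// /D -bigcup_mkord; by move=> x [i _ Fi]; exists i.
have cU : seq_ext_content U \is a fin_num.
  rewrite ge0_fin_numE// (@le_lt_trans _ _ 1) ?ltry// -(probability_setT P).
  rewrite -[leRHS]mul1e -integral_cst//; apply: ge0_le_integral => //.
  - by move=> om _; exact: (avgs_nnmeas _ _ (ind_nnmeas mU.1)).1.
  - exact: comp_x0 (avgs_nnmeas _ _ (ind_nnmeas mU.1)).
  - move=> om _; apply: avgs_le1; first exact: ind_nnmeas mU.1.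
    by move=> y; rewrite /ind indicE lee_fin lern1 leq_b1.
have cD n : seq_ext_content (U `\` D n) \is a fin_num.
  rewrite ge0_fin_numE//; move: cU; rewrite ge0_fin_numE// => h.
  by apply: le_lt_trans h; rewrite (UE n) leeDr.
have -> : (fun n => \sum_(0 <= i < n) seq_ext_content (F i)) =
    (fun n => seq_ext_content U - seq_ext_content (U `\` D n)).
  by apply/funext => n; rewrite -DE (UE n) addeK.
rewrite -[X in _ --> X]sube0; apply: cvgeB => //; first exact: fin_num_adde_defl.
  exact: cvg_cst.
apply: seq_ext_content_cvg0 => [n|n m nm|]; first exact: measurableD.
  by apply: setDS; apply: subset_bigsetU.
apply/seteqP; split=> // x h; have [[n _ Fn] _] := h 0%N I.
have [_] := h n.+1 I; apply; rewrite /D -bigcup_mkord; exists n => //=.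
Qed.

HB.instance Definition _ := isMeasure.Build _ _ R seq_ext_content
  seq_ext_content0 seq_ext_content_ge0 seq_ext_content_sigma_additive.

Let prod_indic (D : nat -> set E) n (z : nat -> E) :
  (\prod_(i < n) \1_(D i) (z i) = \1_[set z | forall i, (i < n)%N -> D i (z i)] z :> R)%R.
Proof.
elim: n => [|n IH]; first by rewrite big_ord0 (_ : [set _ | _] = setT) ?indicT//; apply/seteqP.
rewrite big_ord_recr/= IH !indicE -natrM mulnb; congr (_%:R%R); congr nat_of_bool.
apply/idP/idP => [/andP[/set_mem h /set_mem Dn]|/set_mem h].
  by apply/mem_set => i; rewrite ltnS leq_eqVlt => /orP[/eqP ->//|/h].
by apply/andP; split; apply/mem_set; [move=> i ni; apply: h; exact: ltnW|exact: h].
Qed.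

Section rectangles.
Variables (n : nat) (G : set O) (D : nat -> set E).
Hypotheses (mG : measurable G) (mD : forall i, measurable (D i)).

Let rect : set (seq_ext_alg O E) :=
  [set x | G x.1 /\ forall i, (i < n)%N -> D i (x.2 i)].

Lemma measurable_rect : measurable rect.
Proof.
split; last first.
  exists n => x y xy h; rewrite /rect/= xy; congr (_ /\ _).
  by apply/propext; split=> H i ni; [rewrite -h//|rewrite h//]; exact: H.
pose F i : set W := if (i < n)%N then [set x | D i (x.2 i)] else setT.
rewrite (_ : (rect : set W) = fst @^-1` G `&` \bigcap_i F i); last first.
  apply/seteqP; split=> x [Gx h]; split=> // i; last by move=> ni; have := h i I; rewrite /F ni.
  by rewrite /F => _; case: ifPn => // /h.
apply: measurableI.
  by rewrite -[X in measurable X]setTI; exact: measurable_seq_ext_fst.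
apply: bigcap_measurable => // i _; rewrite /F; case: ifPn => // _.
by rewrite -[X in measurable X]setTI; exact: measurable_seq_ext_coord.
Qed.

Let avgs_rect k j : (j + k)%N = n -> avgs k j (ind rect) = fun x =>
  (\1_G x.1 * \prod_(i < j) \1_(D i) (x.2 i))%:E * \prod_(j <= i < n) kap i x.1 (D i).
Proof.
elim: k j => [|k IH] j.
  rewrite addn0 => ->; apply/funext => x /=; rewrite big_geq// mule1 prod_indic.
  rewrite /ind !indicE -natrM mulnb; congr (_%:R%:E); congr nat_of_bool.
  apply/idP/idP => [/set_mem[? ?]|/andP[/set_mem ? /set_mem ?]]; last exact/mem_set.
  by apply/andP; split; exact/mem_set.
rewrite addnS -addSn => jkn /=; rewrite IH//; apply/funext => x; rewrite /avg /=.
under eq_integral.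
  move=> e _; rewrite big_ord_recr/= eqxx.
  under eq_bigr do rewrite ltn_eqF//.
  rewrite mulrA EFinM -muleA [X in _ * X]muleC muleA.
  over.
rewrite ge0_integralZl//.
- rewrite integral_indic// setIT [in RHS]big_ltn; last by rewrite -jkn leq_addr.
  by rewrite [X in _ = _ * X]muleC muleA.
- exact/measurable_EFinP/measurable_indic.
- apply: mule_ge0; last by apply: prode_ge0.
  by rewrite lee_fin mulr_ge0// prodr_ge0.
Qed.

Lemma seq_ext_content_rect : seq_ext_content rect = \int[P]_(o in G) \prod_(i < n) kap i o (D i).
Proof.
have mr := measurable_rect.
rewrite (@seq_ext_contentE n)//; last first.
  by apply: ind_determined => x y xy h; rewrite /rect/= xy; congr (_ /\ _);
    apply/propext; split=> H i ni; [rewrite -h//|rewrite h//]; exact: H.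
rewrite avgs_rect// [RHS]integral_mkcond; apply: eq_integral => om _ /=.
rewrite big_ord0 mulr1 big_mkord patchE indicE.
by case: ifPn => _; rewrite ?mul1e ?mul0e.
Qed.

End rectangles.

Let Q := measure_extension seq_ext_content.

Let seq_extE A : measurable A -> Q A = seq_ext_content A.
Proof. by move=> mA; rewrite /Q /measure_extension measurable_mu_extE. Qed.

Let QT : Q setT = 1.
Proof.
have := @seq_ext_content_rect 0 setT (fun=> setT) measurableT (fun=> measurableT).
under eq_integral do rewrite big_ord0.
rewrite integral_cst// mul1e (_ : [set _ | _] = setT)//; last exact/seteqP.
have mT : measurable (setT : set (seq_ext_alg O E)).
  by split; [exact: measurableT|exists 0%N].
by rewrite -(seq_extE mT) => ->; exact: probability_setT.
Qed.

HB.instance Definition _ := Measure.on Q.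
HB.instance Definition _ := Measure_isProbability.Build _ _ R Q QT.

(** The [Z n] are conditionally independent given [pi], with conditional laws [kap n]. Only the
    formula on rectangles is exported; every later computation on the enlarged space starts from
    it. *)
Theorem ionescu_tulcea : exists d2 (W' : measurableType d2) (Q' : probability W' R)
    (pi : W' -> O) (Z : nat -> W' -> E),
  [/\ measurable_fun setT pi, forall n, measurable_fun setT (Z n) &
    forall n (G : set O) (D : nat -> set E), measurable G -> (forall i, measurable (D i)) ->
    Q' (pi @^-1` G `&` [set x | forall i, (i < n)%N -> D i (Z i x)]) =
      \int[P]_(o in G) \prod_(i < n) kap i o (D i)].
Proof.
exists _, _, Q, fst, (fun n x => x.2 n).
split=> [_ G mG|n _ B mB|n G D mG mD].
- rewrite setTI; apply: sub_sigma_algebra.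
  have := @measurable_rect 0 G (fun=> setT) mG (fun=> measurableT).
  by congr measurable; apply/seteqP; split=> x //= [].
- rewrite setTI; apply: sub_sigma_algebra.
  have := @measurable_rect n.+1 setT (fun i => if i == n then B else setT) measurableT.
  set A := [set _ | _]; rewrite (_ : A = (fun x => x.2 n) @^-1` B); last first.
    apply/seteqP; split=> x.
      by case=> _ /(_ n (leqnn _)); rewrite eqxx.
    by move=> Bx; split=> // i _; case: eqP => [->|].
  by apply=> i; case: ifP.
- rewrite -(@seq_ext_content_rect n G D mG mD) -seq_extE//.
  exact: measurable_rect.
Qed.

End ionescu_tulcea.

(** * Markov property relative to the wall clock and all copies *)

Lemma integral_indicE d (T : measurableType d) (R : realType)
    (mu : {measure set T -> \bar R}) (G : set T) (f : T -> \bar R) :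
  \int[mu]_(x in G) f x = \int[mu]_x ((\1_G x)%:E * f x).
Proof.
by rewrite integral_mkcond; apply: eq_integral => x _; rewrite epatch_indic muleC.
Qed.

Lemma integral_comp_law d d' (T : measurableType d) (E : measurableType d')
    (R : realType) (mu : {measure set T -> \bar R}) (nu : {measure set E -> \bar R})
    (G : set T) (Y : T -> E) (f : E -> \bar R) :
  measurable G -> measurable_fun setT Y ->
  (forall A, measurable A -> mu (G `&` Y @^-1` A) = nu A) ->
  measurable_fun setT f -> (forall x, 0 <= f x) ->
  \int[mu]_(x in G) f (Y x) = \int[nu]_x f x.
Proof.
move=> mG mY law mf f0.
have m1 : measurable_fun setT (fun x => (\1_G x)%:E : \bar R).
  exact/measurable_EFinP/measurable_indic.
have g0 x : 0 <= (\1_G x)%:E :> \bar R by rewrite lee_fin.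
rewrite integral_indicE.
under eq_integral do rewrite muleC.
rewrite -(integral_density mu g0 m1)//; last exact: (measurableT_comp mf mY).
rewrite -[LHS]/(\int[density mu g0 m1]_(x in Y @^-1` setT) (f \o Y) x).
rewrite -ge0_integral_pushforward//.
apply: eq_measure_integral => A mA _ /=.
rewrite /pushforward /density integral_indic ?law//.
by rewrite -[X in measurable X]setTI; exact: mY.
Qed.

Section markov_property.
Context (R : realType) (k : time_kind) (S : ptopologicalType).
Notation E := (path_space R k S).
Context (K : R.-pker (borel S) ~> E) (sK : strong_markov K).

(** The strong Markov property at a constant time. *)
Lemma markov_at (x : borel S) (t : time R k) (A B : set E) :
  measurable A -> history t B ->
  K x (B `&` shift t @^-1` A) = \int[K x]_(w in B) K (w t) A.
Proof.
move=> mA hB; pose tau (w : E) := (time_val t)%:E.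
(* For a constant stopping time, the condition [c] compares two constants, so that the event to be
   tested is either [C] or empty. *)
have hcst (s : time R k) (c : Prop) (C : set E) : (c -> history s C) ->
    history s (C `&` [set _ | c]).
  move=> h; have [hc|nc] := pselect c.
    rewrite (_ : C `&` _ = C); first exact: h.
    by apply/seteqP; split=> w; [case|split].
  rewrite (_ : C `&` _ = set0); last by apply/seteqP; split=> w // [].
  exact: (@measurable0 _ (g_sigma_algebraType (@cylinders R k S (upto s)))).
have stau : stopping_time tau.
  split; first by move=> w; right; exists t.
  move=> s; rewrite -[X in history s X]setTI.
  by apply: (hcst s ((time_val t)%:E <= (time_val s)%:E)) => _; exact: historyT.
have btau : before_stopping tau B.
  split; first exact: (@history_sub R k S t).
  move=> s; apply: (hcst s ((time_val t)%:E <= (time_val s)%:E)).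
  by rewrite lee_fin => ts; exact: (history_mono ts).
have := strong_markov_restart sK x stau btau mA.
rewrite (_ : [set w | tau w < +oo] = setT) ?setIT; last first.
  by apply/seteqP; split=> // w _; rewrite /= ltry.
by rewrite /tau/= time_ofK.
Qed.

Lemma integral_law_from (mu : probability (borel S) R) (f : E -> \bar R) :
  measurable_fun setT f -> (forall w, 0 <= f w) ->
  \int[law_from K mu]_w f w = \int[mu]_x \int[K x]_w f w.
Proof.
move=> mf f0.
(* [law_from] is the composition of [K] with the kernel from the one-point space that is constantly
   [mu]; the claim is then the integration rule for composed kernels. *)
pose l := kprobability (@measurable_cst _ _ unit (pprobability (borel S) R) setT mu).
pose K' := pullback_kernel K (@measurable_snd _ _ unit (borel S)).
rewrite -(@integral_kcomp _ _ _ unit (borel S) E R l K' tt f)//.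
Qed.

Lemma markov_law_from (mu : probability (borel S) R) (t : time R k) (A B : set E) :
  measurable A -> history t B ->
  law_from K mu (B `&` shift t @^-1` A) = \int[law_from K mu]_(w in B) K (w t) A.
Proof.
move=> mA hB; have mB := history_sub hB.
have mK : measurable_fun setT (fun w : E => K (w t) A).
  exact: (measurableT_comp (measurable_kernel K _ mA) (@measurable_eval R k S t)).
rewrite integral_indicE integral_law_from//.
- by apply: eq_integral => x _; rewrite markov_at// integral_indicE.
- apply: emeasurable_funM => //; exact/measurable_EFinP/measurable_indic.
Qed.

End markov_property.

Section past_of_copies.
Context (R : realType) (k : time_kind) (S : ptopologicalType).
Notation E := (path_space R k S).
Context (K : R.-pker (borel S) ~> E) (sK : strong_markov K).
Context (rho : probability (borel S) R) (N : nat) (Dt : time R k).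
Context d (Omega : measurableType d) (P : probability Omega R).
Context (Y : 'I_N -> Omega -> E) (t_wall : 'I_N -> nat -> Omega -> R).
Hypotheses (Y_measurable : forall r, measurable_fun setT (Y r))
  (Y_law : forall r A, measurable A -> P (Y r @^-1` A) = law_from K rho A)
  (Y_indep : forall A : 'I_N -> set E, (forall r, measurable (A r)) ->
    P (\bigcap_(r in setT) (Y r @^-1` A r)) = \prod_(r < N) P (Y r @^-1` A r))
  (t_wall_measurable : forall r m, measurable_fun setT (t_wall r m)).

Definition wall_events : set (set Omega) :=
  generated setT (fun rm : 'I_N * nat => t_wall rm.1 rm.2).

Hypothesis t_wall_indep : independent P wall_events (generated setT Y).

Lemma wall_events_measurable : wall_events `<=` measurable.
Proof.
apply: sub_generated_measurable => _ [[r m] _ [B mB <-]].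
by rewrite -[X in measurable X]setTI; exact: t_wall_measurable.
Qed.

Definition copies_in (B : 'I_N -> set E) : set Omega := \bigcap_(r in setT) (Y r @^-1` B r).

Lemma copies_in_measurable B : (forall r, measurable (B r)) -> measurable (copies_in B).
Proof.
move=> mB; apply: fin_bigcap_measurable => // r _.
by rewrite -[X in measurable X]setTI; exact: Y_measurable.
Qed.

Lemma copies_in_indep W B : wall_events W -> (forall r, measurable (B r)) ->
  P (W `&` copies_in B) = P W * \prod_(r < N) law_from K rho (B r).
Proof.
move=> hW mB; rewrite t_wall_indep//; last first.
  apply: (@fin_bigcap_measurable _ (g_sigma_algebraType
    [set Y i @^-1` B | i in setT & B in measurable])) => // r _.
  by apply: sub_sigma_algebra; exists r => //; exists (B r).
by rewrite Y_indep//; congr (_ * _); apply: eq_bigr => r _; rewrite Y_law.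
Qed.

(** Generates the information carried by the wall clock, by the other copies at all times, and by
    copy [r] up to time [t]. The Markov property of copy [r] at time [t] survives this enlargement,
    by independence. *)
Definition past_pi (r : 'I_N) (t : time R k) : set (set Omega) :=
  [set G | exists W B, [/\ wall_events W, forall r', measurable (B r'),
     history t (B r) & G = W `&` copies_in B]].

Lemma past_pi_measurable r t : past_pi r t `<=` measurable.
Proof.
move=> _ [W [B [hW mB _ ->]]]; apply: measurableI; first exact: wall_events_measurable.
exact: copies_in_measurable.
Qed.

Lemma past_piT r t : past_pi r t setT.
Proof.
exists setT, (fun=> setT); split=> //; last first.
  by rewrite setTI; apply/seteqP; split=> // x _ i _.
  exact: historyT.
exact: (@measurableT _ (g_sigma_algebraType _)).
Qed.

Lemma past_piI r t : setI_closed (past_pi r t).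
Proof.
move=> _ _ [W [B [hW mB hB ->]]] [W' [B' [hW' mB' hB' ->]]].
exists (W `&` W'), (fun r => B r `&` B' r); split.
- exact: (@measurableI _ (g_sigma_algebraType _)).
- by move=> r'; exact: measurableI.
- exact: historyI.
- rewrite setIACA; congr (_ `&` _).
  apply/seteqP; split=> o; first by case=> h h' i _; split; [exact: h|exact: h'].
  by move=> h; split=> i _; have [] := h i I.
Qed.

Lemma past_pi_mono r s t : (time_val s <= time_val t)%R -> past_pi r s `<=` past_pi r t.
Proof.
move=> st _ [W [B [hW mB hB ->]]]; exists W, B; split=> //.
exact: (history_mono st hB).
Qed.

Definition past r t := <<s past_pi r t >>.

Lemma past_measurable r t : past r t `<=` measurable.
Proof. exact: sub_generated_measurable (@past_pi_measurable r t). Qed.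

Lemma past_mono r s t : (time_val s <= time_val t)%R -> past r s `<=` past r t.
Proof.
move=> st; apply: smallest_sub; first exact: smallest_sigma_algebra.
by move=> A /(past_pi_mono st); exact: sub_sigma_algebra.
Qed.

Lemma past_wall r t W : wall_events W -> past r t W.
Proof.
move=> hW; apply: sub_sigma_algebra; exists W, (fun=> setT); split=> //.
  exact: historyT.
by rewrite (_ : copies_in _ = setT) ?setIT//; apply/seteqP; split=> // x _ i _.
Qed.

Lemma past_copy r t r' (B : set E) : measurable B -> (r' = r -> history t B) ->
  past r t (Y r' @^-1` B).
Proof.
move=> mB hB; apply: sub_sigma_algebra.
exists setT, (fun i => if i == r' then B else setT); split=> //.
- exact: (@measurableT _ (g_sigma_algebraType _)).
- by move=> i; case: ifP.
- case: eqP => [/esym/hB//|_]; exact: historyT.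
- rewrite setTI; apply/seteqP; split=> o.
    by move=> Bo i _ /=; case: eqP => [->|].
  by move=> /(_ r' I)/=; rewrite eqxx.
Qed.

(** Write [G] as the trace of the condition on copy [r] on an event [G'] of the wall clock and the
    other copies. On [G'], copy [r] has law [c] times [law_from K rho], where [c] is the probability
    of [G'], so the claim is the Markov property of this law. *)
Lemma past_markov_pi r t (A : set E) (G : set Omega) : measurable A -> past_pi r t G ->
  \int[P]_(o in G) (\1_(shift t @^-1` A) (Y r o))%:E =
  \int[P]_(o in G) K (Y r o t) A.
Proof.
move=> mA [W [B [hW mB hB ->]]].
have msA : measurable (shift t @^-1` A : set E).
  by rewrite -[X in measurable X]setTI; exact: measurable_shift.
pose B' i := if i == r then setT else B i.
have mB' i : measurable (B' i) by rewrite /B'; case: ifP.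
pose G' := W `&` copies_in B'.
have mG' : measurable G'.
  apply: measurableI; first exact: wall_events_measurable.
  exact: copies_in_measurable.
have GE : W `&` copies_in B = G' `&` Y r @^-1` B r.
  rewrite -setIA; congr (_ `&` _); apply/seteqP; split=> o.
    by move=> h; split; [move=> i _; rewrite /B'/=; case: ifP => // _; exact: h|exact: h].
  move=> [h hr] i _; have [->//|ir] := eqVneq i r.
  by have := h i I; rewrite /B'/= (negbTE ir).
pose c := fine (P W * \prod_(i < N | i != r) law_from K rho (B i)).
have cE : c%:E = P W * \prod_(i < N | i != r) law_from K rho (B i).
  rewrite fineK// fin_numM ?fin_num_measure//; first exact: wall_events_measurable.
  by apply: prode_fin_num => i _; exact: fin_num_measure.
have c0 : (0 <= c)%R by rewrite fine_ge0// mule_ge0// prode_ge0.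
have law C : measurable C -> P (G' `&` Y r @^-1` C) = mscale (NngNum c0) (law_from K rho) C.
  move=> mC; pose C' i := if i == r then C else B i.
  rewrite (_ : G' `&` _ = W `&` copies_in C'); last first.
    rewrite -setIA; congr (_ `&` _); apply/seteqP; split=> o.
      move=> [h hr] i _; rewrite /C'/=; case: eqP => [->//|/eqP ir].
      by have := h i I; rewrite /B'/= (negbTE ir).
    move=> h; split; first by move=> i _; have := h i I; rewrite /B' /C'/=; case: ifP.
    by have := h r I; rewrite /C'/= eqxx.
  rewrite copies_in_indep//; last by move=> i; rewrite /C'; case: ifP.
  rewrite (bigD1 r)//= {1}/C' eqxx muleCA muleC /mscale/= cE; congr (_ * _ * _).
  by apply: eq_bigr => i ir; rewrite /C' (negbTE ir).
have mK : measurable_fun setT (fun w : E => K (w t) A).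
  exact: (measurableT_comp (measurable_kernel K _ mA) (@measurable_eval R k S t)).
have m1 C : measurable C -> measurable_fun setT (fun w : E => (\1_C w)%:E : \bar R).
  by move=> mC; exact/measurable_EFinP/measurable_indic.
have E1 (f : E -> \bar R) : measurable_fun setT f -> (forall w, 0 <= f w) ->
    \int[P]_(o in G' `&` Y r @^-1` B r) f (Y r o) =
    c%:E * \int[law_from K rho]_(w in B r) f w.
  move=> mf f0; rewrite [in RHS]integral_indicE.
  rewrite -(ge0_integral_mscale _ measurableT (NngNum c0))//; last 2 first.
  - by apply: emeasurable_funM => //; exact: m1.
  - by move=> w _; rewrite mule_ge0// lee_fin.
  rewrite -(integral_comp_law mG' (Y_measurable r) law)//; last 2 first.
  - by apply: emeasurable_funM => //; exact: m1.
  - by move=> w; rewrite mule_ge0// lee_fin.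
  rewrite integral_mkcondr; apply: eq_integral => o _.
  rewrite patchE indicE; case: ifPn => [/set_mem h|h].
    by rewrite mem_set// mul1e.
  by rewrite memNset ?mul0e// => h'; move: h; rewrite mem_set.
rewrite GE (E1 (fun w => (\1_(shift t @^-1` A) w)%:E))//; last exact: m1.
rewrite (E1 (fun w => K (w t) A))//.
congr (_ * _); rewrite -markov_law_from// integral_indic//.
  by rewrite setIC.
Qed.

End past_of_copies.

(** * Enumeration of the fragments *)

Section enumeration.
Context (R : realType) (N : nat) (r0 : 'I_N).
Implicit Types (t : 'I_N -> nat -> R) (c : {ffun 'I_N -> nat}).

(** Reads a copy with the least time off a table of comparisons. Such a table has finitely many
    values, whence the measurability of [next_copy]; [r0] is a default value. *)
Definition earliest (B : {ffun 'I_N * 'I_N -> bool}) : 'I_N :=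
  odflt r0 [pick r | [forall i, B (r, i)]].

Definition next_copy t c : 'I_N :=
  earliest [ffun ri => (t ri.1 (c ri.1) <= t ri.2 (c ri.2))%R].

(* counts t j r is the number of fragments of copy r among the first j ones. *)
Fixpoint counts t (j : nat) : {ffun 'I_N -> nat} :=
  if j is j'.+1 then
    [ffun r => (counts t j' r + (r == next_copy t (counts t j')))%N]
  else [ffun=> 0%N].

(** Defined for every outcome, and by finitely many comparisons for each [j], so that it is
    determined measurably by the wall clock. *)
Definition fragment_index t (j : nat) : 'I_N * nat :=
  let r := next_copy t (counts t j) in (r, counts t j r).

(** The fragments of each copy are taken in order and without gaps, since the next one always has
    the current count as its index. *)
Lemma fragment_indexP t j r n :
  (exists2 l, (l < j)%N & fragment_index t l = (r, n)) <-> (n < counts t j r)%N.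
Proof.
elim: j => [|j IH] /=; first by split=> [[]//|]; rewrite ffunE.
rewrite ffunE; split.
  move=> [l]; rewrite ltnS leq_eqVlt => /orP[/eqP -> [<- <-]|lj le].
    by rewrite eqxx addn1.
  by rewrite ltn_addr//; apply/IH; exists l.
case: eqP => [rE|_]; rewrite ?addn0; last first.
  by move=> /IH[l lj le]; exists l => //; exact: ltnW.
rewrite addn1 ltnS leq_eqVlt => /orP[/eqP ->|].
  by exists j => //; rewrite /fragment_index -rE.
by move=> /IH[l lj le]; exists l => //; exact: ltnW.
Qed.

(** Strong induction: if [s] agrees with the recursion before [j], then [s j] has the least time
    among the unlisted pairs. By monotonicity, the candidate of each copy is its first unlisted
    fragment, and strict increase along [s] excludes ties. *)
Lemma fragment_index_unique t s :
  (forall r m n, (m <= n)%N -> (t r m <= t r n)%R) -> enumerates t s ->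
  forall j, s j = fragment_index t j.
Proof.
move=> nd [rs ts].
have tlt i j : (i < j)%N -> (t (s i).1 (s i).2 < t (s j).1 (s j).2)%R.
  elim: j => // j IH; rewrite ltnS leq_eqVlt => /orP[/eqP ->|/IH h]; first exact: ts.
  exact: lt_trans h (ts _).
elim/ltn_ind => j IH; set c := counts t j.
have later r n : (c r <= n)%N -> exists2 i, (j <= i)%N & s i = (r, n).
  move=> cn; have : range s (r, n) by rewrite rs.
  case=> i _ si; exists i => //; rewrite leqNgt; apply/negP => ij.
  have : (n < counts t j r)%N by apply/fragment_indexP; exists i; rewrite -?IH.
  by rewrite ltnNge cn.
have sle r n i : (j <= i)%N -> s i = (r, n) -> (t (s j).1 (s j).2 <= t r n)%R /\
    ((t r n <= t (s j).1 (s j).2)%R -> s j = (r, n)).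
  rewrite leq_eqVlt => /orP[/eqP -> ->|/tlt + se]; first by [].
  by rewrite se/= => lt; split; [exact: ltW|rewrite leNgt lt].
(* The first unlisted fragment of the copy of [s j] occurs at position [j] or later, and by
   monotonicity its time is at most that of [s j]; so it is [s j]. *)
have [r sj] : exists r, s j = (r, c r).
  exists (s j).1; have [|i ji si] := later (s j).1 (c (s j).1); first exact: leqnn.
  have [_ h] := sle _ _ _ ji si; apply: h; apply: nd.
  rewrite leqNgt; apply/negP => /fragment_indexP[l lj].
  rewrite -IH// -surjective_pairing => slj; have := tlt _ _ lj.
  by rewrite slj ltxx.
have rmin i : (t r (c r) <= t i (c i))%R.
  have [|l jl sl] := later i (c i); first exact: leqnn.
  by have [+ _] := sle _ _ _ jl sl; rewrite sj.
rewrite /fragment_index -/c; suff -> : next_copy t c = r by [].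
rewrite /next_copy /earliest; case: pickP => [r' /= /forallP h|/(_ r)/negP[]]; last first.
  by apply/forallP => i; rewrite ffunE/=; exact: rmin.
have [|i ji si] := later r' (c r'); first exact: leqnn.
have [_] := sle _ _ _ ji si; rewrite sj/=.
by have := h r; rewrite ffunE/= => h1 /(_ h1)[].
Qed.

End enumeration.

Section enumeration_events.
Context (R : realType) (N : nat) (r0 : 'I_N).
Context d (Omega : measurableType d) (t_wall : 'I_N -> nat -> Omega -> R).
Notation t_at o := (fun r m => t_wall r m o).
Let Tw : measurableType _ := g_sigma_algebraType
  [set (fun rm : 'I_N * nat => t_wall rm.1 rm.2) i @^-1` B | i in setT & B in measurable].

Lemma wall_next_copy c r :
  wall_events t_wall [set o | next_copy r0 (t_at o) c = r].
Proof.
have mt r' m : measurable_fun setT (t_wall r' m : Tw -> R).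
  by move=> _ B mB; rewrite setTI; apply: sub_sigma_algebra; exists (r', m) => //; exists B.
pose M o : {ffun 'I_N * 'I_N -> bool} :=
  [ffun ri => (t_wall ri.1 (c ri.1) o <= t_wall ri.2 (c ri.2) o)%R].
rewrite (_ : [set _ | _] = \bigcup_(B in [set B | earliest r0 B = r]) [set o | M o = B]).
  apply: (@fin_bigcup_measurable _ Tw) => // B _.
  rewrite (_ : [set o | M o = B] = \bigcap_(ri in setT)
      [set o | (t_wall ri.1 (c ri.1) o <= t_wall ri.2 (c ri.2) o)%R = B ri]).
    apply: (@fin_bigcap_measurable _ Tw) => // ri _.
    have := measurable_fun_ler (mt ri.1 (c ri.1)) (mt ri.2 (c ri.2)).
    by move=> /(_ measurableT [set B ri] I); rewrite setTI.
  apply/seteqP; split=> o; first by move=> /= <- ri _; rewrite /M/= ffunE.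
  by move=> h; apply/ffunP => ri; rewrite /M ffunE; exact: h.
apply/seteqP; split=> o; first by move=> h; exists (M o).
by case=> B /= <- <-.
Qed.

Lemma wall_counts j c : wall_events t_wall [set o | counts r0 (t_at o) j = c].
Proof.
elim: j c => [|j IH] c /=.
  have [<-|nc] := pselect ([ffun=> 0%N] = c).
    rewrite (_ : [set _ | _] = setT); first exact: (@measurableT _ Tw).
    by apply/seteqP; split.
  rewrite (_ : [set _ | _] = set0); first exact: (@measurable0 _ Tw).
  by apply/seteqP; split=> om //= /nc.
pose F (cr : {ffun 'I_N -> nat} * 'I_N) : set Omega :=
  if [ffun r => (cr.1 r + (r == cr.2))%N] == c then
    [set o | counts r0 (t_at o) j = cr.1] `&` [set o | next_copy r0 (t_at o) cr.1 = cr.2]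
  else set0.
rewrite (_ : [set _ | _] = \bigcup_cr F cr).
  apply: (@countable_bigcupT_measurable _ Tw) => // cr; rewrite /F; case: ifP => _.
    exact: (@measurableI _ Tw _ _ (IH _) (wall_next_copy _ _)).
  exact: (@measurable0 _ Tw).
apply/seteqP; split=> o.
  move=> /= h; exists (counts r0 (t_at o) j, next_copy r0 (t_at o) (counts r0 (t_at o) j)) => //.
  by rewrite /F/= h eqxx.
by case=> -[c' r'] _; rewrite /F/=; case: ifP => // /eqP <- [/= -> ->].
Qed.

End enumeration_events.

(** * Prolonged fragments *)

Lemma path_ext (R : realType) (k : time_kind) (S : ptopologicalType)
  (w w' : path_space R k S) : (forall t, w t = w' t) -> w = w'.
Proof.
case: w w' => [w cw] [w' cw'] /= /funext ww'; move: cw'; rewrite -ww' => cw'.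
by congr Path; exact: Prop_irrelevance.
Qed.

Lemma measurable_eq_borel (S : ptopologicalType) (C : nat -> set (borel S))
    (mC : forall n, measurable (C n))
    (sepC : forall x y, (forall n, C n x <-> C n y) -> x = y)
    d (T : measurableType d) (f g : T -> borel S) :
  measurable_fun setT f -> measurable_fun setT g -> measurable [set x | f x = g x].
Proof.
move=> mf mg; rewrite (_ : [set _ | _] = \bigcap_n
  ((f @^-1` C n `&` g @^-1` C n) `|` (f @^-1` (~` C n) `&` g @^-1` (~` C n)))).
  have mp (h : T -> borel S) A : measurable_fun setT h -> measurable A ->
      measurable (h @^-1` A).
    by move=> mh mA; rewrite -[X in measurable X]setTI; exact: mh.
  apply: bigcap_measurable => // n _.
  by apply: measurableU; apply: measurableI; apply: mp => //; exact: measurableC.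
apply/seteqP; split=> x /=.
  move=> fg n _ /=; rewrite fg; have [Cg|nCg] := pselect (C n (g x)); first by left.
  by right.
move=> h; apply: sepC => n; have := h n I.
by case=> -[/= h1 h2]; split=> // h3.
Qed.

Lemma prob_lty d (T : measurableType d) (R : realType) (P : probability T R) A :
  measurable A -> P A < +oo.
Proof. by move=> mA; rewrite -ge0_fin_numE//; exact: fin_num_measure. Qed.

Lemma pker_fin d d' (T : measurableType d) (E : measurableType d') (R : realType)
  (k : R.-pker T ~> E) x A : measurable A -> k x A \is a fin_num.
Proof.
move=> mA; rewrite ge0_fin_numE// (@le_lt_trans _ _ 1) ?ltry//.
by rewrite -(@prob_kernel _ _ _ _ _ k x); apply: le_measure; rewrite ?inE.
Qed.

Lemma law_unique d d' (T : measurableType d) (E : measurableType d') (R : realType)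
    (mu : {measure set T -> \bar R}) (nu : {measure set E -> \bar R})
    (G : set T) (Y : T -> E) (Pi : set (set E)) :
  measurable G -> mu G < +oo -> measurable_fun setT Y ->
  (measurable : set (set E)) = <<s Pi >> -> setI_closed Pi -> Pi setT ->
  (forall A, Pi A -> mu (G `&` Y @^-1` A) = nu A) ->
  forall A, measurable A -> mu (G `&` Y @^-1` A) = nu A.
Proof.
move=> mG Goo mY PiE PiI PiT h A mA.
pose Ym : {mfun T >-> E} := HB.pack Y (isMeasurableFun.Build _ _ _ _ _ mY).
rewrite -(measure_unique Pi (fun=> setT) PiE PiI (fun=> PiT) _
  (pushforward (mrestr mu mG) Ym) nu)//.
- by rewrite /pushforward /mrestr setIC.
- by rewrite bigcup_const.
- by move=> B PiB; rewrite -h// setIC.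
- by move=> _; rewrite /= /pushforward /mrestr setTI.
Qed.

Section mixture.
Context d d' (T : measurableType d) (E : measurableType d') (R : realType).
Context (mu : {measure set T -> \bar R}) (G : set T) (mG : measurable G)
  (k : R.-pker T ~> E).

Definition mixture (mG : measurable G) (A : set E) : \bar R := \int[mu]_(x in G) k x A.

Let mixture0 : mixture mG set0 = 0.
Proof. by rewrite /mixture integral0_eq// => x _; rewrite measure0. Qed.

Let mixture_ge0 A : 0 <= mixture mG A.
Proof. exact: integral_ge0. Qed.

Let mixture_sigma_additive : semi_sigma_additive (mixture mG).
Proof.
move=> F mF tF mUF; rewrite /mixture [X in _ --> X](_ : _ =
  \int[mu]_(x in G) (\sum_(n <oo) k x (F n))); last first.
  apply: eq_integral => x _.
  by apply/esym/cvg_lim => //; exact/measure_semi_sigma_additive.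
have mk n : measurable_fun G (k ^~ (F n)).
  exact/measurable_funTS/(measurable_kernel k _ (mF n)).
rewrite integral_nneseries//.
by apply: is_cvg_nneseries => n _ _; exact: integral_ge0.
Qed.

HB.instance Definition _ := isMeasure.Build _ _ _ (mixture mG)
  mixture0 mixture_ge0 mixture_sigma_additive.

End mixture.

Section fragments.
Context (R : realType) (k : time_kind) (S : ptopologicalType).
Notation E := (path_space R k S).
Context (C : nat -> set (borel S)) (mC : forall n, measurable (C n))
  (sepC : forall x y, (forall n, C n x <-> C n y) -> x = y).
Context (K : R.-pker (borel S) ~> E) (sK : strong_markov K).
Context (rho : probability (borel S) R) (N : nat) (r0 : 'I_N) (Dt : time R k).
Context d (Omega : measurableType d) (P : probability Omega R).
Context (Y : 'I_N -> Omega -> E) (t_wall : 'I_N -> nat -> Omega -> R).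
Hypotheses (Y_measurable : forall r, measurable_fun setT (Y r))
  (Y_law : forall r A, measurable A -> P (Y r @^-1` A) = law_from K rho A)
  (Y_indep : forall A : 'I_N -> set E, (forall r, measurable (A r)) ->
    P (\bigcap_(r in setT) (Y r @^-1` A r)) = \prod_(r < N) P (Y r @^-1` A r))
  (t_wall_measurable : forall r m, measurable_fun setT (t_wall r m))
  (t_wall_indep : independent P (wall_events t_wall) (generated setT Y)).

(** The auxiliary paths are indexed by numbers through [pickle]. A number that decodes to nothing is
    sent to a default pair, and no fragment uses the path of that number. *)
Definition decode_fragment (i : nat) : 'I_N * nat := odflt (r0, 0%N) (unpickle i).
Notation tm := (time_muln Dt).

Lemma pickleK_fragment rm : decode_fragment (pickle rm) = rm.
Proof. by rewrite /decode_fragment pickleK. Qed.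

Lemma measurable_Y_at r t : measurable_fun setT (fun o => Y r o t : borel S).
Proof. exact: (measurableT_comp (@measurable_eval R k S t) (Y_measurable r)). Qed.

(** The successor appears because the prolongation of fragment [m] starts where this fragment ends,
    at time (m + 1) Dt of its copy. *)
Definition restart_kernel (i : nat) : R.-pker Omega ~> E :=
  let rm := decode_fragment i in
  pullback_kernel K (@measurable_Y_at rm.1 (tm rm.2.+1)).

Context d' (Omega' : measurableType d') (Q : probability Omega' R)
  (pi : Omega' -> Omega) (Z : nat -> Omega' -> E).
Hypotheses (mpi : measurable_fun setT pi) (mZ : forall n, measurable_fun setT (Z n)).
Hypothesis rectQ : forall n (G : set Omega) (D : nat -> set E),
  measurable G -> (forall i, measurable (D i)) ->
  Q (pi @^-1` G `&` [set x | forall i, (i < n)%N -> D i (Z i x)]) =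
    \int[P]_(o in G) \prod_(i < n) restart_kernel i o (D i).

Definition fragment (rm : 'I_N * nat) (o : Omega') : E :=
  concat Dt (shift (tm rm.2) (Y rm.1 (pi o))) (Z (pickle rm) o).

Lemma measurable_Ypi_at r t : measurable_fun setT (fun o => Y r (pi o) t : borel S).
Proof. exact: (measurableT_comp (measurable_Y_at r t) mpi). Qed.

(* h is the identity, from Omega' with its own or with a smaller sigma-algebra. *)
Lemma measurable_fragment_gen d0 (T : measurableType d0) (h : T -> Omega') rm :
  (forall t, (time_val t <= time_val (tm rm.2.+1))%R ->
    measurable_fun setT (fun o => Y rm.1 (pi (h o)) t : borel S)) ->
  measurable_fun setT (fun o => Z (pickle rm) (h o)) ->
  measurable_fun setT (fun o => fragment rm (h o)).
Proof.
move=> mY mZ'; apply: measurable_path => t.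
have tmS : time_val (tm rm.2.+1) = (time_val (tm rm.2) + time_val Dt)%R.
  by rewrite !tv_muln -addn1 natrD mulrDl mul1r.
have mYD : measurable_fun setT (fun o => Y rm.1 (pi (h o)) (time_add (tm rm.2) Dt) : borel S).
  by apply: mY; rewrite tvD tmS.
have [tD|Dt_t] := leP (time_val t) (time_val Dt).
  under eq_fun do rewrite concat_le//.
  by apply: mY; rewrite tvD tmS lerD2l.
under eq_fun do rewrite concat_gt//.
have mZt s : measurable_fun setT (fun o => Z (pickle rm) (h o) s : borel S).
  exact: (measurableT_comp (@measurable_eval R k S s) mZ').
apply: measurable_fun_ifT => //.
apply: (measurable_fun_bool true).
rewrite setTI (_ : _ @^-1` _ = [set o | Z (pickle rm) (h o) (time_zero R k) =
    Y rm.1 (pi (h o)) (time_add (tm rm.2) Dt) :> borel S]).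
  exact: (measurable_eq_borel mC sepC).
by apply/seteqP; split=> om /= => [/asboolP|?]; [|exact/asboolP].
Qed.

Lemma measurable_fragment rm : measurable_fun setT (fragment rm).
Proof.
apply: (@measurable_fragment_gen _ _ idfun) => //.
by move=> t _; exact: measurable_Ypi_at.
Qed.

(** Fragments of different copies are [before] each other, whatever their indices: either may be
    known when the other starts. *)
Definition before (rm rm' : 'I_N * nat) : Prop := rm.1 = rm'.1 -> (rm.2 < rm'.2)%N.

Definition all_in (D : nat -> set E) : set Omega' := [set o | forall i, D i (Z i o)].

(** On the enlarged space, the past of a fragment also knows the prolongations of the fragments
    [before] it. The bound [n] keeps the events within the reach of the rectangle formula. *)
Definition past_pi' (rm : 'I_N * nat) : set (set Omega') :=
  [set G' | exists G D n, [/\ past Y t_wall rm.1 (tm rm.2) G,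
    forall i, measurable (D i),
    forall i, ~ before (decode_fragment i) rm -> D i = setT,
    forall i, (n <= i)%N -> D i = setT & G' = pi @^-1` G `&` all_in D]].

Let measurable_pi G : measurable G -> measurable (pi @^-1` G).
Proof. by move=> mG; rewrite -[X in measurable X]setTI; exact: mpi. Qed.

Lemma measurable_all_in D : (forall i, measurable (D i)) -> measurable (all_in D).
Proof.
move=> mD; rewrite (_ : all_in D = \bigcap_i (Z i @^-1` D i)).
  apply: bigcap_measurable => // i _.
  by rewrite -[X in measurable X]setTI; exact: mZ.
by apply/seteqP; split=> om h i => [_|]; exact: h.
Qed.

Lemma past_pi'_measurable rm : past_pi' rm `<=` measurable.
Proof.
move=> _ [G [D [n [hG mD _ _ ->]]]]; apply: measurableI; last exact: measurable_all_in.
apply: measurable_pi; apply: past_measurable hG => //.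
Qed.

Lemma past_pi'T rm : past_pi' rm setT.
Proof.
exists setT, (fun=> setT), 0%N; split=> //.
  exact: (@measurableT _ (g_sigma_algebraType _)).
by apply/seteqP; split.
Qed.

Lemma past_pi'I rm : setI_closed (past_pi' rm).
Proof.
move=> _ _ [G [D [n [hG mD bD nD ->]]]] [G' [D' [n' [hG' mD' bD' nD' ->]]]].
exists (G `&` G'), (fun i => D i `&` D' i), (maxn n n'); split.
- exact: (@measurableI _ (g_sigma_algebraType _)).
- by move=> i; exact: measurableI.
- by move=> i nb; rewrite bD// bD'// setIT.
- by move=> i; rewrite geq_max => /andP[ni n'i]; rewrite nD// nD'// setIT.
- rewrite preimage_setI setIACA; congr (_ `&` _).
  apply/seteqP; split=> om; first by case=> h h' i; split; [exact: h|exact: h'].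
  by move=> h; split=> i; have [] := h i.
Qed.

(** The conditional probability, given the original outcome, that the first [n] auxiliary paths fall
    in the sets [D i]. *)
Let weight (D : nat -> set E) n o : \bar R := \prod_(i < n) restart_kernel i o (D i).

Let weight_ge0 D n o : 0 <= weight D n o. Proof. exact: prode_ge0. Qed.

Let weight_fin D n o : (forall i, measurable (D i)) -> weight D n o \is a fin_num.
Proof. by move=> mD; apply: prode_fin_num => i _; exact: pker_fin. Qed.

Let measurable_weight_gen d0 (T : measurableType d0) (h : T -> Omega) D n :
  (forall i, measurable_fun setT (fun o => restart_kernel i (h o) (D i))) ->
  measurable_fun setT (fun o => weight D n (h o)).
Proof.
move=> mD; rewrite /weight; elim: n => [|n IH].
  by under eq_fun do rewrite big_ord0; exact: measurable_cst.
by under eq_fun do rewrite big_ord_recr/=; apply: emeasurable_funM; [exact: IH|exact: mD].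
Qed.

Let measurable_weight D n : (forall i, measurable (D i)) -> measurable_fun setT (weight D n).
Proof.
move=> mD; apply: (@measurable_weight_gen _ _ idfun) => i.
exact: (measurable_kernel (restart_kernel i) _ (mD i)).
Qed.

Lemma rect_law G D n : measurable G -> (forall i, measurable (D i)) ->
  (forall i, (n <= i)%N -> D i = setT) ->
  Q (all_in D `&` pi @^-1` G) = \int[P]_(o in G) weight D n o.
Proof.
move=> mG mD nD; rewrite /weight -rectQ// setIC; congr (Q (_ `&` _)).
apply/seteqP; split=> om h i => [_|]; first exact: h.
by have [/h//|/nD ->] := ltnP i n.
Qed.

Lemma rect_integral G D n (psi : Omega -> \bar R) :
  measurable G -> (forall i, measurable (D i)) ->
  (forall i, (n <= i)%N -> D i = setT) ->
  measurable_fun setT psi -> (forall o, 0 <= psi o) ->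
  \int[Q]_(o in pi @^-1` G `&` all_in D) psi (pi o) =
  \int[P]_o ((\1_G o)%:E * weight D n o * psi o).
Proof.
move=> mG mD nD mpsi psi0.
have m1 : measurable_fun setT (fun o => (\1_G o)%:E : \bar R).
  exact/measurable_EFinP/measurable_indic.
have mg : measurable_fun setT (fun o => (\1_G o)%:E * psi o) by exact: emeasurable_funM.
have g0 o : 0 <= (\1_G o)%:E * psi o by rewrite mule_ge0// lee_fin.
transitivity (\int[Q]_(o in all_in D) ((\1_G (pi o))%:E * psi (pi o))).
  rewrite setIC integral_mkcondr; apply: eq_integral => om _.
  rewrite patchE indicE; case: ifPn => [/set_mem h|h].
    by rewrite mem_set// mul1e.
  by rewrite memNset ?mul0e// => h'; move: h; rewrite mem_set.
rewrite (@integral_comp_law _ _ _ _ _ Q (density P (weight_ge0 D n) (measurable_weight n mD))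
  _ pi (fun o => (\1_G o)%:E * psi o))//; last 2 first.
- exact: measurable_all_in.
- by move=> A mA; exact: rect_law.
rewrite integral_density//; last by move=> om; exact: weight_fin.
by apply: eq_integral => om _; rewrite muleAC.
Qed.

Let tmS m : time_val (tm m.+1) = (time_val (tm m) + time_val Dt)%R.
Proof. by rewrite !tv_muln -addn1 natrD mulrDl mul1r. Qed.

Let tm_add m : time_add (tm m) Dt = tm m.+1.
Proof. by apply: tv_inj; rewrite tvD tmS. Qed.

Let tm_le m n : (m <= n)%N -> (time_val (tm m) <= time_val (tm n))%R.
Proof. by move=> mn; rewrite !tv_muln ler_wpM2r ?tv_ge0// ler_nat. Qed.

Lemma past_Y_at rm r' t : (r' = rm.1 -> (time_val t <= time_val (tm rm.2))%R) ->
  measurable_fun setT (fun o : g_sigma_algebraType (past_pi Y t_wall rm.1 (tm rm.2)) =>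
    Y r' o t : borel S).
Proof.
move=> ht _ B mB; rewrite setTI.
apply: (@past_copy R k S N _ _ _ _ _ _ r' [set w : E | B (w t)]).
  by rewrite -[X in measurable X]setTI; exact: measurable_eval.
by move=> /ht h; exact: history_eval.
Qed.

(** A fragment of the same copy [before] rm ends no later than rm starts, so the starting points of
    the constrained prolongations all belong to the past of rm. *)
Let past_weight rm D n : (forall i, measurable (D i)) ->
  (forall i, ~ before (decode_fragment i) rm -> D i = setT) ->
  measurable_fun setT
    (weight D n : g_sigma_algebraType (past_pi Y t_wall rm.1 (tm rm.2)) -> \bar R).
Proof.
move=> mD bD; apply: (@measurable_weight_gen _
  (g_sigma_algebraType (past_pi Y t_wall rm.1 (tm rm.2))) (fun o => o)) => i.
have [bi|nbi] := pselect (before (decode_fragment i) rm); last first.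
  rewrite bD//; rewrite (_ : (fun _ => _) = cst 1); first exact: measurable_cst.
  by apply/funext => om; exact: prob_kernel.
apply: (measurableT_comp (measurable_kernel K _ (mD i))).
by apply: past_Y_at => /bi h; exact: tm_le.
Qed.

Let past_indic rm G : past Y t_wall rm.1 (tm rm.2) G -> measurable_fun setT
  (fun o : g_sigma_algebraType (past_pi Y t_wall rm.1 (tm rm.2)) => (\1_G o)%:E : \bar R).
Proof. by move=> hG; apply/measurable_EFinP; exact: measurable_indic. Qed.

(** The kernel [K x] charges only paths that start at [x], but this is known one set at a time; the
    countable separating family turns it into an almost sure equality of points. *)
Lemma start_ae rm : {ae Q, forall o, Z (pickle rm) o (time_zero R k) =
  Y rm.1 (pi o) (tm rm.2.+1)}.
Proof.
have null (B : set (borel S)) : measurable B ->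
    Q ([set o | B (Z (pickle rm) o (time_zero R k))] `&`
       [set o | ~ B (Y rm.1 (pi o) (tm rm.2.+1))]) = 0.
  move=> mB; pose D i := if i == pickle rm then [set w : E | B (w (time_zero R k))] else setT.
  have mB0 : measurable [set w : E | B (w (time_zero R k))].
    by rewrite -[X in measurable X]setTI; exact: measurable_eval.
  have mD i : measurable (D i) by rewrite /D; case: ifP.
  have mG : measurable [set o | ~ B (Y rm.1 o (tm rm.2.+1))].
    rewrite (_ : [set _ | _] = setT `&` (fun o => Y rm.1 o (tm rm.2.+1) : borel S) @^-1` (~` B)).
      by apply: measurable_Y_at => //; exact: measurableC.
    by rewrite setTI.
  have := @rect_law _ D (pickle rm).+1 mG mD.
  rewrite (_ : all_in D = [set o | B (Z (pickle rm) o (time_zero R k))]); last first.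
    apply/seteqP; split=> om; first by move=> /(_ (pickle rm)); rewrite /D eqxx.
    by move=> h i; rewrite /D; case: eqP => [->|].
  move=> -> //; last by move=> i; rewrite /D; case: eqP => // ->; rewrite ltnn.
  rewrite integral_indicE integral0_eq// => om _.
  rewrite indicE; case: (boolP (om \in _)) => [/set_mem h|_]; last by rewrite mul0e.
  rewrite /weight big_ord_recr/= {2}/D eqxx /restart_kernel pickleK_fragment/=.
  rewrite /pullback_kernel (strong_markov_start sK)// diracE memNset//.
  by rewrite !mule0.
have mZB (B : set (borel S)) : measurable B ->
    measurable [set o | B (Z (pickle rm) o (time_zero R k))].
  move=> mB; rewrite -[X in measurable X]setTI.
  exact: (measurableT_comp (@measurable_eval R k S (time_zero R k)) (mZ (pickle rm))).
have mYB (B : set (borel S)) : measurable B ->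
    measurable [set o | B (Y rm.1 (pi o) (tm rm.2.+1))].
  by move=> mB; rewrite -[X in measurable X]setTI; exact: measurable_Ypi_at.
pose F n := ([set o | C n (Z (pickle rm) o (time_zero R k))] `&`
       [set o | ~ C n (Y rm.1 (pi o) (tm rm.2.+1))]) `|`
   ([set o | (~` C n) (Z (pickle rm) o (time_zero R k))] `&`
       [set o | ~ (~` C n) (Y rm.1 (pi o) (tm rm.2.+1))]).
have mF1 (B : set (borel S)) : measurable B -> measurable (
    [set o | B (Z (pickle rm) o (time_zero R k))] `&`
       [set o | ~ B (Y rm.1 (pi o) (tm rm.2.+1))]).
  move=> mB; apply: measurableI; first exact: mZB.
  by apply: (mYB (~` B)); exact: measurableC.
have mF n : measurable (F n).
  by apply: measurableU; apply: mF1 => //; exact: measurableC.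
have F0 n : Q (F n) = 0.
  apply/eqP; rewrite -measure_le0 (le_trans (measureU2 _ _ _))//; [exact: mF1|..].
    by apply: mF1; exact: measurableC.
  rewrite [X in X + _]null// [X in _ + X]null ?adde0//; exact: measurableC.
apply: (@negligibleS _ _ _ _ (\bigcup_n F n)); last first.
  by apply: negligible_bigcup => n; apply/negligibleP; [exact: mF|exact: F0].
move=> om /= h; apply: contrapT => nF; apply: h; apply: sepC => n.
split=> h; apply: contrapT => h'; apply: nF; exists n => //; [by left|].
by right; split=> //= hc; exact: hc.
Qed.

(** Both sides equal the integral of one indicator: the left one by the Markov property of the copy
    at the end of the fragment, the right one by the same property at its start. The law of the copy
    past the end is thus the law of a fresh prolongation. *)
Let copy_weight_mid rm D n (G : set Omega) (A1 : set E) (A2 : set E) :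
  let m1 := (rm.1, rm.2.+1) in
  past Y t_wall rm.1 (tm rm.2) G -> history Dt A1 -> measurable A2 ->
  (forall i, measurable (D i)) ->
  (forall i, ~ before (decode_fragment i) rm -> D i = setT) ->
  \int[P]_o ((\1_(G `&` Y rm.1 @^-1` (shift (tm rm.2) @^-1` A1)) o)%:E * weight D n o *
    K (Y rm.1 o (tm rm.2.+1)) A2) =
  \int[P]_o ((\1_G o)%:E * weight D n o *
    K (Y rm.1 o (tm rm.2)) (A1 `&` shift Dt @^-1` A2)).
Proof.
move=> m1 hG hA1 mA2 mD bD.
have mA1 := history_sub hA1.
have msA t (A : set E) : measurable A -> measurable (shift t @^-1` A : set E).
  by move=> mA; rewrite -[X in measurable X]setTI; exact: measurable_shift.
have mH : measurable (A1 `&` shift Dt @^-1` A2) by apply: measurableI => //; exact: msA.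
have mYA (A : set E) : measurable A -> measurable (Y rm.1 @^-1` A).
  by move=> mA; rewrite -[X in measurable X]setTI; exact: Y_measurable.
have mf1 t (A : set E) : measurable A -> measurable_fun setT
    (fun o => (\1_(shift t @^-1` A) (Y rm.1 o))%:E : \bar R).
  move=> mA; apply/measurable_EFinP.
  apply: (measurableT_comp _ (Y_measurable rm.1)).
  by apply: measurable_indic; exact: msA.
have f1oo t (A : set E) : measurable A ->
    \int[P]_o (\1_(shift t @^-1` A) (Y rm.1 o))%:E < +oo.
  move=> mA; rewrite [ltLHS](_ : _ = \int[P]_o (\1_(Y rm.1 @^-1` (shift t @^-1` A)) o)%:E).
    have mB : measurable (Y rm.1 @^-1` (shift t @^-1` A)) by exact: mYA (msA _ _ mA).
    by rewrite integral_indic ?setIT; [exact: (prob_lty P mB)|exact: measurableT|exact: mB].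
  by apply: eq_integral => o _; rewrite !indicE.
have mf2 t (A : set E) : measurable A -> measurable_fun setT (fun o => K (Y rm.1 o t) A).
  by move=> mA; apply: (measurableT_comp (measurable_kernel K _ mA)); exact: measurable_Y_at.
have cond t (A : set E) (g : Omega -> \bar R) : measurable A ->
    measurable_fun setT (g : g_sigma_algebraType (past_pi Y t_wall rm.1 t) -> \bar R) ->
    (forall o, 0 <= g o) ->
    \int[P]_o (g o * K (Y rm.1 o t) A) =
    \int[P]_o (g o * (\1_(shift t @^-1` A) (Y rm.1 o))%:E).
  move=> mA mg g0; apply/esym; apply: (@eq_cond_expectation _ _ _ P (past_pi Y t_wall rm.1 t)) => //.
  - exact: past_pi_measurable.
  - exact: past_piI.
  - exact: past_piT.
  - exact: mf1.
  - exact: mf2.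
  - by move=> o; exact: pker_fin.
  - exact: f1oo.
  - move=> B; exact: (past_markov_pi sK Y_measurable Y_law Y_indep t_wall_measurable t_wall_indep).
rewrite cond//; last 2 first.
- apply: emeasurable_funM.
    apply: (@past_indic m1); apply: (@measurableI _ (g_sigma_algebraType _)).
      exact: (@past_mono R k S N _ _ Y t_wall rm.1 _ _ (tm_le (leqnSn _)) _ hG).
    apply: (@past_copy R k S N _ _ Y t_wall rm.1 _ rm.1 (shift (tm rm.2) @^-1` A1)).
      exact: msA.
    by move=> _; rewrite -[tm m1.2]/(tm rm.2.+1) -tm_add; exact: history_shift.
  apply: (@past_weight m1) => // i nb; apply: bD => b; apply: nb => /= /b.
  by move=> h; exact: ltnW.
- by move=> o; rewrite mule_ge0// lee_fin.
rewrite [RHS]cond//; last 2 first.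
- by apply: emeasurable_funM; [exact: past_indic|exact: past_weight].
- by move=> o; rewrite mule_ge0// lee_fin.
apply: eq_integral => o _; rewrite muleAC [RHS]muleAC; congr (_ * _).
rewrite -!EFinM; congr (_%:E); rewrite !indicE -!natrM !mulnb; congr (_%:R%R).
congr nat_of_bool; rewrite in_setI.
have sE : shift (tm rm.2.+1) (Y rm.1 o) = shift Dt (shift (tm rm.2) (Y rm.1 o)).
  by apply: path_ext => t; rewrite -tm_add /= time_addA.
have -> : (Y rm.1 o \in shift (tm rm.2.+1) @^-1` A2) =
    (shift Dt (shift (tm rm.2) (Y rm.1 o)) \in A2).
  by rewrite -sE; apply/idP/idP => /set_mem h; exact/mem_set.
have -> : (Y rm.1 o \in shift (tm rm.2) @^-1` (A1 `&` shift Dt @^-1` A2)) =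
    (shift (tm rm.2) (Y rm.1 o) \in A1) && (shift Dt (shift (tm rm.2) (Y rm.1 o)) \in A2).
  apply/idP/idP => [/set_mem[h1 h2]|/andP[/set_mem h1 /set_mem h2]].
    by apply/andP; split; exact/mem_set.
  by apply/mem_set; split.
have -> : (o \in Y rm.1 @^-1` (shift (tm rm.2) @^-1` A1)) =
    (shift (tm rm.2) (Y rm.1 o) \in A1).
  by apply/idP/idP => /set_mem h; exact/mem_set.
by rewrite andbA.
Qed.

(** Almost surely, [A1] tests the copy and [A2] tests the auxiliary path. Integrating out the latter
    leaves the kernel at the end of the fragment, which [copy_weight_mid] carries back to its
    start. *)
Let past'_markov_split rm G' (A1 A2 : set E) :
  past_pi' rm G' -> history Dt A1 -> measurable A2 ->
  Q (G' `&` fragment rm @^-1` (A1 `&` shift Dt @^-1` A2)) =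
  \int[Q]_(o in G') K (Y rm.1 (pi o) (tm rm.2)) (A1 `&` shift Dt @^-1` A2).
Proof.
move=> [G [D [n [hG mD bD nD ->]]]] hA1 mA2.
have mA1 := history_sub hA1.
have mG : measurable G by apply: past_measurable hG.
have msA t (A : set E) : measurable A -> measurable (shift t @^-1` A : set E).
  by move=> mA; rewrite -[X in measurable X]setTI; exact: measurable_shift.
have mH : measurable (A1 `&` shift Dt @^-1` A2) by apply: measurableI => //; exact: msA.
(* The constraint [A2] can be put on coordinate [i0] because no other constraint bears on it: a
   fragment is not [before] itself, so [D i0] is everything. *)
pose i0 := pickle rm; pose D' i := if i == i0 then A2 else D i.
have Di0 : D i0 = setT.
  by apply: bD; rewrite pickleK_fragment /before => /(_ erefl); rewrite ltnn.
have mD' i : measurable (D' i) by rewrite /D'; case: ifP.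
pose n' := maxn n i0.+1.
have nD0 i : (n' <= i)%N -> D i = setT by rewrite geq_max => /andP[/nD].
have nD' i : (n' <= i)%N -> D' i = setT.
  by move=> ni; rewrite /D'; case: eqP ni => [->|_ /nD0//]; rewrite geq_max ltnn andbF.
pose G1 := Y rm.1 @^-1` (shift (tm rm.2) @^-1` A1).
have mG1 : measurable G1.
  by rewrite -[X in measurable X]setTI; apply: Y_measurable => //; exact: msA.
have mGG1 : measurable (G `&` G1) by exact: measurableI.
transitivity (Q (all_in D' `&` pi @^-1` (G `&` G1))).
  apply: ae_measure_eq.
  - apply: measurableI; last first.
      by rewrite -[X in measurable X]setTI; exact: measurable_fragment.
    by apply: measurableI; [exact: measurable_pi|exact: measurable_all_in].
  - by apply: measurableI; [exact: measurable_all_in|exact: measurable_pi].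
  apply: filterS (start_ae rm) => o Zo.
  have Zo' : Z i0 o (time_zero R k) = shift (tm rm.2) (Y rm.1 (pi o)) Dt.
    by rewrite Zo -tm_add.
  have sE : shift Dt (fragment rm o) = Z i0 o.
    by apply: path_ext => t; rewrite /fragment shift_concat.
  have A1E : A1 (fragment rm o) <-> G1 (pi o).
    by apply: (history_agree hA1) => s sD; rewrite /fragment concat_le.
  rewrite /setI/= sE; split.
    move=> [[Go Do] [/A1E Ao Zoo]]; split=> //.
    by move=> i; rewrite /D'; case: eqP => [->|_]; [|exact: Do].
  move=> [Do [Go /A1E Ao]]; split; [split=> // i|split=> //].
    by have := Do i; rewrite /D'; case: eqP => [-> _|//]; rewrite Di0.
  by have := Do i0; rewrite /D' eqxx.
rewrite (rect_law _ mD' nD')// integral_indicE.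
have -> : \int[P]_x ((\1_(G `&` G1) x)%:E * weight D' n' x) =
    \int[P]_x ((\1_(G `&` G1) x)%:E * weight D n' x * K (Y rm.1 x (tm rm.2.+1)) A2).
  apply: eq_integral => o _; rewrite -muleA; congr (_ * _).
  have i0n : (i0 < n')%N by rewrite /n' leq_max ltnSn orbT.
  rewrite /weight (bigD1 (Ordinal i0n))//= [in RHS](bigD1 (Ordinal i0n))//=.
  rewrite {1}/D' eqxx Di0 prob_kernel mul1e muleC; congr (_ * _).
    by apply: eq_bigr => i ii0; rewrite /D' ifF//; apply: negbTE; rewrite -(inj_eq val_inj) in ii0.
  by rewrite /restart_kernel /i0 pickleK_fragment.
rewrite copy_weight_mid// -rect_integral//.
apply: (measurableT_comp (measurable_kernel K _ mH)); exact: measurable_Y_at.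
Qed.

Definition past_fragment rm := <<s past_pi' rm >>.

Lemma past_fragment_measurable rm : past_fragment rm `<=` measurable.
Proof. exact: sub_generated_measurable (@past_pi'_measurable rm). Qed.

(** Two uniqueness arguments: in [A], from [split_sets] to all events of path space, and then in
    [G], from the pi-system to the past. *)
Theorem fragment_markov rm G A : past_fragment rm G -> measurable A ->
  Q (G `&` fragment rm @^-1` A) = \int[Q]_(o in G) K (Y rm.1 (pi o) (tm rm.2)) A.
Proof.
move=> hG mA.
have mfr (B : set E) : measurable B -> measurable (fragment rm @^-1` B).
  by move=> mB; rewrite -[X in measurable X]setTI; exact: measurable_fragment.
pose K' := pullback_kernel K (@measurable_Ypi_at rm.1 (tm rm.2)).
have step1 G' : past_pi' rm G' ->
    Q (G' `&` fragment rm @^-1` A) = \int[Q]_(o in G') K (Y rm.1 (pi o) (tm rm.2)) A.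
  move=> hG'; have mG' := past_pi'_measurable hG'.
  apply: (@law_unique _ _ _ _ _ Q (mixture Q K' mG') G' (fragment rm) (split_sets Dt)) => [||||||B [A1 [A2 [hA1 mA2 ->]]]|].
  - exact: mG'.
  - exact: (prob_lty Q mG').
  - exact: measurable_fragment.
  - exact: split_setsE.
  - exact: split_setsI.
  - exact: split_setsT.
  - rewrite /mixture /K' /pullback_kernel.
    rewrite -[LHS]/(Q (G' `&` fragment rm @^-1` (A1 `&` shift Dt @^-1` A2))).
    exact: (past'_markov_split hG' hA1 mA2).
  - exact: mA.
have mf1 : measurable_fun setT (fun o => (\1_(fragment rm @^-1` A) o)%:E : \bar R).
  by apply/measurable_EFinP/measurable_indic; exact: mfr.
have f1E B : measurable B -> \int[Q]_(o in B) (\1_(fragment rm @^-1` A) o)%:E =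
    Q (B `&` fragment rm @^-1` A).
  move=> mB; have mfA := mfr _ mA; rewrite setIC.
  by rewrite integral_indic.
rewrite -f1E; last exact: past_fragment_measurable hG.
apply: (@eq_cond_expectation_set _ _ _ Q (past_pi' rm)) => //.
- exact: past_pi'_measurable.
- exact: past_pi'I.
- exact: past_pi'T.
- exact: (measurable_kernel K' _ mA).
- rewrite (f1E _ measurableT) setTI; apply: (prob_lty Q); exact: mfr.
- by move=> B hB; rewrite f1E; [exact: step1|exact: past_pi'_measurable hB].
Qed.

Lemma past_fragment_pi rm G : past Y t_wall rm.1 (tm rm.2) G ->
  past_fragment rm (pi @^-1` G).
Proof.
move=> hG; apply: sub_sigma_algebra; exists G, (fun=> setT), 0%N; split=> //.
by rewrite (_ : all_in _ = setT) ?setIT//; apply/seteqP; split.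
Qed.

(** A prolonged fragment is built from its copy up to the end of the piece and from its own
    auxiliary path, and the past of rm contains both. *)
Lemma past_fragment_fragment rm rm' (B : set E) : before rm' rm -> measurable B ->
  past_fragment rm (fragment rm' @^-1` B).
Proof.
move=> bef mB; have := @measurable_fragment_gen _ (g_sigma_algebraType (past_pi' rm))
  (fun o => o) rm'.
move=> h; suff /h : forall t, (time_val t <= time_val (tm rm'.2.+1))%R ->
    measurable_fun setT (fun o : g_sigma_algebraType (past_pi' rm) =>
      Y rm'.1 (pi o) t : borel S).
  move=> /(_ _ measurableT B mB); rewrite setTI; apply.
  move=> _ D mD; rewrite setTI; apply: sub_sigma_algebra.
  exists setT, (fun i => if i == pickle rm' then D else setT), (pickle rm').+1; split.
  - exact: (@measurableT _ (g_sigma_algebraType _)).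
  - by move=> i; case: ifP.
  - by move=> i nb; case: eqP nb => // ->; rewrite pickleK_fragment.
  - by move=> i; case: eqP => // ->; rewrite ltnn.
  - rewrite preimage_setT setTI; apply/seteqP; split=> om.
      by move=> h' i /=; case: eqP => [->|].
    by move=> /(_ (pickle rm')); rewrite eqxx.
move=> t trm _ D mD; rewrite setTI.
apply: (@past_fragment_pi rm (Y rm'.1 @^-1` [set w : E | D (w t)])).
apply: (@past_copy R k S N _ _ Y t_wall rm.1 _ rm'.1 [set w : E | D (w t)]).
  by rewrite -[X in measurable X]setTI; exact: measurable_eval.
by move=> /bef h'; apply: history_eval => //; apply: le_trans trm _; exact: tm_le.
Qed.

Lemma fragment_pi G : measurable G -> Q (pi @^-1` G) = P G.
Proof.
move=> mG; have := @rectQ 0 G (fun=> setT) mG (fun=> measurableT).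
rewrite (_ : [set _ | _] = setT) ?setIT => [->|]; last by apply/seteqP; split.
under eq_integral do rewrite big_ord0.
by rewrite integral_cst// mul1e.
Qed.

Lemma fragment_le rm o t : (time_val t <= time_val Dt)%R ->
  fragment rm o t = Y rm.1 (pi o) (time_add (tm rm.2) t).
Proof. by move=> tD; rewrite /fragment concat_le. Qed.

End fragments.

(** * The k-th fragment *)

Lemma ae_pullback d d' (T : measurableType d) (E : measurableType d') (R : realType)
    (mu : {measure set T -> \bar R}) (nu : {measure set E -> \bar R}) (Y : T -> E)
    (p : E -> Prop) : measurable_fun setT Y ->
  (forall A, measurable A -> nu A = 0 -> mu (Y @^-1` A) = 0) ->
  {ae nu, forall w, p w} -> {ae mu, forall x, p (Y x)}.
Proof.
move=> mY law [A [mA A0 sA]]; exists (Y @^-1` A); split.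
- by rewrite -[X in measurable X]setTI; exact: mY.
- exact: law.
- by move=> x /= h; exact: sA.
Qed.

Lemma ae_forall_count d (T : measurableType d) (R : realType)
    (mu : {measure set T -> \bar R}) (I : countType) (p : I -> T -> Prop) :
  (forall i, {ae mu, forall x, p i x}) -> {ae mu, forall x, forall i, p i x}.
Proof.
move=> h; pose p' n x := if unpickle n is Some i then p i x else True.
have : {ae mu, forall x, forall n, p' n x}.
  by apply: ae_foralln => n; rewrite /p'; case: unpickle => [i|]; [exact: h|exact: aeW].
by apply: filterS => x hx i; have := hx (pickle i); rewrite /p' pickleK.
Qed.

(** The Radon-Nikodym derivative, with respect to the law of [Z], of the image under [Z] of [P]
    restricted to [B]. *)
Lemma cond_version_exists d d' (T : measurableType d) (V : measurableType d') (R : realType)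
    (P : probability T R) (Z : T -> V) (B : set T) :
  measurable_fun setT Z -> measurable B -> exists g : V -> R, cond_version P Z B g.
Proof.
move=> mZ mB.
have mZC C : measurable C -> measurable (Z @^-1` C).
  by move=> mC; rewrite -[X in measurable X]setTI; exact: mZ.
pose Zm : {mfun T >-> V} := HB.pack Z (isMeasurableFun.Build _ _ _ _ _ mZ).
pose nu0 := pushforward (mrestr P mB) Zm.
have nu0fin : fin_num_fun nu0.
  move=> C mC; rewrite /nu0 /pushforward /mrestr; apply: fin_num_measure.
  by apply: measurableI => //; exact: mZC.
pose nu : {finite_measure set V -> \bar R} := HB.pack nu0 (Measure_isFinite.Build _ _ _ nu0 nu0fin).
pose mu : probability V R := distribution P Zm.
have [|g [g0 gfin gi gE]] := @radon_nikodym_sigma_finite _ _ _ mu (nu mZ mZ mZ mZ).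
  apply/null_content_dominatesP => C mC muC.
  have muC0 : P (Z @^-1` C) = 0 := muC.
  have mCB : measurable (Z @^-1` C `&` B) by apply: measurableI => //; exact: mZC.
  exact: (subset_measure0 mCB (mZC _ mC) (@subIsetl _ _ _) muC0).
have mg : measurable_fun setT g by case/integrableP : gi.
exists (fine \o g); split.
- by apply: measurableT_comp => //.
- by move=> z; exact: fine_ge0.
- move=> C mC; transitivity (\int[mu]_(x in C) g x); first by rewrite -gE.
  rewrite [LHS]integral_indicE.
  transitivity (\int[P]_(x in setT) ((\1_C (Z x))%:E * g (Z x))).
    apply/esym; apply: (@integral_comp_law _ _ _ _ _ P mu setT Z
      (fun v => (\1_C v)%:E * g v)) => //.
    + by move=> A mA; rewrite setTI.
    + by apply: emeasurable_funM => //; exact/measurable_EFinP/measurable_indic.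
    + by move=> v; rewrite mule_ge0// lee_fin.
  rewrite [RHS]integral_indicE; apply: eq_integral => x _.
  by rewrite fineK// !indicE.
Qed.

Lemma cond_version_integral d d' (T : measurableType d) (V : measurableType d') (R : realType)
    (P : probability T R) (Z : T -> V) (B : set T) (g : V -> R) (phi : V -> \bar R) :
  measurable_fun setT Z -> measurable B -> cond_version P Z B g ->
  measurable_fun setT phi -> (forall v, 0 <= phi v) ->
  \int[P]_(x in B) phi (Z x) = \int[P]_x (phi (Z x) * (g (Z x))%:E).
Proof.
move=> mZ mB [mg g0 gE] mphi phi0.
rewrite integral_indicE; under eq_integral do rewrite muleC.
pose Pi := [set Z @^-1` C | C in (measurable : set (set V))].
apply: (@eq_cond_expectation _ _ _ P Pi) => //.
- by move=> _ [C mC <-]; rewrite -[X in measurable X]setTI; exact: mZ.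
- move=> _ _ [C mC <-] [C' mC' <-]; exists (C `&` C'); first exact: measurableI.
  by rewrite preimage_setI.
- by exists setT.
- exact/measurable_EFinP/measurable_indic.
- exact/measurable_EFinP/(measurableT_comp mg mZ).
- by move=> x; rewrite lee_fin.
- by rewrite integral_indic// setIT; exact: prob_lty.
- move=> _ [C mC <-]; rewrite -gE// integral_indic 1?setIC//.
  by rewrite -[X in measurable X]setTI; exact: mZ.
- move=> _ C mC; rewrite setTI; apply: sub_sigma_algebra; exists (phi @^-1` C) => //.
  by rewrite -[X in measurable X]setTI; exact: mphi.
Qed.

(** The assumption on the start settles [c = 0]: there are then no pieces, while the right-hand side
    says that the path starts in [U]. *)
Lemma exit_gt_blocks (R : realType) (k : time_kind) (S : ptopologicalType) (U : set S)
    (oU : open U) (w : path_space R k S) (Dt : time R k) (c : nat) : U (w (time_zero R k)) ->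
  (forall n, (n < c)%N -> forall s, (time_val s <= time_val Dt)%R ->
     U (w (time_add (time_muln Dt n) s))) <->
  (time_val (time_muln Dt c))%:E < exit_time U w.
Proof.
move=> U0; split=> [h|/(exit_gtP oU) h n nc s sD]; last first.
  apply: h; rewrite tvD !tv_muln (@le_trans _ _ (n.+1%:R * time_val Dt)%R)//.
    by rewrite -addn1 natrD mulrDl mul1r lerD2l.
  by rewrite ler_wpM2r ?tv_ge0// ler_nat.
apply/(exit_gtP oU); elim: c h => [|c IH] h s.
  rewrite tv_muln mul0r => s0; rewrite (_ : s = time_zero R k)//.
  by apply: tv_inj; rewrite tv0; apply/eqP; rewrite eq_le s0 tv_ge0.
move=> sc; have [sc'|/ltW cs] := leP (time_val s) (time_val (time_muln Dt c)).
  by apply: IH => // n nc; apply: h; exact: ltnW.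
have [u su] := time_le_add cs; rewrite su; apply: h => //.
move: sc; rewrite su tvD !tv_muln -(addn1 c) natrD mulrDl mul1r lerD2l.
by [].
Qed.

Section law_from_facts.
Context (R : realType) (k : time_kind) (S : ptopologicalType).
Notation E := (path_space R k S).
Context (K : R.-pker (borel S) ~> E) (sK : strong_markov K).

Lemma law_from_start (mu : probability (borel S) R) (C : set (borel S)) : measurable C ->
  law_from K mu [set w : E | C (w (time_zero R k))] = mu C.
Proof.
move=> mC; transitivity (\int[mu]_x (\1_C x)%:E).
  by apply: eq_integral => x _; rewrite (strong_markov_start sK)// diracE.
by rewrite integral_indic ?setIT.
Qed.

Context (U : set S) (oU : open U).
Hypothesis exit_time_rv : forall (mu : probability (borel S) R) (t : R),
  completed_event (law_from K mu) [set w | exit_time U w <= t%:E].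

Lemma survives_version (mu : probability (borel S) R) (t : R) :
  exists B, measurable B /\
    {ae law_from K mu, forall w, t%:E < exit_time U w <-> B w}.
Proof.
have [B [mB hB]] := completed_event_version (exit_time_rv mu t).
exists (~` B); split; first exact: measurableC.
apply: filterS hB => w h; rewrite ltNge; split; first by move=> /negP n /h.
by move=> nB; apply/negP => /h.
Qed.

Context (rho : probability (borel S) R) (rho_qsd : is_qsd U K rho).

(** Quasistationarity with the denominator cleared. It concerns subsets of [U] only, but rho charges
    only [U], and a path that survives beyond [t] is in [U] at time [t], so [C] may be cut down to
    [U]. *)
Lemma qsd_start (t : time R k) (B : set E) (C : set (borel S)) :
  measurable B -> {ae law_from K rho, forall w, (time_val t)%:E < exit_time U w <-> B w} ->
  measurable C ->
  law_from K rho (B `&` [set w : E | C (w t)]) = rho C * law_from K rho B.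
Proof.
move=> mB hB mC; have [rU hq] := rho_qsd; have [s0 hA] := hq t.
have mU : measurable (U : set (borel S)) by exact: sub_sigma_algebra.
have mCt (D : set (borel S)) : measurable D -> measurable [set w : E | D (w t)].
  by move=> mD; rewrite -[X in measurable X]setTI; exact: measurable_eval.
have E1 : mu_ext (law_from K rho) (survives U (time_val t)) = law_from K rho B.
  exact: (completed_event_ae mB hB).2.
have mBC : measurable (B `&` [set w : E | C (w t)]) by apply: measurableI => //; exact: mCt.
have E2 : mu_ext (law_from K rho) ([set w : E | (C `&` U) (w t)] `&`
    survives U (time_val t)) = law_from K rho (B `&` [set w : E | C (w t)]).
  apply: (completed_event_ae mBC _).2; apply: filterS hB => w h.
  split; first by move=> [[Cw _] /h].
  move=> [/h sw Cw]; split=> //; split=> //.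
  exact: (proj1 (exit_gtP oU w t) sw).
have rCU : rho C = rho (C `&` U).
  rewrite (measureDI rho mC mU) [X in X + _](_ : _ = 0) ?add0e//.
  apply/eqP; rewrite -measure_le0; apply: (@le_trans _ _ (rho (~` U))).
    by apply: le_measure; rewrite ?inE; [exact: measurableD|exact: measurableC|move=> x []].
  by rewrite probability_setC// rU subee.
rewrite rCU (hA _ (measurableI _ _ mC mU) (@subIsetr _ _ _)) /cond_prob E1 E2.
have B0 : 0 < law_from K rho B by rewrite -E1.
have Bfin : law_from K rho B \is a fin_num by exact: fin_num_measure.
have BCfin : law_from K rho (B `&` [set w : E | C (w t)]) \is a fin_num.
  exact: fin_num_measure.
rewrite -[in X in _ = _ * X](fineK Bfin) -EFinM divfK ?fineK//.
by rewrite gt_eqF// fine_gt0// B0 ltey_eq Bfin.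
Qed.

End law_from_facts.

(** * Fragments at random indices, from the Markov property of fragments at fixed indices *)

Section selection.
Context (R : realType) (k : time_kind) (S : ptopologicalType).
Notation E := (path_space R k S).
Context (K : R.-pker (borel S) ~> E) (sK : strong_markov K).
Context (N : nat) (r0 : 'I_N) (Dt : time R k).
Notation tm := (time_muln Dt).
Context d (Omega : measurableType d).
Context (Y : 'I_N -> Omega -> E) (t_wall : 'I_N -> nat -> Omega -> R).
Context d' (Omega' : measurableType d') (Q : probability Omega' R) (pi : Omega' -> Omega).
Context (frag : 'I_N * nat -> Omega' -> E) (pst : 'I_N * nat -> set (set Omega')).
Hypotheses (frag_measurable : forall rm, measurable_fun setT (frag rm))
  (frag_le : forall rm o t, (time_val t <= time_val Dt)%R ->
    frag rm o t = Y rm.1 (pi o) (time_add (tm rm.2) t))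
  (frag_markov : forall rm G A, pst rm G -> measurable A ->
    Q (G `&` frag rm @^-1` A) = \int[Q]_(o in G) K (Y rm.1 (pi o) (tm rm.2)) A)
  (pst_sigma : forall rm, sigma_algebra setT (pst rm))
  (pst_measurable : forall rm, pst rm `<=` measurable)
  (pst_wall : forall rm W, wall_events t_wall W -> pst rm (pi @^-1` W))
  (pst_start : forall rm (C : set (borel S)), measurable C ->
    pst rm [set o | C (Y rm.1 (pi o) (tm rm.2))])
  (pst_frag : forall rm rm' (B : set E), before rm' rm -> measurable B ->
    pst rm (frag rm' @^-1` B)).

Notation t_at o := (fun r m => t_wall r m (pi o)).

(** Finer than the index of the next fragment: the counts of all copies are needed to factor the
    survival of the first [j] fragments over the copies. *)
Definition state (j : nat) (o : Omega') : {ffun 'I_N -> nat} * 'I_N :=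
  (counts r0 (t_at o) j, next_copy r0 (t_at o) (counts r0 (t_at o) j)).

Definition state_index (s : {ffun 'I_N -> nat} * 'I_N) : 'I_N * nat := (s.2, s.1 s.2).

Definition selected (j : nat) (o : Omega') : E := frag (fragment_index r0 (t_at o) j) o.

Lemma state_indexE j o : fragment_index r0 (t_at o) j = state_index (state j o).
Proof. by []. Qed.

Lemma frag0 rm o : frag rm o (time_zero R k) = Y rm.1 (pi o) (tm rm.2).
Proof. by rewrite frag_le ?tv0 ?tv_ge0// time_add0. Qed.

Let wall_state j s : exists2 W, wall_events t_wall W & state j @^-1` [set s] = pi @^-1` W.
Proof.
exists ([set o | counts r0 (fun r m => t_wall r m o) j = s.1] `&`
  [set o | next_copy r0 (fun r m => t_wall r m o) s.1 = s.2]).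
  apply: (@measurableI _ (g_sigma_algebraType _)); first exact: wall_counts.
  exact: wall_next_copy.
case: s => c r; apply/seteqP; split=> o; rewrite /state/=.
  by case=> <- <-; split.
by move=> [/= <- <-].
Qed.

Let pst_state j rm s : pst rm (state j @^-1` [set s]).
Proof. by have [W hW ->] := wall_state j s; exact: pst_wall. Qed.

Lemma state_measurable j s : measurable (state j @^-1` [set s]).
Proof. exact: pst_measurable (pst_state j (r0, 0%N) s). Qed.

Let pst0 rm : pst rm set0. Proof. by case: (pst_sigma rm). Qed.
Let pstU rm (F : nat -> set Omega') : (forall n, pst rm (F n)) -> pst rm (\bigcup_n F n).
Proof. by case: (pst_sigma rm) => _ _; apply. Qed.
Let pstC rm A : pst rm A -> pst rm (~` A).
Proof. by case: (pst_sigma rm) => _ + _ => /[apply]; rewrite setTD. Qed.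
Let pstI rm A B : pst rm A -> pst rm B -> pst rm (A `&` B).
Proof.
move=> hA hB; rewrite -(setCK (A `&` B)) setCI; apply: pstC.
rewrite -bigcup2E; apply: pstU => -[|[|n]] /=; [exact: pstC|exact: pstC|exact: pst0].
Qed.

Let pst_countable_bigcup rm (I : countType) (F : I -> set Omega') :
  (forall i, pst rm (F i)) -> pst rm (\bigcup_i F i).
Proof.
move=> hF; pose G n := if unpickle n is Some i then F i else set0.
rewrite (_ : \bigcup_i F i = \bigcup_n G n).
  by apply: pstU => n; rewrite /G; case: unpickle.
apply/seteqP; split=> o [i _].
  by move=> Fi; exists (pickle i) => //; rewrite /G pickleK.
by rewrite /G; case: unpickle => // i' Fi'; exists i'.
Qed.

Lemma measurable_selected j : measurable_fun setT (selected j).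
Proof.
move=> _ B mB; rewrite setTI.
rewrite (_ : selected j @^-1` B =
  \bigcup_s (state j @^-1` [set s] `&` frag (state_index s) @^-1` B)).
  apply: countable_bigcupT_measurable => // s; apply: measurableI.
    exact: state_measurable.
  by rewrite -[X in measurable X]setTI; exact: frag_measurable.
apply/seteqP; split=> o; first by move=> h; exists (state j o).
by case=> s _ [/= sE]; rewrite /selected state_indexE sE.
Qed.

(** The analogue of the sigma-algebra at a stopping time: on each value of the state, the event must
    belong to the past of the fragment which that value selects. *)
Definition past_of (j : nat) (G : set Omega') : Prop :=
  forall s, pst (state_index s) (G `&` state j @^-1` [set s]).

Lemma past_of_sigma j : sigma_algebra setT (past_of j).
Proof.
split=> [s|A hA s|F hF s]; first by rewrite set0I.
  rewrite setTD (_ : ~` A `&` _ = state j @^-1` [set s] `&` ~` (A `&` state j @^-1` [set s])).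
    by apply: pstI; [exact: pst_state|exact: pstC].
  apply/seteqP; split=> o; first by case=> nA so; split=> // -[].
  by case=> so h; split=> // Ao; apply: h.
by rewrite setI_bigcupl; apply: pstU => n; exact: hF.
Qed.

Lemma past_of_measurable j : past_of j `<=` measurable.
Proof.
move=> G hG; rewrite (_ : G = \bigcup_s (G `&` state j @^-1` [set s])).
  by apply: countable_bigcupT_measurable => // s; exact: pst_measurable (hG s).
by rewrite -setI_bigcupr (_ : \bigcup_s _ = setT) ?setIT//; apply/seteqP; split=> // o _; exists (state j o).
Qed.

Lemma past_ofI j : setI_closed (past_of j).
Proof.
by move=> A B hA hB s; rewrite -[state j @^-1` _]setIid setIACA; exact: pstI.
Qed.

(** Cutting also along the state at [l] makes both indices deterministic. The set [B] depends on the
    index because each fragment has its own version of the survival event. *)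
Lemma past_of_frag j l (B : 'I_N * nat -> set E) : (l < j)%N -> (forall rm, measurable (B rm)) ->
  past_of j [set o | B (fragment_index r0 (t_at o) l) (selected l o)].
Proof.
move=> lj mB s.
pose F (s' : {ffun 'I_N -> nat} * 'I_N) := state l @^-1` [set s'] `&` state j @^-1` [set s] `&`
  frag (state_index s') @^-1` B (state_index s').
rewrite (_ : _ `&` _ = \bigcup_s' F s').
  apply: pst_countable_bigcup => s'; rewrite /F.
  have [bef|nbef] := pselect (before (state_index s') (state_index s)).
    by apply: pstI; [apply: pstI; exact: pst_state|exact: pst_frag].
  (* If both fragments belong to the same copy, the earlier one has index below the count at [j],
     which is the index of the later one. Pairs of states that are not ordered in this way do not
     occur. *)
  rewrite (_ : _ `&` _ = set0)//; apply/seteqP; split=> // o [[sl sj] _].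
  apply: nbef; rewrite /before /= => s12.
  have /fragment_indexP : exists2 l, (l < j)%N &
    fragment_index r0 (t_at o) l = (s'.2, s'.1 s'.2) by exists l; rewrite // state_indexE sl.
  have -> : counts r0 (t_at o) j = s.1 by rewrite -sj.
  by rewrite s12.
apply/seteqP; split=> o.
  by move=> [/= h sj]; exists (state l o) => //; split.
by case=> s' _ [[/= sl sj]]; rewrite /selected state_indexE sl.
Qed.

Lemma past_of_start j (C : set (borel S)) : measurable C ->
  past_of j [set o | C (selected j o (time_zero R k))].
Proof.
move=> mC s.
rewrite (_ : _ `&` _ = [set o | C (Y (state_index s).1 (pi o) (tm (state_index s).2))] `&`
    state j @^-1` [set s]); first by apply: pstI; [exact: pst_start|exact: pst_state].
by apply/seteqP; split=> o [/= + sE]; rewrite /selected state_indexE sE frag0.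
Qed.

Lemma past_of_generated j (G : set Omega') : generated `I_j selected G -> past_of j G.
Proof.
move=> hG; apply: (smallest_sub (past_of_sigma j) _ hG) => _ [l /= lj [B mB <-]].
exact: (@past_of_frag j l (fun=> B) lj).
Qed.

Let measurable_selected_at j t : measurable_fun setT (fun o => selected j o t : borel S).
Proof. exact: (measurableT_comp (@measurable_eval R k S t) (measurable_selected j)). Qed.

Lemma measurable_K_selected j t (A : set E) : measurable A ->
  measurable_fun setT (fun o => K (selected j o t) A).
Proof. by move=> mA; exact: (measurableT_comp (measurable_kernel K _ mA) (measurable_selected_at j t)). Qed.

(** On each fibre of [state j] this is the Markov property of a fixed fragment, relative to a past
    that contains the trace of [G]. *)
Theorem selected_markov j G A : past_of j G -> measurable A ->
  Q (G `&` selected j @^-1` A) = \int[Q]_(o in G) K (selected j o (time_zero R k)) A.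
Proof.
move=> hG mA; have mG := past_of_measurable hG.
have mXA : measurable (selected j @^-1` A).
  by rewrite -[X in measurable X]setTI; exact: measurable_selected.
have f0 o : 0 <= K (selected j o (time_zero R k)) A by [].
apply: (@measure_countable_fibers _ _ _ _ (state j) Q
  (density Q f0 (measurable_K_selected j (time_zero R k) mA))) => // [s||s].
- exact: state_measurable.
- exact: measurableI.
rewrite /density; transitivity (Q ((G `&` state j @^-1` [set s]) `&` frag (state_index s) @^-1` A)).
  congr (Q _); apply/seteqP; split=> o [[Go h1] h2].
    by split; [split|move: h1; rewrite /= /selected state_indexE h2].
  by split; [split=> //; rewrite /= /selected state_indexE h1|].
rewrite (frag_markov (hG s) mA).
by apply: eq_integral => o /set_mem[_ /= sE]; rewrite /selected state_indexE sE frag0.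
Qed.

Definition start_law (j : nat) : probability (borel S) R :=
  distribution Q (HB.pack (fun o => selected j o (time_zero R k) : borel S)
    (isMeasurableFun.Build _ _ _ _ _ (measurable_selected_at j (time_zero R k))) : {mfun Omega' >-> borel S}).

Lemma selected_law j A : measurable A ->
  Q (selected j @^-1` A) = law_from K (start_law j) A.
Proof.
move=> mA; have pT : past_of j setT by case: (past_of_sigma j) => p0 /(_ _ p0) + _; rewrite setD0.
rewrite -[X in Q X]setTI selected_markov//.
apply: (@integral_comp_law _ _ _ _ _ Q (start_law j) setT
  (fun o => selected j o (time_zero R k) : borel S) (fun x => K x A)) => //.
- by move=> C mC; rewrite setTI.
- exact: (measurable_kernel K A mA).
Qed.

Lemma selected_same_transition j : same_transition_law K Q (selected j).
Proof.
move=> C A mC mA D; exact: (selected_markov (past_of_start j mC) mA).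
Qed.

(** A property of the law alone: the selected path has the law of the Markov process started from
    its own initial distribution. *)
Lemma selected_markov_process j : markov_process K Q (selected j).
Proof.
move=> t A B mA hB; have mB := history_sub hB.
have msA : measurable (shift t @^-1` A : set E).
  by rewrite -[X in measurable X]setTI; exact: measurable_shift.
have mBA : measurable (B `&` shift t @^-1` A) by exact: measurableI.
have mXB : measurable (selected j @^-1` B).
  by rewrite -[X in measurable X]setTI; exact: measurable_selected.
rewrite (selected_law j mBA) markov_law_from//.
have mK : measurable_fun setT (fun w : E => K (w t) A).
  exact: (measurableT_comp (measurable_kernel K _ mA) (@measurable_eval R k S t)).
rewrite [LHS]integral_indicE.
rewrite [LHS](_ : _ = \int[Q]_(o in setT) ((\1_B (selected j o))%:E * K (selected j o t) A)).
  by rewrite [RHS]integral_indicE; apply: eq_integral => o _; rewrite !indicE.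
apply/esym; apply: (@integral_comp_law _ _ _ _ _ Q (law_from K (start_law j)) setT (selected j)
  (fun w => (\1_B w)%:E * K (w t) A)) => //.
- exact: measurable_selected.
- by move=> C mC; rewrite setTI; exact: selected_law.
- by apply: emeasurable_funM => //; exact/measurable_EFinP/measurable_indic.
Qed.

Lemma generated_single j (A : set Omega') : generated [set j] selected A ->
  exists2 H, measurable H & A = selected j @^-1` H.
Proof.
move=> hA; pose F := [set B : set Omega' | exists2 H, measurable H & B = selected j @^-1` H].
suff : F A by [].
apply: (smallest_sub _ _ hA) => [|_ [_ -> [B mB <-]]]; last by exists B.
split=> [|B [H mH ->]|B hB].
- by exists set0 => //; rewrite preimage_set0.
- by exists (~` H); [exact: measurableC|rewrite setTD preimage_setC].
- have /choice[H hH] n : exists H, measurable H /\ B n = selected j @^-1` H.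
    by have [H mH BH] := hB n; exists H.
  exists (\bigcup_n H n); first by apply: bigcup_measurable => n _; have [] := hH n.
  by rewrite preimage_bigcup; apply: eq_bigcupr => n _; have [] := hH n.
Qed.

(** The kernel gives a version for the event of the path, and Radon-Nikodym a version [g] for the
    past event [B]. For the intersection, the condition [C] on the start joins [B] in the past, the
    Markov property replaces the path by the kernel, and [B] is then replaced by [g]. *)
Lemma selected_cond_independent j :
  cond_independent Q (fun o => selected j o (time_zero R k) : borel S)
    (generated [set j] selected) (generated `I_j selected).
Proof.
move=> A B /generated_single[H mH ->] hB.
have pB := past_of_generated hB; have mB := past_of_measurable pB.
pose Z o := selected j o (time_zero R k) : borel S.
have mZ : measurable_fun setT Z by exact: measurable_selected_at.
have [g hg] := cond_version_exists Q mZ mB.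
have [mg g0 gE] := hg.
have mK : measurable_fun setT (fun x => K x H) by exact: measurable_kernel.
have mfK : measurable_fun setT (fun x => fine (K x H)) by exact: measurableT_comp.
have KE x : (fine (K x H))%:E = K x H by rewrite fineK//; exact: pker_fin.
exists (fun x => fine (K x H)), g; split=> //.
  split=> [//|x|C mC]; first exact: fine_ge0.
  rewrite (selected_markov (past_of_start j mC) mH).
  by apply: eq_integral => o _; rewrite KE.
split=> [|x|C mC]; first exact: measurable_funM.
  by rewrite mulr_ge0// fine_ge0.
have mZC : measurable (Z @^-1` C) by rewrite -[X in measurable X]setTI; exact: mZ.
have pG : past_of j (Z @^-1` C `&` B).
  by apply: past_ofI => //; exact: past_of_start.
transitivity (Q ((Z @^-1` C `&` B) `&` selected j @^-1` H)).
  by congr (Q _); rewrite setIA setIAC.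
rewrite (selected_markov pG mH).
transitivity (\int[Q]_(o in B) ((\1_C (Z o))%:E * K (Z o) H)).
  rewrite setIC integral_mkcondr; apply: eq_integral => o _.
  rewrite patchE indicE; case: ifPn => [/set_mem h|h].
    by rewrite mem_set// mul1e.
  by rewrite memNset ?mul0e// => h'; move: h; rewrite mem_set.
have mphi : measurable_fun setT (fun x => (\1_C x)%:E * K x H).
  by apply: emeasurable_funM => //; exact/measurable_EFinP/measurable_indic.
have phi0 x : 0 <= (\1_C x)%:E * K x H by rewrite mule_ge0// lee_fin.
rewrite (cond_version_integral mZ mB hg mphi phi0).
rewrite [RHS]integral_indicE; apply: eq_integral => o _.
by rewrite EFinM KE muleA !indicE.
Qed.

Context (U : set S) (oU : open U)
  (exit_time_rv : forall (mu : probability (borel S) R) (t : R),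
    completed_event (law_from K mu) [set w | exit_time U w <= t%:E])
  (rho : probability (borel S) R) (rho_qsd : is_qsd U K rho) (P : probability Omega R).
Hypotheses (Y_measurable : forall r, measurable_fun setT (Y r))
  (Y_law : forall r A, measurable A -> P (Y r @^-1` A) = law_from K rho A)
  (Y_indep : forall A : 'I_N -> set E, (forall r, measurable (A r)) ->
    P (\bigcap_(r in setT) (Y r @^-1` A r)) = \prod_(r < N) P (Y r @^-1` A r))
  (t_wall_measurable : forall r m, measurable_fun setT (t_wall r m))
  (t_wall_indep : independent P (wall_events t_wall) (generated setT Y))
  (pi_measurable : measurable_fun setT pi)
  (pi_law : forall G, measurable G -> Q (pi @^-1` G) = P G).

Definition survived (j : nat) : set Omega' :=
  [set o | forall i, (i < j)%N -> (time_val Dt)%:E < exit_time U (selected i o)].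

Let copy_survives n := sval (cid (survives_version exit_time_rv rho (time_val (tm n)))).

Let copy_survives_measurable n : measurable (copy_survives n).
Proof. by rewrite /copy_survives; case: cid => B []. Qed.

Let copy_survivesP n : {ae law_from K rho, forall w,
  (time_val (tm n))%:E < exit_time U w <-> copy_survives n w}.
Proof. by rewrite /copy_survives; case: cid => B []. Qed.

Let mU : measurable (U : set (borel S)). Proof. exact: sub_sigma_algebra. Qed.

Let measurable_Ypi r : measurable_fun setT (fun o => Y r (pi o)).
Proof. exact: (measurableT_comp (Y_measurable r) pi_measurable). Qed.

Let ae_copy (p : E -> Prop) r : {ae law_from K rho, forall w, p w} ->
  {ae Q, forall o, p (Y r (pi o))}.
Proof.
apply: ae_pullback; first exact: measurable_Ypi.
move=> A mA A0; have mYA : measurable (Y r @^-1` A).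
  by rewrite -[X in measurable X]setTI; exact: Y_measurable.
have E1 : Q (pi @^-1` (Y r @^-1` A)) = law_from K rho A by rewrite pi_law// Y_law.
by rewrite A0 in E1.
Qed.

(** The first [j] fragments are, for each copy, its first [counts] pieces without gaps, so all of
    them survive exactly when each copy survives up to the end of those pieces. *)
Let survived_copies j : {ae Q, forall o, survived j o <->
  forall r, copy_survives (counts r0 (t_at o) j r) (Y r (pi o))}.
Proof.
have h1 : {ae Q, forall o, forall rn : 'I_N * nat,
    (time_val (tm rn.2))%:E < exit_time U (Y rn.1 (pi o)) <->
    copy_survives rn.2 (Y rn.1 (pi o))}.
  apply: ae_forall_count => -[r n].
  exact: (ae_copy (p := fun w => (time_val (tm n))%:E < exit_time U w <->
    copy_survives n w) r (copy_survivesP n)).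
have h2 : {ae Q, forall o, forall r, U (Y r (pi o) (time_zero R k))}.
  apply: ae_forall_count => r.
  apply: (ae_copy (p := fun w => U (w (time_zero R k)))).
  have mU0 : measurable [set w : E | U (w (time_zero R k))].
    by rewrite -[X in measurable X]setTI; exact: measurable_eval.
  exists (~` [set w : E | U (w (time_zero R k))]); split=> //.
    exact: measurableC.
  have : law_from K rho (~` [set w : E | U (w (time_zero R k))]) =
      1 - law_from K rho [set w : E | U (w (time_zero R k))] := probability_setC _ mU0.
  by move=> ->; rewrite law_from_start// rho_qsd.1 subee.
apply: filterS2 h1 h2 => o h1 h2.
transitivity (forall r, (time_val (tm (counts r0 (t_at o) j r)))%:E < exit_time U (Y r (pi o))).
  split=> [h r|h l lj].
    apply/(exit_gt_blocks oU _ _ (h2 r)) => n nc s sD.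
    have /fragment_indexP[l lj lE] := nc.
    have /(exit_gtP oU)/(_ _ sD) := h l lj.
    by rewrite /selected lE frag_le.
  apply/(exit_gtP oU) => s sD; rewrite /selected frag_le//.
  set rn := fragment_index _ _ _.
  apply: (proj2 (exit_gt_blocks oU Dt (counts r0 (t_at o) j rn.1) (h2 rn.1)) (h rn.1)) => //.
  by apply/fragment_indexP; exists l => //; exact: surjective_pairing.
by split=> h r; [apply/(h1 (r, _)); exact: h|apply/(h1 (r, _)); exact: h].
Qed.

(** A fixed fragment has the law of the process started from the distribution of its own starting
    point, which may differ from rho; hence the appeal to completeness under every initial law. *)
Let fragment_version rm : exists B, measurable B /\
  {ae Q, forall o, (time_val Dt)%:E < exit_time U (frag rm o) <-> B (frag rm o)}.
Proof.
pose Z o := frag rm o (time_zero R k) : borel S.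
have mZ : measurable_fun setT Z.
  exact: (measurableT_comp (@measurable_eval R k S (time_zero R k)) (frag_measurable rm)).
pose mu : probability (borel S) R :=
  distribution Q (HB.pack Z (isMeasurableFun.Build _ _ _ _ _ mZ) : {mfun Omega' >-> borel S}).
have [B [mB hB]] := survives_version exit_time_rv mu (time_val Dt).
exists B; split=> //.
apply: (ae_pullback (p := fun w => (time_val Dt)%:E < exit_time U w <-> B w) _ _ hB) => // A mA A0.
have pT : pst rm setT by rewrite -setC0; exact: pstC.
have E1 : Q (frag rm @^-1` A) = law_from K mu A.
  rewrite -[X in Q X]setTI (frag_markov pT mA).
  transitivity (\int[Q]_(o in setT) K (Z o) A).
    by apply: eq_integral => o _; rewrite /Z frag0.
  apply: (@integral_comp_law _ _ _ _ _ Q mu setT Z (fun x => K x A)) => //.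
  - by move=> C mC; rewrite setTI.
  - exact: (measurable_kernel K A mA).
by rewrite A0 in E1.
Qed.

Let fragment_survives rm := sval (cid (fragment_version rm)).

(** A second version of survival, through fragments. It belongs to [past_of j], as the Markov
    property requires; the version through copies factors by independence, but [copy_survives n]
    need not lie in the history up to n Dt. *)
Let selected_survives j : set Omega' := [set o | forall l, (l < j)%N ->
  fragment_survives (fragment_index r0 (t_at o) l) (selected l o)].

Let past_selected_survives j : past_of j (selected_survives j).
Proof.
have ps := past_of_sigma j.
rewrite (_ : selected_survives j = ~` \bigcup_l (~` [set o | (l < j)%N ->
    fragment_survives (fragment_index r0 (t_at o) l) (selected l o)])); last first.
  rewrite setC_bigcup; apply/seteqP; split=> o h l => [_|lj].
    by rewrite setCK; exact: h.
  by have := h l I; rewrite setCK; apply.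
case: ps => p0 pC pU; rewrite -setTD; apply: (pC); apply: pU => l.
rewrite -setTD; apply: (pC); have [lj|lj] := ltnP l j.
  rewrite (_ : [set _ | _] = [set o | fragment_survives (fragment_index r0 (t_at o) l) (selected l o)]).
    apply: past_of_frag => // rm; rewrite /fragment_survives; by case: cid => B [].
  by apply/seteqP; split=> o h; [exact: h|].
rewrite (_ : [set _ | _] = setT); first by have := pC _ p0; rewrite setD0.
by apply/seteqP; split.
Qed.

Let survived_version j : {ae Q, forall o, survived j o <-> selected_survives j o}.
Proof.
have h : {ae Q, forall o, forall rm, (time_val Dt)%:E < exit_time U (frag rm o) <->
    fragment_survives rm (frag rm o)}.
  by apply: ae_forall_count => rm; rewrite /fragment_survives; case: cid => B [].
by apply: filterS h => o h; split=> H l lj; apply/h; exact: H.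
Qed.

(** On a fibre of the state, survival is a product event over the copies, and the start of the next
    fragment constrains the factor of one copy only. Quasistationarity extracts rho C from that
    factor, whichever copy it is. *)
Let selected_survives_start j (C : set (borel S)) : measurable C ->
  Q (selected_survives j `&` [set o | C (selected j o (time_zero R k))]) =
  rho C * Q (selected_survives j).
Proof.
move=> mC; have mV := past_of_measurable (past_selected_survives j).
have mX0 := past_of_measurable (past_of_start j mC).
have rC0 : (0 <= fine (rho C))%R by exact: fine_ge0.
have rCE : (fine (rho C))%:E = rho C by rewrite fineK// fin_num_measure.
rewrite -rCE.
apply: (measure_countable_fibers (N := state j) (mu1 := Q) (mu2 := mscale (NngNum rC0) Q)) => //.
- exact: state_measurable.
- exact: measurableI.
move=> s.
rewrite [RHS](_ : _ = rho C * Q (selected_survives j `&` state j @^-1` [set s])); last first.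
  by rewrite -[X in _ = X * _]rCE.
have [W hW WE] := wall_state j s.
have mW : measurable W by exact: (wall_events_measurable t_wall_measurable).
pose B r := copy_survives (s.1 r).
have mB r : measurable (B r) by exact: copy_survives_measurable.
(* The next fragment starts exactly at the time up to which its copy is required to survive, which
   is what quasistationarity needs. *)
pose B' r := if r == s.2 then B r `&` [set w : E | C (w (tm (s.1 r)))] else B r.
have mCt t : measurable [set w : E | C (w t)].
  by rewrite -[X in measurable X]setTI; exact: measurable_eval.
have mB' r : measurable (B' r) by rewrite /B'; case: ifP => // _; exact: measurableI.
have mpi' G : measurable G -> measurable (pi @^-1` G).
  by move=> mG; rewrite -[X in measurable X]setTI; exact: pi_measurable.
have mWB D : (forall r, measurable (D r)) -> measurable (W `&` copies_in Y D).
  by move=> mD; apply: measurableI => //; exact: copies_in_measurable.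
have ms := state_measurable j s.
have ae_s : {ae Q, forall o, selected_survives j o <->
    forall r, copy_survives (counts r0 (t_at o) j r) (Y r (pi o))}.
  by apply: filterS2 (survived_copies j) (survived_version j) => o h1 h2;
    split=> [/h2/h1|/h1/h2].
have E1 : Q (selected_survives j `&` [set o | C (selected j o (time_zero R k))] `&`
    state j @^-1` [set s]) = P (W `&` copies_in Y B').
  rewrite -pi_law; last exact: mWB.
  apply: ae_measure_eq.
  - exact: (measurableI _ _ (measurableI _ _ mV mX0) ms).
  - by apply: mpi'; exact: mWB.
  apply: filterS ae_s => o h.
  have Wo : state j o = s <-> W (pi o) by rewrite -[W (pi o)]/((pi @^-1` W) o) -WE.
  split.
    move=> [[/h ho Co] so]; split; first exact/Wo.
    move=> r _; rewrite /= /B'; have cE : counts r0 (t_at o) j = s.1 by rewrite -so.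
    have Br : B r (Y r (pi o)) by rewrite /B -cE; exact: ho.
    case: eqP => // rE; split=> //; move: Co.
    by rewrite /= /selected state_indexE so frag0 /state_index/= -rE.
  move=> [/Wo so hB]; have cE : counts r0 (t_at o) j = s.1 by rewrite -so.
  split=> //; split.
    apply/h => r; rewrite cE; have := hB r I; rewrite /= /B'.
    by case: eqP => // _ [].
  rewrite /= /selected state_indexE so frag0 /state_index/=.
  by have := hB s.2 I; rewrite /= /B' eqxx => -[].
have E2 : Q (selected_survives j `&` state j @^-1` [set s]) = P (W `&` copies_in Y B).
  rewrite -pi_law; last exact: mWB.
  apply: ae_measure_eq; [exact: measurableI|by apply: mpi'; exact: mWB|].
  apply: filterS ae_s => o h.
  have Wo : state j o = s <-> W (pi o) by rewrite -[W (pi o)]/((pi @^-1` W) o) -WE.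
  split.
    move=> [/h ho so]; split; first exact/Wo.
    have cE : counts r0 (t_at o) j = s.1 by rewrite -so.
    by move=> r _; rewrite /= /B -cE; exact: ho.
  move=> [/Wo so hB]; have cE : counts r0 (t_at o) j = s.1 by rewrite -so.
  by split=> //; apply/h => r; rewrite cE; exact: (hB r I).
transitivity (P (W `&` copies_in Y B')); first exact: E1.
rewrite E2 (copies_in_indep Y_law Y_indep t_wall_indep hW mB').
rewrite (copies_in_indep Y_law Y_indep t_wall_indep hW mB).
rewrite (bigD1 s.2)//= [in RHS](bigD1 s.2)//= {1}/B' eqxx.
rewrite (qsd_start oU rho_qsd (mB s.2) (copy_survivesP (s.1 s.2)) mC).
rewrite (_ : \prod_(i < N | i != s.2) law_from K rho (B' i) =
  \prod_(i < N | i != s.2) law_from K rho (B i)); last first.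
  by apply: eq_bigr => r /negbTE rs; rewrite /B' rs.
by rewrite -!muleA [LHS]muleCA.
Qed.

(** The constant is the probability that the first [j] fragments survive. On that event the next one
    starts from rho, and the Markov property relative to [past_of j] extends this from the starting
    point to the whole path. *)
Theorem survived_regenerates j : exists V, [/\ measurable V,
  {ae Q, forall o, survived j o <-> V o} & exists a : {nonneg R},
  forall A, measurable A -> Q (V `&` selected j @^-1` A) = a%:num%:E * law_from K rho A].
Proof.
have pV := past_selected_survives j; have mV := past_of_measurable pV.
exists (selected_survives j); split; [exact: mV|exact: (survived_version j)|].
have a0 : (0 <= fine (Q (selected_survives j)))%R by exact: fine_ge0.
have QE : (fine (Q (selected_survives j)))%:E = Q (selected_survives j).
  by rewrite fineK// fin_num_measure.
exists (NngNum a0) => A mA; rewrite (selected_markov pV mA).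
have mK : measurable_fun setT (fun x => K x A) by exact: measurable_kernel.
rewrite -[RHS]/((fine (Q (selected_survives j)))%:E * \int[rho]_x K x A).
rewrite -(ge0_integral_mscale rho measurableT (NngNum a0))//.
apply: (@integral_comp_law _ _ _ _ _ Q (mscale (NngNum a0) rho) _
  (fun o => selected j o (time_zero R k) : borel S) (fun x => K x A)) => // C mC.
transitivity (Q (selected_survives j) * rho C).
  by rewrite muleC; exact: selected_survives_start.
by rewrite -[X in X * _ = _]QE.
Qed.

End selection.

(* The survival event is measurable only for the completion of P, hence the version V. *)
Definition regenerative (R : realType) (k : time_kind) (S : ptopologicalType)
    (U : set S) (Dt : time R k) d (Omega : measurableType d) (P : probability Omega R)
    (lam : probability (path_space R k S) R) (X : nat -> Omega -> path_space R k S) : Prop :=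
  (forall j, measurable_fun setT (X j)) /\
  forall j, exists V, [/\ measurable V,
    {ae P, forall o, (forall i, (i < j)%N ->
       (time_val Dt)%:E < exit_time U (X i o))%E <-> V o} &
    exists a : {nonneg R}, forall A, measurable A ->
      P (V `&` X j @^-1` A) = a%:num%:E * lam A].

(** Phrased with [fragment_index] rather than a given enumeration, so that it applies both to the
    given copies and to a single path with a deterministic clock. *)
Theorem parallel_construction (R : realType) (k : time_kind) (S : ptopologicalType)
  (S_standard : standard_borel R S)
  (K : R.-pker (borel S) ~> path_space R k S) (sK : strong_markov K)
  (U : set S) (oU : open U)
  (exit_time_rv : forall (mu : probability (borel S) R) (t : R),
    completed_event (law_from K mu) [set w | exit_time U w <= t%:E])
  (rho : probability (borel S) R) (rho_qsd : is_qsd U K rho)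
  (N : nat) (r0 : 'I_N) (Dt : time R k)
  (d : measure_display) (Omega : measurableType d) (P : probability Omega R)
  (Y : 'I_N -> Omega -> path_space R k S)
  (Y_measurable : forall r, measurable_fun setT (Y r))
  (Y_law : forall r A, measurable A -> P (Y r @^-1` A) = law_from K rho A)
  (Y_indep : forall A : 'I_N -> set (path_space R k S), (forall r, measurable (A r)) ->
    P (\bigcap_(r in setT) (Y r @^-1` A r)) = \prod_(r < N) P (Y r @^-1` A r))
  (t_wall : 'I_N -> nat -> Omega -> R)
  (t_wall_measurable : forall r m, measurable_fun setT (t_wall r m))
  (t_wall_indep : independent P (wall_events t_wall) (generated setT Y)) :
  exists (d' : measure_display) (Omega' : measurableType d')
    (P' : probability Omega' R) (pi : Omega' -> Omega)
    (X : nat -> Omega' -> path_space R k S),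
  (measurable_fun setT pi /\ forall G, measurable G -> P' (pi @^-1` G) = P G) /\
  (forall o j t, (time_val t <= time_val Dt)%R ->
     let rm := fragment_index r0 (fun r m => t_wall r m (pi o)) j in
     X j o t = Y rm.1 (pi o) (time_add (time_muln Dt rm.2) t)) /\
  (forall j, [/\ measurable_fun setT (X j), markov_process K P' (X j) &
     same_transition_law K P' (X j)]) /\
  (forall j, cond_independent P' (fun o => X j o (time_zero R k) : borel S)
     (generated [set j] X) (generated `I_j X)) /\
  regenerative U Dt P' (law_from K rho) X.
Proof.
have [C [mC sepC]] := standard_borel_separating S_standard.
have [d' [W' [Q [pi [Z [mpi mZ rectQ]]]]]] :=
  ionescu_tulcea P (restart_kernel K r0 Dt Y_measurable).
pose frag := fragment Dt Y pi Z.
pose pst := past_fragment r0 Dt Y t_wall pi Z.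
have frag_measurable rm : measurable_fun setT (frag rm).
  exact: (measurable_fragment mC sepC Dt Y_measurable mpi mZ).
have frag_le' rm o t : (time_val t <= time_val Dt)%R ->
    frag rm o t = Y rm.1 (pi o) (time_add (time_muln Dt rm.2) t).
  exact: fragment_le.
have frag_markov rm G A : pst rm G -> measurable A ->
    Q (G `&` frag rm @^-1` A) = \int[Q]_(o in G) K (Y rm.1 (pi o) (time_muln Dt rm.2)) A.
  exact: (fragment_markov mC sepC sK Y_law Y_indep t_wall_measurable t_wall_indep mpi mZ rectQ).
have pst_sigma rm : sigma_algebra setT (pst rm) by exact: smallest_sigma_algebra.
have pst_measurable rm : pst rm `<=` measurable.
  exact: (@past_fragment_measurable _ _ _ _ r0 Dt _ _ Y t_wall Y_measurable t_wall_measurable _ _ pi Z mpi mZ).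
have pst_wall rm W : wall_events t_wall W -> pst rm (pi @^-1` W).
  by move=> hW; apply: (@past_fragment_pi _ _ _ _ r0 Dt _ _ Y t_wall _ _ pi Z rm); exact: past_wall.
have pst_start rm (B : set (borel S)) : measurable B ->
    pst rm [set o | B (Y rm.1 (pi o) (time_muln Dt rm.2))].
  move=> mB; apply: (@past_fragment_pi _ _ _ _ r0 Dt _ _ Y t_wall _ _ pi Z rm
    (Y rm.1 @^-1` [set w | B (w (time_muln Dt rm.2))])).
  apply: past_copy; first by rewrite -[X in measurable X]setTI; exact: measurable_eval.
  by move=> _; exact: history_eval.
have pst_frag rm rm' B : before rm' rm -> measurable B -> pst rm (frag rm' @^-1` B).
  exact: (past_fragment_fragment mC sepC).
have pi_law G : measurable G -> Q (pi @^-1` G) = P G by exact: (fragment_pi rectQ).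
exists d', W', Q, pi, (selected r0 t_wall pi frag); split; first by split.
split; first by move=> o j t tD rm; rewrite /selected frag_le'.
split.
  move=> j; split.
  - exact: (measurable_selected r0 frag_measurable pst_measurable pst_wall j).
  - exact: (selected_markov_process sK r0 frag_measurable frag_le' frag_markov pst_sigma
      pst_measurable pst_wall j).
  - exact: (selected_same_transition r0 frag_measurable frag_le' frag_markov pst_sigma
      pst_measurable pst_wall pst_start j).
split.
  move=> j; exact: (selected_cond_independent frag_measurable frag_le' frag_markov
    pst_sigma pst_measurable pst_wall pst_start pst_frag).
split; first by move=> j; exact: (measurable_selected r0 frag_measurable pst_measurable pst_wall j).
move=> j; exact: (survived_regenerates sK r0 frag_measurable frag_le' frag_markov
  pst_sigma pst_measurable pst_wall pst_start pst_frag oU exit_time_rv rho_qsd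
  Y_measurable Y_law Y_indep t_wall_measurable t_wall_indep mpi pi_law j).
Qed.

(** * Exit and occupation *)

(** The value of [f] is recovered from countably many sublevel sets, each replaced by a measurable
    version. *)
Lemma real_version d (T : measurableType d) (R : realType) (P : probability T R)
    (f : T -> \bar R) : (forall t : R, completed_event P [set w | f w <= t%:E]) ->
  (forall w, 0 <= f w) -> {ae P, forall w, f w < +oo} ->
  exists tau : T -> R, [/\ measurable_fun setT tau, (forall w, 0 <= tau w)%R &
    {ae P, forall w, f w = (tau w)%:E}].
Proof.
move=> fP f0 foo.
have /choice[B hB] (q : rat) : exists V, measurable V /\
    {ae P, forall w, f w <= (ratr q)%:E <-> V w}.
  by have [V] := completed_event_version (fP (ratr q)); exists V.
(* The infimum of the [h n] is that of the rationals [q] with [f w <= q], up to a null set; numbers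
   that decode to no rational contribute +oo. *)
pose h (n : nat) (w : T) : \bar R :=
  if unpickle n is Some q then if w \in B q then (ratr q)%:E else +oo else +oo.
have mh n : measurable_fun setT (h n).
  rewrite /h; case: unpickle => [q|]; last exact: measurable_cst.
  apply: measurable_fun_ifT => //.
  by apply: (measurable_fun_bool true); rewrite setTI/= preimage_mem_true; have [] := hB q.
pose g w := einfs (h ^~ w) 0%N.
have mg : measurable_fun setT g by exact: measurable_fun_einfs.
exists (fun w => Num.max 0%R (fine (g w))); split.
- by apply: measurable_maxr => //; exact: measurableT_comp.
- by move=> w; rewrite le_max lexx.
have hB' : {ae P, forall w, forall q, f w <= (ratr q)%:E <-> B q w}.
  by apply: ae_forall_count => q; have [] := hB q.
apply: filterS2 foo hB' => w foo hw.
have gE : g w = f w.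
  apply/eqP; rewrite eq_le; apply/andP; split; last first.
    apply: le_ereal_inf_tmp => _ [n _ <-]; rewrite /h.
    case: unpickle => [q|]; last exact: leey.
    by case: ifPn => [/set_mem/hw//|_]; exact: leey.
  apply/lee_addgt0Pr => e e0; have fwE : f w = (fine (f w))%:E.
    by rewrite fineK// ge0_fin_numE.
  have lt : (fine (f w) < fine (f w) + e)%R by rewrite ltrDl.
  have [q] := rat_in_itvoo lt; rewrite in_itv/= => /andP[q1 q2].
  apply: (@le_trans _ _ (ratr q)%:E); last by rewrite fwE -EFinD lee_fin ltW.
  apply: ereal_inf_lbound; exists (pickle q) => //; rewrite /h pickleK mem_set//.
  by apply/hw; rewrite fwE lee_fin ltW.
rewrite -gE max_r; last by rewrite fine_ge0// gE.
by rewrite fineK// gE ge0_fin_numE.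
Qed.

Lemma eseries_finite (R : realType) (p : pred nat) (f : nat -> \bar R) (n : nat) :
  (forall i, p i -> (i < n)%N) ->
  \sum_(0 <= i <oo | p i) f i = \sum_(0 <= i < n | p i) f i.
Proof.
move=> pn; apply: lim_near_cst => //; exists n => // m /= nm.
rewrite (big_cat_nat (n := n))//= [X in _ + X]big_nat_cond [X in _ + X]big1 ?adde0//.
by move=> i /andP[/andP[ni _] /pn]; rewrite ltnNge ni.
Qed.

Section first_exit.
Context (R : realType) (k : time_kind) (S : ptopologicalType) (U : set S) (Dt : time R k).
Notation E := (path_space R k S).
Implicit Types (X : nat -> E) (j : nat).
Notation survived X j :=
  (forall i, (i < j)%N -> (time_val Dt)%:E < exit_time U (X i)).

Lemma first_exit_geP X j : j.+1%:R%:E <= first_exit U Dt X <-> survived X j.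
Proof.
split=> [le i ij|h].
  rewrite ltNge; apply/negP => le'.
  have : j.+1%:R%:E <= i.+1%:R%:E :> \bar R.
    by apply: le_trans le _; apply: ereal_inf_lbound; exists i.
  by rewrite lee_fin ler_nat ltnS leqNgt ij.
apply: le_ereal_inf_tmp => _ [i /= le <-]; rewrite lee_fin ler_nat ltnS leqNgt.
by apply/negP => /h; rewrite ltNge le.
Qed.

Lemma first_exitE X j : survived X j -> exit_time U (X j) <= (time_val Dt)%:E ->
  first_exit U Dt X = j.+1%:R%:E.
Proof.
move=> h le; apply/eqP; rewrite eq_le; apply/andP; split.
  by apply: ereal_inf_lbound; exists j.
exact/first_exit_geP.
Qed.

Lemma exit_fragmentE X j : survived X j -> exit_time U (X j) <= (time_val Dt)%:E ->
  exit_fragment U Dt X = X j.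
Proof. by move=> h le; rewrite /exit_fragment (first_exitE h le)/= natrK. Qed.

Lemma T_parE X j : survived X j -> exit_time U (X j) <= (time_val Dt)%:E ->
  T_par U Dt X = (j%:R * time_val Dt)%:E + exit_time U (X j).
Proof.
move=> h le; rewrite /T_par (first_exitE h le) (exit_fragmentE h le) -EFinB -EFinM.
by congr ((_ * _)%:E + _); rewrite -addn1 natrD addrK.
Qed.

Lemma occupation_parE X j g : survived X j -> exit_time U (X j) <= (time_val Dt)%:E ->
  occupation_par U Dt X g =
  \sum_(0 <= i < j) occupation g (X i) (time_val Dt)%:E + occupation g (X j) (exit_time U (X j)).
Proof.
move=> h le; have pE i : (i.+1%:R%:E <= first_exit U Dt X) = (i < j.+1)%N.
  by rewrite (first_exitE h le) lee_fin ler_nat.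
rewrite /occupation_par (@eseries_finite _ _ _ j.+1) => [|i]; last by rewrite pE.
rewrite big_mkcond big_nat_recr//= pE ltnSn min_l//; congr (_ + _).
apply: eq_big_nat => i /= ij; rewrite pE ltnS (ltnW ij) min_r//.
exact: ltW (h i ij).
Qed.

Lemma first_exit_exists X : (exists j, ~ survived X j) ->
  exists j, survived X j /\ exit_time U (X j) <= (time_val Dt)%:E.
Proof.
case=> j0 nj0; have ex : exists j, exit_time U (X j) <= (time_val Dt)%:E.
  by apply: contrapT => n; apply: nj0 => i _; rewrite ltNge; apply/negP => ?; apply: n; exists i.
case: (ex_minnP ex) => j hj jmin; exists j; split=> // i ij.
by rewrite ltNge; apply/negP => /jmin; rewrite leqNgt ij.
Qed.

End first_exit.

Lemma lebesgue_measure_shift (R : realType) (s : R) (A : set R) : measurable A ->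
  lebesgue_measure ((fun x : R => s + x)%R @^-1` A) = lebesgue_measure A.
Proof.
move=> mA; transitivity
  (pushforward lebesgue_measure ((fun x : R => s + x)%R : R -> measurableTypeR R) A) => //.
have ms : measurable_fun setT ((fun x : R => s + x)%R : R -> measurableTypeR R).
  exact: measurable_funD.
apply/esym/lebesgue_measure_unique => //= X [[a b] _ <-] /=.
rewrite /pushforward (_ : _ @^-1` _ = `](a - s)%R, (b - s)%R]%classic); last first.
  by apply/seteqP; split=> x /=; rewrite !in_itv/= ltrBlDl lerBrDl.
rewrite !lebesgue_measure_itv/= !lte_fin ltrD2r; case: ifP => // _.
by rewrite -!EFinB; congr EFin; ring.
Qed.

Lemma eseriesB_finite (R : realType) (p : pred nat) (f g : nat -> R) (n : nat) :
  (forall i, p i -> (i < n)%N) ->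
  \sum_(0 <= i <oo | p i) (f i - g i)%:E =
  \sum_(0 <= i <oo | p i) (f i)%:E - \sum_(0 <= i <oo | p i) (g i)%:E.
Proof. by move=> pn; rewrite !(eseries_finite _ pn) !sumEFin -EFinB sumrB. Qed.

Section occupation.
Context (R : realType) (k : time_kind) (S : ptopologicalType).
Notation E := (path_space R k S).
Hypothesis joint_eval :
  measurable_fun setT (fun xw : R * E => xw.2 (time_of k xw.1) : borel S).
Implicit Types (g : S -> R) (w : E).

Lemma occupation_ge0 g w a : (forall x, 0 <= g x)%R -> 0 <= occupation g w a.
Proof.
move: w; case: k => w g0 /=; last by apply: integral_ge0 => x _; rewrite lee_fin.
by apply: nneseries_ge0 => n _ _; rewrite lee_fin.
Qed.

Lemma occupation_agree g w w' (t : time R k) (a : R) : (forall s, (time_val s <= time_val t)%R -> w s = w' s) ->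
  (a <= time_val t)%R -> occupation g w a%:E = occupation g w' a%:E.
Proof.
move: w w' t; case: k => w w' t ww' at_ /=.
  apply: eq_eseriesr => n; rewrite lte_fin => na.
  by rewrite ww'//= ltW// (lt_le_trans na).
apply: eq_integral => x /set_mem[/= x0]; rewrite lte_fin => xa.
by rewrite ww'//= max_r// ltW// (lt_le_trans xa).
Qed.

Let horizonE (a : R) : [set x : R | (0 <= x)%R /\ x%:E < a%:E] = `[0%R, a[%classic.
Proof. by apply/seteqP; split=> x /=; rewrite in_itv/= lte_fin => /andP. Qed.

Let discrete_bound (a : R) (i : nat) : i%:R%:E < a%:E -> (i < (Num.truncn a).+1)%N.
Proof.
rewrite lte_fin -(ltr_nat R) => ia; apply: lt_trans ia _.
by rewrite truncnS_gt.
Qed.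

(** In discrete time the finite horizon makes the sum finite, so it may be split; in continuous time
    this is the definition of the integral. *)
Lemma occupation_signed g w (a : R) : occupation g w a%:E =
  occupation (fun x => Num.max (g x) 0)%R w a%:E -
  occupation (fun x => Num.max (- g x) 0)%R w a%:E.
Proof.
move: w; case: k => w /=.
  rewrite -(eseriesB_finite _ _ (@discrete_bound a)); apply: eq_eseriesr => i _.
  by congr EFin; case: (leP (g (w i)) 0%R); case: (leP (- g (w i))%R 0%R); lra.
rewrite integralE; congr (_ - _); apply: eq_integral => x _.
  by rewrite funeposE EFin_max.
by rewrite funenegE -EFinN EFin_max.
Qed.

(** The 1 in [a + 1] pays for discrete time, where [0, a) may contain more than [a] integers, but
    never more than [a + 1]. *)
Lemma occupation_le g w (M a : R) : measurable_fun setT (g : borel S -> R) ->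
  (forall x, 0 <= g x <= M)%R -> (0 <= a)%R ->
  occupation g w a%:E <= (M * (a + 1))%:E.
Proof.
move=> mg gM a0.
have M0 : (0 <= M)%R by have /andP[g0 gM'] := gM point; exact: le_trans g0 gM'.
have joint := joint_eval; move: w joint; case: k => w joint /=.
  rewrite (eseries_finite _ (@discrete_bound a)) sumEFin lee_fin.
  apply: (@le_trans _ _ (\sum_(0 <= i < (Num.truncn a).+1) M)%R).
    rewrite big_mkcond; apply: ler_sum => i _; case: ifP => // _.
    by have /andP[] := gM (w i).
  rewrite big_const_nat subn0 iter_addr_0 -mulr_natr ler_wpM2l//.
  by rewrite -addn1 natrD lerD2r truncn_le.
rewrite horizonE; apply: (@le_trans _ _ (\int[lebesgue_measure]_(x in `[0%R, a[) (cst M%:E) x)).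
  apply: ge0_le_integral => //.
  - by move=> x _; rewrite lee_fin; have /andP[] := gM (w (time_of Continuous x)).
  - apply: measurable_funTS; apply/measurable_EFinP.
    exact: (measurableT_comp mg (measurableT_comp joint (pair2_measurable w))).
  - by move=> x _; rewrite lee_fin; have /andP[] := gM (w (time_of Continuous x)).
rewrite integral_cst// [X in _ * X]lebesgue_measure_itv/= lte_fin.
case: ifP => _; last by rewrite mule0 lee_fin mulr_ge0// addr_ge0.
by rewrite -EFinB -EFinM lee_fin subr0 ler_wpM2l// lerDl.
Qed.

(** In continuous time by Tonelli, from joint measurability in time and path; the random horizon [h]
    enters as an indicator. *)
Lemma measurable_occupation g (h : E -> R) : measurable_fun setT (g : borel S -> R) ->
  (forall x, 0 <= g x)%R -> measurable_fun setT h ->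
  measurable_fun setT (fun w => occupation g w (h w)%:E).
Proof.
move=> mg g0 mh; have joint := joint_eval; move: h mh joint; case: k => h mh joint /=.
  rewrite (_ : (fun _ => _) = fun u => \sum_(0 <= n <oo)
      if n%:R%:E < (h u)%:E then (g (u n))%:E else 0); last first.
    by apply/funext => u; rewrite eseries_mkcond.
  apply: ge0_emeasurable_sum => [n u _ _|n _]; first by case: ifP; rewrite ?lee_fin.
  apply: measurable_fun_ifT => //.
    rewrite (_ : (fun _ => _) = fun u => (n%:R < h u)%R)//.
    exact: measurable_fun_ltr.
  by apply/measurable_EFinP; exact: (measurableT_comp mg (@measurable_eval R Discrete S n)).
pose F (xw : R * path_space R Continuous S) : \bar R :=
  if (0 <= xw.1)%R && (xw.1 < h xw.2)%R then (g (xw.2 (time_of Continuous xw.1)))%:E else 0.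
rewrite (_ : (fun _ => _) = fubini_G lebesgue_measure F); last first.
  apply/funext => u; rewrite /fubini_G [LHS]integral_mkcond. apply: eq_integral => x _.
  rewrite patchE /F/= -lte_fin; case: ifPn => [/set_mem[/= -> ->]//|].
  by case: ifP => // /andP[x0 xh]; rewrite mem_set.
apply: measurable_fun_fubini_tonelli_G => [|xw]; last first.
  by rewrite /F; case: ifP; rewrite ?lee_fin.
apply: measurable_fun_ifT => //.
- apply: measurable_and.
    by apply: measurable_fun_ler => //; exact: measurable_fst.
  apply: measurable_fun_ltr; first exact: measurable_fst.
  exact: (measurableT_comp mh measurable_snd).
- by apply/measurable_EFinP; exact: (measurableT_comp mg joint).
Qed.

Lemma occupationD g w (t : time R k) (a : R) : measurable_fun setT (g : borel S -> R) ->
  (forall x, 0 <= g x)%R -> (0 <= a)%R ->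
  occupation g w (time_val t + a)%:E =
  occupation g w (time_val t)%:E + occupation g (shift t w) a%:E.
Proof.
move=> mg g0 a0; have joint := joint_eval; move: w t joint; case: k => w t joint /=.
  rewrite (@eseries_finite _ _ _ (t + (Num.truncn a).+1)); last first.
    move=> i; rewrite lte_fin -(ltr_nat R) natrD => ia; apply: lt_trans ia _.
    by rewrite ltrD2l truncnS_gt.
  rewrite (big_cat_nat (n := t))//= ?leq_addr//; congr (_ + _).
    rewrite (@eseries_finite _ _ _ t); last by move=> i; rewrite lte_fin ltr_nat.
    rewrite [LHS]big_nat_cond [RHS]big_nat_cond; apply: eq_bigl => i.
    rewrite !lte_fin ltr_nat; case: (ltnP i t) => it; rewrite ?andbF//=.
    by rewrite (@lt_le_trans _ _ t%:R) ?ltr_nat// lerDl.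
  rewrite -{1}(add0n t) big_addn addKn (eseries_finite _ (@discrete_bound a)).
  apply: eq_big => i; first by rewrite !lte_fin natrD addrC ltrD2l.
  by rewrite addnC.
have mf (u : path_space R Continuous S) :
    measurable_fun setT (fun x : R => (g (u (time_of Continuous x)))%:E).
  apply/measurable_EFinP.
  exact: (measurableT_comp mg (measurableT_comp joint (pair2_measurable u))).
rewrite !horizonE (_ : `[0%R, (t%:num + a)%R[%classic =
    `[0%R, t%:num[%classic `|` `[t%:num, (t%:num + a)%R[%classic); last first.
  apply/seteqP; split=> x; rewrite /= !in_itv/=.
    by case: (ltP x t%:num) => [xt /andP[-> _]|tx /andP[_ ->]]; [left|right].
  case=> /andP[h1 h2]; first by rewrite h1 (lt_le_trans h2)// lerDl.
  by rewrite h2 (le_trans _ h1).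
rewrite ge0_integral_setU//; last 3 first.
- by apply: measurable_funTS; exact: mf.
- by move=> x _; rewrite lee_fin.
- apply/disj_setPS => x [] /=; rewrite !in_itv/= => /andP[_ xt] /andP[tx _].
  by move: tx; rewrite leNgt xt.
congr (_ + _).
pose F (x : R) := (\1_(`[t%:num, (t%:num + a)%R[%classic : set R) x)%:E *
  (g (w (time_of Continuous x)))%:E.
have mF : measurable_fun setT F.
  by apply: emeasurable_funM; [exact/measurable_EFinP/measurable_indic|exact: mf].
transitivity (\int[lebesgue_measure]_x F x); first by rewrite integral_indicE.
rewrite -(@integral_comp_law _ _ _ _ _ lebesgue_measure lebesgue_measure setT
  (fun x : R => t%:num + x)%R F)//; last 3 first.
- exact: measurable_funD.
- by move=> A mA; rewrite setTI; exact: lebesgue_measure_shift.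
- by move=> x; rewrite /F mule_ge0// lee_fin.
rewrite [RHS]integral_indicE; apply: eq_integral => x _; rewrite /F !indicE.
have -> : ((t%:num + x)%R \in (`[t%:num, (t%:num + a)%R[%classic : set R)) =
    (x \in (`[0%R, a[%classic : set R)).
  by apply/idP/idP => /set_mem/=; rewrite in_itv/= => h; apply/mem_set;
    rewrite /= in_itv/=; move: h; rewrite lerDl ltrD2l.
case: (boolP (x \in (`[0%R, a[%classic : set R))) => [h|_]; last by rewrite !mul0e.
rewrite !mul1e /=; congr ((g (w _))%:E); apply/val_inj => /=.
by move/set_mem: h; rewrite /= in_itv/= => /andP[x0 _]; rewrite !max_r// addr_ge0.
Qed.

End occupation.

(** * Regenerative families of fragments *)

Lemma geometric_eseries_lty (R : realType) (q C : R) : (0 <= q < 1)%R -> (0 <= C)%R ->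
  \sum_(0 <= j <oo) ((q ^+ j)%:E * C%:E) < +oo.
Proof.
move=> /andP[q0 q1] C0.
have q1' : (0 < 1 - q)%R by rewrite subr_gt0.
apply: (@le_lt_trans _ _ (C / (1 - q))%:E); last exact: ltry.
apply: lime_le.
  by apply: is_cvg_nneseries => n _ _; rewrite mule_ge0// lee_fin// exprn_ge0.
apply: nearW => n; under eq_bigr do rewrite -EFinM.
rewrite sumEFin lee_fin ler_pdivlMr//.
suff -> : ((\sum_(0 <= i < n) q ^+ i * C) * (1 - q) = C - q ^+ n * C)%R.
  by rewrite lerBlDr lerDl mulr_ge0// exprn_ge0.
elim: n => [|n IH]; first by rewrite big_geq// mul0r expr0 mul1r subrr.
by rewrite big_nat_recr//= mulrDl IH exprS; ring.
Qed.

Lemma fin_sumeB (R : numDomainType) (f g : nat -> \bar R) (n : nat) :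
  (forall i, f i \is a fin_num) -> (forall i, g i \is a fin_num) ->
  \sum_(0 <= i < n) (f i - g i) = \sum_(0 <= i < n) f i - \sum_(0 <= i < n) g i.
Proof.
move=> ff gf.
have -> : f = fun i => (fine (f i))%:E by apply/funext => i; rewrite fineK.
have -> : g = fun i => (fine (g i))%:E by apply/funext => i; rewrite fineK.
by under eq_bigr do rewrite -EFinB; rewrite !sumEFin -EFinB sumrB.
Qed.

Lemma bounded_parts d (T : measurableType d) (R : realType) (g : T -> R) (M : R) :
  measurable_fun setT g -> (forall x, `|g x| <= M)%R ->
  measurable_fun setT (fun x => Num.max (g x) 0)%R /\
  measurable_fun setT (fun x => Num.max (- g x) 0)%R /\
  (forall x, 0 <= Num.max (g x) 0 <= M)%R /\
  (forall x, 0 <= Num.max (- g x) 0 <= M)%R.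
Proof.
move=> mg gM; have M0 x : (0 <= M)%R := le_trans (normr_ge0 _) (gM x).
split; first exact: measurable_maxr.
split; first by apply: measurable_maxr => //; exact: measurableT_comp.
split=> x; rewrite le_max lexx orbT/= ge_max (M0 x) andbT (le_trans (ler_norm _))//.
by rewrite normrN.
Qed.

Section regenerative_family.
Context (R : realType) (k : time_kind) (S : ptopologicalType) (U : set S) (Dt : time R k).
Notation E := (path_space R k S).
Notation D := (time_val Dt).
Context (lam : probability E R).
Hypothesis joint_eval :
  measurable_fun setT (fun xw : R * E => xw.2 (time_of k xw.1) : borel S).
Context (tau : E -> R).
Hypotheses (tau_measurable : measurable_fun setT tau) (tau_ge0 : forall w, (0 <= tau w)%R)
  (tauP : {ae lam, forall w, exit_time U w = (tau w)%:E}).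

Definition survival : R := fine (lam [set w | (D < tau w)%R]).

Definition state_at_tau (w : E) : borel S := w (time_of k (tau w)).

Lemma measurable_state_at_tau : measurable_fun setT state_at_tau.
Proof.
exact: (measurableT_comp joint_eval (measurable_fun_pair tau_measurable (@measurable_id _ E setT))).
Qed.

Let measurable_survive : measurable [set w | (D < tau w)%R].
Proof.
rewrite -[X in measurable X]setTI (_ : [set w | _] = tau @^-1` `]D, +oo[); last first.
  by apply/seteqP; split=> w /=; rewrite in_itv/= andbT.
exact: tau_measurable.
Qed.

Lemma survivalE : survival%:E = lam [set w | (D < tau w)%R].
Proof. by rewrite /survival fineK// fin_num_measure. Qed.

Lemma survival_ge0 : (0 <= survival)%R.
Proof. exact: fine_ge0. Qed.

Lemma survival_le1 : (survival <= 1)%R.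
Proof. by rewrite -lee_fin survivalE; exact: probability_le1. Qed.

(** The event that a path placed after [j] surviving fragments exits within its own fragment and
    yields a value of (T_par, X_par) in [B]. *)
Definition exit_in (j : nat) (B : set (\bar R * borel S)) : set E :=
  [set w | (tau w <= D)%R /\ B ((j%:R * D + tau w)%:E, state_at_tau w)].

Lemma measurable_exit_in j B : measurable B -> measurable (exit_in j B).
Proof.
move=> mB; apply: (@measurableI _ _ [set w | (tau w <= D)%R]).
  rewrite (_ : [set w | _] = ~` [set w | (D < tau w)%R]); first exact: measurableC.
  by apply/seteqP; split=> w /=; rewrite leNgt => /negP.
rewrite -[X in measurable X]setTI.
have m : measurable_fun setT (fun w => ((j%:R * D + tau w)%:E, state_at_tau w)).
  apply: measurable_fun_pair; last exact: measurable_state_at_tau.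
  by apply/measurable_EFinP; exact: measurable_funD.
exact: m.
Qed.

Definition fragment_occupation (g : S -> R) (w : E) : \bar R :=
  occupation g w (Num.min (tau w) D)%:E.

(** For g >= 0, the weight p^j is the probability that fragment [j] is reached, and the integral is
    its mean contribution once reached. *)
Definition mean_occupation (g : S -> R) : \bar R :=
  \sum_(0 <= j <oo) ((survival ^+ j)%:E * \int[lam]_w fragment_occupation g w).

Lemma measurable_fragment_occupation (g : S -> R) : measurable_fun setT (g : borel S -> R) ->
  (forall x, 0 <= g x)%R -> measurable_fun setT (fragment_occupation g).
Proof.
move=> mg g0; apply: (measurable_occupation joint_eval mg g0).
exact: measurable_minr.
Qed.

Lemma mean_occupation_lty (g : S -> R) (M : R) : (survival < 1)%R ->
  measurable_fun setT (g : borel S -> R) -> (forall x, 0 <= g x <= M)%R ->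
  mean_occupation g < +oo.
Proof.
move=> lt1 mg gM; have g0 x : (0 <= g x)%R by have /andP[] := gM x.
have M0 : (0 <= M)%R by have /andP[h1 h2] := gM point; exact: le_trans h2.
have C0 : (0 <= M * (D + 1))%R by rewrite mulr_ge0// addr_ge0// tv_ge0.
have q1 : (0 <= survival < 1)%R by rewrite survival_ge0.
apply: le_lt_trans (geometric_eseries_lty q1 C0).
apply: lee_nneseries => j _; first by
  rewrite mule_ge0 ?lee_fin ?exprn_ge0 ?survival_ge0//; apply: integral_ge0 => w _; exact: occupation_ge0.
apply: lee_wpmul2l; first by rewrite lee_fin exprn_ge0 ?survival_ge0.
apply: (@le_trans _ _ (\int[lam]_w (cst (M * (D + 1))%:E) w)).
  apply: ge0_le_integral => //.
  - by move=> w _; exact: occupation_ge0.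
  - exact: measurable_fragment_occupation.
  move=> w _; have m0 : (0 <= Num.min (tau w) D)%R by rewrite le_min tau_ge0 tv_ge0.
  apply: le_trans (occupation_le joint_eval w mg gM m0) _.
  by rewrite lee_fin ler_wpM2l// lerD2r ge_min lexx orbT.
have lamT : lam setT = 1 by exact: probability_setT.
rewrite integral_cst// -[X in _ <= X]mule1; apply: lee_wpmul2l; first by rewrite lee_fin.
by rewrite -lamT.
Qed.

Section family.
Context d (Omega : measurableType d) (P : probability Omega R) (X : nat -> Omega -> E).
Hypothesis X_regenerative : regenerative U Dt P lam X.

Notation survived j o := (forall i, (i < j)%N -> D%:E < exit_time U (X i o)).

Let X_measurable j : measurable_fun setT (X j). Proof. exact: X_regenerative.1. Qed.

Let measurable_X_in j A : measurable A -> measurable (X j @^-1` A).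
Proof. by move=> mA; rewrite -[Y in measurable Y]setTI; exact: X_measurable. Qed.

Definition alive (j : nat) : set Omega := [set o | forall i, (i < j)%N -> (D < tau (X i o))%R].

Lemma aliveS j : alive j.+1 = alive j `&` X j @^-1` [set w | (D < tau w)%R].
Proof.
apply/seteqP; split=> o /=.
  by move=> h; split=> [i ij|]; apply: h; rewrite // ltnS ltnW.
by move=> [h hj] i; rewrite ltnS leq_eqVlt => /orP[/eqP ->|/h].
Qed.

Lemma measurable_alive j : measurable (alive j).
Proof.
elim: j => [|j IH]; first by rewrite (_ : alive 0 = setT)//; apply/seteqP; split.
by rewrite aliveS; apply: measurableI => //; exact: measurable_X_in.
Qed.

(** [tau] is a version of the exit time under [lam] alone, and null sets of [lam] are controlled for
    fragment [j] only where its predecessors survive. *)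
Lemma alive_exit_time : {ae P, forall o, forall j, survived j o ->
  exit_time U (X j o) = (tau (X j o))%:E}.
Proof.
apply: ae_forall_count => j; have [V [mV VP [a aP]]] := X_regenerative.2 j.
have [A [mA A0 sA]] := tauP.
have h : {ae P, forall o, V o -> exit_time U (X j o) = (tau (X j o))%:E}.
  exists (V `&` X j @^-1` A); split.
  - by apply: measurableI => //; exact: measurable_X_in.
  - by rewrite aP// A0 mule0.
  - by move=> o /= /not_implyP[Vo ne]; split=> //; exact: sA.
by apply: filterS2 VP h => o hV h /hV /h.
Qed.

(** By induction on [j]: the version may be used for fragment [j] precisely when the previous ones
    are known to survive. *)
Lemma survived_alive : {ae P, forall o, forall j, survived j o <-> alive j o}.
Proof.
apply: filterS alive_exit_time => o h; elim=> [|j IH]; first by split.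
rewrite aliveS; split=> [hs|[/IH hs hj] i].
  have hj : survived j o by move=> i ij; apply: hs; rewrite ltnS ltnW.
  split; first exact/IH.
  by rewrite /= -lte_fin -(h j hj); exact: hs.
by rewrite ltnS leq_eqVlt => /orP[/eqP ->|/hs//]; rewrite (h j hs) lte_fin.
Qed.

(** Taking the whole path space for [A] identifies the unknown constant as P(alive j), and then the
    survival event gives the recursion P(alive (j + 1)) = P(alive j) p. *)
Lemma alive_law j A : measurable A ->
  P (alive j `&` X j @^-1` A) = (survival ^+ j)%:E * lam A.
Proof.
have H i : exists a : {nonneg R}, forall B, measurable B ->
    P (alive i `&` X i @^-1` B) = a%:num%:E * lam B.
  have [V [mV VP [a aP]]] := X_regenerative.2 i; exists a => B mB; rewrite -aP//.
  apply: ae_measure_eq.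
  - by apply: measurableI; [exact: measurable_alive|exact: measurable_X_in].
  - by apply: measurableI => //; exact: measurable_X_in.
  by apply: filterS2 VP survived_alive => o /= h1 /(_ i) h2; split=> -[h ?]; split=> //;
    [apply/h1/h2|apply/h2/h1].
have lamT : lam setT = 1 by exact: probability_setT.
have aE i : P (alive i) = (survival ^+ i)%:E.
  elim: i => [|i IH].
    rewrite (_ : alive 0 = setT) ?expr0; first exact: probability_setT.
    by apply/seteqP; split.
  rewrite aliveS; have [a aP] := H i; rewrite aP// -survivalE.
  have := aP _ measurableT; rewrite preimage_setT setIT IH lamT mule1 => <-.
  by rewrite exprSr EFinM.
move=> mA; have [a aP] := H j; rewrite aP//; congr (_ * _).
by have := aP _ measurableT; rewrite preimage_setT setIT aE lamT mule1.
Qed.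

Lemma measure_alive j : P (alive j) = (survival ^+ j)%:E.
Proof.
have lamT : lam setT = 1 by exact: probability_setT.
by have := alive_law j measurableT; rewrite preimage_setT setIT lamT mule1.
Qed.

Lemma survival_lt1 : {ae P, forall o, exists j, ~ survived j o} -> (survival < 1)%R.
Proof.
move=> ex; rewrite lt_neqAle survival_le1 andbT; apply/eqP => s1.
have all_alive : {ae P, forall o, forall j, alive j o}.
  apply: ae_forall_count => j; exists (~` alive j); split=> //.
    by apply: measurableC; exact: measurable_alive.
  have : P (~` alive j) = 1 - P (alive j) := probability_setC _ (measurable_alive j).
  by rewrite measure_alive s1 expr1n subee.
have : {ae P, forall o, False}.
  by apply: filterS3 ex all_alive survived_alive => o [j nj] h /(_ j) h'; apply: nj; exact/h'.
move=> [A [mA A0 sA]]; have : P setT = 0.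
  by apply: subset_measure0 A0 => // o _; apply: sA => /=.
by move=> h; have : P setT = 1 := probability_setT P; rewrite h => /eqP; rewrite eq_sym onee_eq0.
Qed.

Hypothesis lt1 : (survival < 1)%R.

Lemma exits_ae : {ae P, forall o, exists j, ~ survived j o}.
Proof.
have mI : measurable (\bigcap_j alive j).
  by apply: bigcapT_measurable => j; exact: measurable_alive.
have I0 : P (\bigcap_j alive j) = 0.
  apply/eqP; rewrite eq_le measure_ge0 andbT.
  have c : (survival ^+ n)%:E @[n --> \oo] --> (0 : \bar R).
    apply/cvg_EFin; first by near=> n.
    by apply: cvg_expr; rewrite ger0_norm ?survival_ge0.
  rewrite -(cvg_lim _ c)//; apply: lime_ge; first by apply/cvg_ex; exists 0.
  apply: nearW => n; rewrite -measure_alive le_measure ?inE//; first exact: measurable_alive.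
  by move=> o; apply.
have : {ae P, forall o, ~ (\bigcap_j alive j) o}.
  by exists (\bigcap_j alive j); split=> // o /= /contrapT.
apply: filterS2 survived_alive => o h n; apply: contrapT => n'; apply: n => j _.
by apply/h; apply: contrapT => nj; apply: n'; exists j.
Unshelve. all: by end_near. Qed.

(** Split along the index of the first fragment that exits. The result involves only p, [tau] and
    [lam], hence is the same for every regenerative family. *)
Theorem regenerative_exit_law B : measurable B ->
  completed_event P [set o | B (T_par U Dt (X ^~ o), X_par U Dt (X ^~ o))] /\
  mu_ext P [set o | B (T_par U Dt (X ^~ o), X_par U Dt (X ^~ o))] =
  \sum_(0 <= j <oo) ((survival ^+ j)%:E * lam (exit_in j B)).
Proof.
move=> mB; pose F j := alive j `&` X j @^-1` exit_in j B.
have mF j : measurable (F j).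
  apply: measurableI; first exact: measurable_alive.
  by apply: measurable_X_in; exact: measurable_exit_in.
have mV : measurable (\bigcup_j F j) by exact: bigcup_measurable.
have tF : trivIset setT F.
  apply/trivIsetP => i j _ _; wlog ij : i j / (i < j)%N => [hw nij|_].
    have [ij|] := ltnP i j; first exact: hw.
    by rewrite leq_eqVlt eq_sym (negbTE nij)/= => ji; rewrite setIC; apply: hw; rewrite // eq_sym.
  apply/seteqP; split=> // o [[_ [/= le _]] [h _]].
  by move: (h i ij); rewrite ltNge le.
have [c ->] : completed_event P [set o | B (T_par U Dt (X ^~ o), X_par U Dt (X ^~ o))] /\
    mu_ext P [set o | B (T_par U Dt (X ^~ o), X_par U Dt (X ^~ o))] = P (\bigcup_j F j).
  apply: completed_event_ae => //.
  apply: filterS3 exits_ae alive_exit_time survived_alive => o ex exE sa.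
  have [j [sj le]] := first_exit_exists ex; have E1 := exE j sj.
  have tj : (tau (X j o) <= D)%R by rewrite -lee_fin -E1.
  have TX : (T_par U Dt (X ^~ o), X_par U Dt (X ^~ o)) =
      ((j%:R * D + tau (X j o))%:E, state_at_tau (X j o)).
    rewrite (T_parE sj le) E1 /X_par (exit_fragmentE sj le) /exit_state E1.
    by rewrite EFinD.
  rewrite -[X in X <-> _]/(B (T_par U Dt (X ^~ o), X_par U Dt (X ^~ o))) TX.
  split; first by move=> h; exists j => //; split; [exact/sa|].
  case=> i _ [/sa si [/= ti Bi]].
  have [ij|ij|<-//] := ltngtP i j.
    by have := sj i ij; rewrite ltNge (exE i si) lee_fin ti.
  by have := si j ij; rewrite ltNge le.
split=> //; rewrite measure_semi_bigcup//; apply: eq_eseriesr => j _.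
exact: (alive_law j (measurable_exit_in j mB)).
Qed.

Lemma ge0_regenerative_occupation (g : S -> R) : measurable_fun setT (g : borel S -> R) ->
  (forall x, 0 <= g x)%R ->
  exists F, [/\ measurable_fun setT F, (forall o, 0 <= F o),
    {ae P, forall o, occupation_par U Dt (X ^~ o) g = F o} &
    \int[P]_o F o = mean_occupation g].
Proof.
move=> mg g0.
have mphi := measurable_fragment_occupation mg g0.
have phi0 w : 0 <= fragment_occupation g w by exact: occupation_ge0.
pose F j o := (\1_(alive j) o)%:E * fragment_occupation g (X j o).
have mF j : measurable_fun setT (F j).
  apply: emeasurable_funM; first by apply/measurable_EFinP/measurable_indic; exact: measurable_alive.
  exact: (measurableT_comp mphi (X_measurable j)).
have F0 j o : 0 <= F j o by rewrite mule_ge0// lee_fin.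
exists (fun o => \sum_(0 <= j <oo) F j o); split.
- by apply: ge0_emeasurable_sum => [j o _ _|j _]; [exact: F0|exact: mF].
- by move=> o; exact: nneseries_ge0.
- apply: filterS2 alive_exit_time survived_alive => o exE sa.
  rewrite /occupation_par eseries_mkcond; apply: eq_eseriesr => j _.
  rewrite /F indicE; case: ifPn => [/first_exit_geP sj|nsj].
    rewrite mem_set; last exact/sa.
    by rewrite mul1e (exE j sj) /fragment_occupation EFin_min.
  rewrite memNset ?mul0e// => /sa sj.
  by move/negP: nsj; apply; exact/first_exit_geP.
rewrite integral_nneseries//; apply: eq_eseriesr => j _.
rewrite -integral_indicE.
have s0 : (0 <= survival ^+ j)%R by rewrite exprn_ge0// survival_ge0.
rewrite -(ge0_integral_mscale lam measurableT (NngNum s0))//.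
apply: (@integral_comp_law _ _ _ _ _ P (mscale (NngNum s0) lam) (alive j) (X j)) => //.
- exact: measurable_alive.
- by move=> A mA; exact: (alive_law j mA).
Qed.

(** Almost surely finitely many fragments contribute, so the sum splits pathwise into positive and
    negative parts. Geometric decay makes both means finite, which permits the subtraction of
    integrals. *)
Theorem regenerative_occupation (g : S -> R) (M : R) : measurable_fun setT (g : borel S -> R) ->
  (forall x, `|g x| <= M)%R ->
  \int[P]_o occupation_par U Dt (X ^~ o) g =
  mean_occupation (fun x => Num.max (g x) 0)%R - mean_occupation (fun x => Num.max (- g x) 0)%R.
Proof.
move=> mg gM; set gp := fun x => Num.max (g x) 0%R; set gn := fun x => Num.max (- g x)%R 0%R.
have [mgp [mgn [gpM gnM]]] := bounded_parts mg gM.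
have gp0 x : (0 <= gp x)%R by have /andP[] := gpM x.
have gn0 x : (0 <= gn x)%R by have /andP[] := gnM x.
have [Fp [mFp Fp0 FpE Fpi]] := ge0_regenerative_occupation mgp gp0.
have [Fn [mFn Fn0 FnE Fni]] := ge0_regenerative_occupation mgn gn0.
have occ_fin (h : S -> R) (w : E) (a : R) : measurable_fun setT (h : borel S -> R) -> (forall x, 0 <= h x <= M)%R ->
    (0 <= a)%R -> occupation h w a%:E \is a fin_num.
  move=> mh hM a0; rewrite ge0_fin_numE; last by apply: occupation_ge0 => x; have /andP[] := hM x.
  apply: (@le_lt_trans _ _ (M * (a + 1))%:E); last exact: ltry.
  exact: (occupation_le joint_eval w mh hM a0).
rewrite (@integral_version _ _ _ _ _ (fun o => Fp o - Fn o)); last 2 first.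
- exact: emeasurable_funB.
- have FE : {ae P, forall o, occupation_par U Dt (X ^~ o) gp = Fp o /\
      occupation_par U Dt (X ^~ o) gn = Fn o} by apply: filterS2 FpE FnE => o.
  apply: filterS3 FE exits_ae alive_exit_time => o [<- <-] ex exE.
  have [j [sj le]] := first_exit_exists ex.
  rewrite !(occupation_parE _ sj le) (exE j sj).
  under eq_bigr do rewrite occupation_signed.
  rewrite occupation_signed fin_sumeB; last 2 first.
  - by move=> i; apply: occ_fin => //; exact: tv_ge0.
  - by move=> i; apply: occ_fin => //; exact: tv_ge0.
  rewrite oppeD; first by rewrite addeACA.
  by apply: fin_num_adde_defl; apply: occ_fin.
by rewrite integralB ?Fpi ?Fni//; apply/integrableP; split=> //;
  (rewrite (eq_integral _ _ (fun o _ => gee0_abs (Fp0 o))) Fpi ||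
   rewrite (eq_integral _ _ (fun o _ => gee0_abs (Fn0 o))) Fni);
  exact: mean_occupation_lty.
Qed.

End family.
End regenerative_family.

(** * Reference case of a single copy *)

Section single_process.
Context (R : realType) (k : time_kind) (S : ptopologicalType) (U : set S) (oU : open U).
Context (Dt : time R k) (Dt_gt0 : (0 < time_val Dt)%R).
Notation E := (path_space R k S).
Notation D := (time_val Dt).
Notation tm := (time_muln Dt).
Hypothesis joint_eval :
  measurable_fun setT (fun xw : R * E => xw.2 (time_of k xw.1) : borel S).

Lemma occupation0 (g : S -> R) (w : E) : occupation g w 0 = 0.
Proof.
move: w; case: k => w /=.
  by rewrite (@eseries_finite _ _ _ 0%N) ?big_geq// => i; rewrite lte_fin ltNge ler0n.
rewrite (_ : [set x | _] = set0) ?integral_set0//.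
by apply/seteqP; split=> // x [/= x0]; rewrite lte_fin ltNge x0.
Qed.

(** The first [j] pieces survive exactly when [w] survives beyond j Dt, so [j] is the piece that
    contains the exit time. Minimality of the exit times of [w] and of this piece, used in both
    directions, shows that they differ by j Dt. *)
Lemma path_fragments (w : E) (X : nat -> E) :
  (forall j t, (time_val t <= D)%R -> X j t = w (time_add (tm j) t)) ->
  U (w (time_zero R k)) -> exit_time U w < +oo ->
  exists j, [/\ forall i, (i < j)%N -> D%:E < exit_time U (X i),
    exit_time U (X j) <= D%:E,
    exit_time U w = (j%:R * D)%:E + exit_time U (X j),
    exit_state U w = exit_state U (X j) &
    forall g : S -> R, measurable_fun setT (g : borel S -> R) -> (forall x, 0 <= g x)%R ->
      occupation g w (exit_time U w) =
      \sum_(0 <= i < j) occupation g (X i) D%:E + occupation g (X j) (exit_time U (X j))].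
Proof.
move=> XE U0 woo.
have survivedP j : (forall i, (i < j)%N -> D%:E < exit_time U (X i)) <->
    (time_val (tm j))%:E < exit_time U w.
  rewrite -(exit_gt_blocks oU Dt j U0); split=> h i ij.
    by move=> s sD; have /(exit_gtP oU)/(_ _ sD) := h i ij; rewrite XE.
  by apply/(exit_gtP oU) => s sD; rewrite XE//; exact: h.
have [t [tE nUt]] := exit_attained oU woo.
have [j [sj le]] : exists j, (forall i, (i < j)%N -> D%:E < exit_time U (X i)) /\
    exit_time U (X j) <= D%:E.
  (* This many pieces of length [D] reach beyond the exit time [t], so they cannot all survive. *)
  apply: first_exit_exists; exists (Num.truncn (time_val t / D)).+1 => /survivedP.
  rewrite tE lte_fin tv_muln ltNge => /negP; apply.
  by rewrite -ler_pdivrMr// ltW// truncnS_gt.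
have [s [sE nUs]] : exists s, exit_time U (X j) = (time_val s)%:E /\ ~ U (X j s).
  by apply: (exit_attained oU); exact: le_lt_trans le (ltry _).
have sD : (time_val s <= D)%R by rewrite -lee_fin -sE.
have tj : (time_val (tm j) < time_val t)%R by rewrite -lte_fin -tE; exact/survivedP.
have [u tu] := time_le_add (ltW tj).
have us : u = s.
  have ts : (time_val t <= time_val (time_add (tm j) s))%R.
    by rewrite -lee_fin -tE; apply: exit_le; rewrite -XE.
  have {}us : (time_val u <= time_val s)%R by move: ts; rewrite tu !tvD lerD2l.
  apply/tv_inj/eqP; rewrite eq_le us/= -lee_fin -sE; apply: exit_le.
  by rewrite XE ?(le_trans us)// -tu.
rewrite us in tu.
have TE : exit_time U w = (j%:R * D)%:E + exit_time U (X j).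
  by rewrite tE sE tu tvD tv_muln EFinD.
exists j; split=> //.
  by rewrite /exit_state tE sE/= !time_ofK XE// tu.
move=> g mg g0; rewrite TE sE -EFinD -tv_muln (occupationD joint_eval)//; last exact: tv_ge0.
have shE i : forall r, (time_val r <= D)%R -> shift (tm i) w r = X i r by move=> r rD; rewrite XE.
rewrite (occupation_agree g (fun r rs => shE j r (le_trans rs sD)) (lexx _)); congr (_ + _).
elim: j {sj le sE nUs tj tu us TE} => [|j IH]; first by rewrite big_geq// tv_muln mul0r occupation0.
have -> : time_val (tm j.+1) = (time_val (tm j) + D)%R.
  by rewrite !tv_muln -addn1 natrD mulrDl mul1r.
by rewrite big_nat_recr//= -IH (occupationD joint_eval)// ?(occupation_agree g (shE j) (lexx _))// tv_ge0.
Qed.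

End single_process.

Lemma single_fragment_index (R : realType) (j : nat) :
  fragment_index ord0 (fun (_ : 'I_1) (m : nat) => m%:R : R) j = (ord0, j).
Proof.
apply/esym; apply: (@fragment_index_unique _ _ _ _ (fun j => (ord0, j))) => [_ m n|].
  by rewrite ler_nat.
split=> [|i]; last by rewrite ltr_nat.
by apply/seteqP; split=> [//|[r m] _]; exists m; rewrite // (ord1 r).
Qed.

Section reference.
Context (R : realType) (k : time_kind) (S : ptopologicalType) (S_standard : standard_borel R S).
Notation E := (path_space R k S).
Context (K : R.-pker (borel S) ~> E) (sK : strong_markov K) (U : set S) (oU : open U)
  (exit_time_rv : forall (mu : probability (borel S) R) (t : R),
    completed_event (law_from K mu) [set w | exit_time U w <= t%:E])
  (rho : probability (borel S) R) (rho_qsd : is_qsd U K rho)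
  (exit_finite : {ae law_from K rho, forall w, exit_time U w < +oo})
  (Dt : time R k) (Dt_gt0 : (0 < time_val Dt)%R).
Notation D := (time_val Dt).
Notation lam := (law_from K rho).

(** The construction applied on path space itself with law [lam], the identity as the only copy and
    [m] as the m-th clock time. Its fragments are then consecutive pieces of the path [pi]. *)
Lemma single_copy_fragments :
  exists (d' : measure_display) (Omega' : measurableType d')
    (P' : probability Omega' R) (pi : Omega' -> E) (X : nat -> Omega' -> E),
  [/\ measurable_fun setT pi, (forall A, measurable A -> P' (pi @^-1` A) = lam A),
    regenerative U Dt P' lam X &
    {ae P', forall o, exists j, [/\ forall i, (i < j)%N -> D%:E < exit_time U (X i o),
    exit_time U (X j o) <= D%:E,
    exit_time U (pi o) = (j%:R * D)%:E + exit_time U (X j o),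
    exit_state U (pi o) = exit_state U (X j o) &
    forall g : S -> R, measurable_fun setT (g : borel S -> R) -> (forall x, 0 <= g x)%R ->
      occupation g (pi o) (exit_time U (pi o)) =
      \sum_(0 <= i < j) occupation g (X i o) D%:E +
      occupation g (X j o) (exit_time U (X j o))]}].
Proof.
have joint := measurable_joint_eval sK.
pose t_wall (r : 'I_1) (m : nat) (w : E) : R := m%:R.
(* Deterministic clock times generate the trivial sigma-algebra, which is independent of the
   copy. *)
have wall_trivial A : wall_events t_wall A -> A = set0 \/ A = setT.
  move=> hA; pose F := [set A : set E | A = set0 \/ A = setT].
  suff : F A by [].
  apply: (smallest_sub _ _ hA); last first.
    move=> _ [[r m] _ [B mB <-]]; rewrite /t_wall/=.
    by have [Bm|nBm] := pselect (B m%:R); [right|left]; apply/seteqP; split.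
  split=> [|B|G hG]; first by left.
  - by case=> ->; rewrite setTD ?setC0 ?setCT; [right|left].
  - have [[n Gn]|nG] := pselect (exists n, G n = setT).
      by right; apply/seteqP; split=> // w _; exists n => //; rewrite Gn.
    left; apply/seteqP; split=> // w [n _]; have [->//|GT] := hG n.
    by exfalso; apply: nG; exists n.
have t_indep : independent lam (wall_events t_wall) (generated setT (fun _ : 'I_1 => @id E)).
  move=> A B /wall_trivial[->|->] _.
    by rewrite set0I measure0 mul0e.
  have lamT : lam setT = 1 by exact: probability_setT.
  by rewrite setTI -[LHS]mul1e; congr (_ * _); exact/esym.
have Y_indep (A : 'I_1 -> set E) : (forall r, measurable (A r)) ->
    lam (\bigcap_(r in setT) (id @^-1` A r)) = \prod_(r < 1) lam (id @^-1` A r).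
  move=> mA; rewrite big_ord1; congr (lam _); apply/seteqP; split=> w /=; first by apply.
  by move=> h r _; rewrite (ord1 r).
have [d' [W' [P' [pi [X [[mpi pi_law] [XE [_ [_ Xreg]]]]]]]]] :=
  @parallel_construction R k S S_standard K sK U oU exit_time_rv rho rho_qsd 1 ord0 Dt
    _ E lam (fun _ => id) (fun=> @measurable_id _ _ _) (fun r A mA => erefl) Y_indep
    t_wall (fun r m => @measurable_cst _ _ _ _ _ _) t_indep.
exists d', W', P', pi, X; split=> //.
have pull (p : E -> Prop) : {ae lam, forall w, p w} -> {ae P', forall o, p (pi o)}.
  by apply: ae_pullback => // A mA A0; rewrite -A0; exact: (pi_law A mA).
have U0 : {ae lam, forall w : E, U (w (time_zero R k))}.
  have mU : measurable (U : set (borel S)) by exact: sub_sigma_algebra.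
  have mU0 : measurable [set w : E | U (w (time_zero R k))].
    by rewrite -[X in measurable X]setTI; exact: measurable_eval.
  exists (~` [set w : E | U (w (time_zero R k))]); split=> //; first exact: measurableC.
  have : lam (~` [set w : E | U (w (time_zero R k))]) =
      1 - lam [set w : E | U (w (time_zero R k))] := probability_setC _ mU0.
  by move=> ->; rewrite (law_from_start sK)// rho_qsd.1 subee.
apply: filterS2 (pull _ U0) (pull _ exit_finite) => o.
apply: (path_fragments oU Dt_gt0 joint) => j t tD.
have ij : fragment_index ord0 (fun r m => t_wall r m (pi o)) j = (ord0, j).
  exact: single_fragment_index.
by rewrite (XE o j t tD) ij.
Qed.

(** The series are those of [regenerative_exit_law] and [regenerative_occupation]. In the
    single-copy family they describe the exit and the occupation of [pi], whose law is [lam]. *)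
Theorem exit_reference : exists tau : E -> R,
  [/\ measurable_fun setT tau, (forall w, 0 <= tau w)%R,
    {ae lam, forall w, exit_time U w = (tau w)%:E},
    (survival Dt lam tau < 1)%R &
    (forall B, measurable B ->
      completed_event lam [set w | B (exit_time U w, exit_state U w)] /\
      mu_ext lam [set w | B (exit_time U w, exit_state U w)] =
      \sum_(0 <= j <oo) ((survival Dt lam tau ^+ j)%:E * lam (exit_in Dt tau j B))) /\
    forall (g : S -> R) (M : R), measurable_fun setT (g : borel S -> R) ->
      (forall x, `|g x| <= M)%R ->
      \int[lam]_w occupation g w (exit_time U w) =
      mean_occupation Dt lam tau (fun x => Num.max (g x) 0)%R -
      mean_occupation Dt lam tau (fun x => Num.max (- g x) 0)%R].
Proof.
have joint := measurable_joint_eval sK.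
have [tau [mtau tau0 tauP]] := real_version (exit_time_rv rho) (@exit_ge0 R k S U) exit_finite.
have [d' [W' [P' [pi [X [mpi pi_law Xreg fragE]]]]]] := single_copy_fragments.
(* The path exits in finite time, so one of its pieces fails to survive, which p = 1 would
   forbid. *)
have lt1 : (survival Dt lam tau < 1)%R.
  apply: (survival_lt1 mtau tauP Xreg); apply: filterS fragE => o [j [sj le _ _ _]].
  exists j.+1 => /(_ j (ltnSn j)); rewrite ltNge; exact/negP/negPn.
have tau_pi : {ae P', forall o, exit_time U (pi o) = (tau (pi o))%:E}.
  apply: (ae_pullback (p := fun w => exit_time U w = (tau w)%:E) mpi _ tauP) => A mA A0.
  by rewrite -A0; exact: (pi_law A mA).
exists tau; split=> //; split.
  move=> B mB.
  pose V := [set w : E | B ((tau w)%:E, state_at_tau tau w)].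
  have mV : measurable V.
    have mp : measurable_fun setT (fun w : E => ((tau w)%:E, state_at_tau tau w)).
      apply: measurable_fun_pair; first exact/measurable_EFinP.
      exact: measurable_state_at_tau.
    by rewrite -[Z in measurable Z]setTI; exact: mp.
  have [c ->] : completed_event lam [set w | B (exit_time U w, exit_state U w)] /\
      mu_ext lam [set w | B (exit_time U w, exit_state U w)] = lam V.
    by apply: completed_event_ae => //; apply: filterS tauP => w /= h; rewrite /exit_state h.
  split=> //; rewrite -(pi_law V mV).
  have [_ <-] := regenerative_exit_law joint mtau tauP Xreg lt1 mB.
  have mpV : measurable (pi @^-1` V) by rewrite -[Z in measurable Z]setTI; exact: mpi.
  apply/esym; apply: (proj2 (completed_event_ae mpV _)).
  apply: filterS2 fragE tau_pi => o [j [sj le TE XE _]] tE.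
  have E1 : (T_par U Dt (X ^~ o), X_par U Dt (X ^~ o)) = ((tau (pi o))%:E, state_at_tau tau (pi o)).
    rewrite (T_parE sj le) /X_par (exit_fragmentE sj le) -TE -XE tE; congr (_, _).
    by rewrite /exit_state tE.
  by rewrite -[Z in Z <-> _]/(B (T_par U Dt (X ^~ o), X_par U Dt (X ^~ o))) E1.
have ref (h : S -> R) (M : R) : measurable_fun setT (h : borel S -> R) -> (forall x : S, 0 <= h x <= M)%R ->
  lam.-integrable setT (fun w => occupation h w (tau w)%:E) /\
  \int[lam]_w occupation h w (tau w)%:E = mean_occupation Dt lam tau h.
  move=> mh hM; have h0 x : (0 <= h x)%R by have /andP[] := hM x.
  have mocc := measurable_occupation joint mh h0 mtau.
  have occ0 w : 0 <= occupation h w (tau w)%:E by exact: occupation_ge0.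
  have E1 : \int[lam]_w occupation h w (tau w)%:E = mean_occupation Dt lam tau h.
    have [F [mF F0 FE <-]] := ge0_regenerative_occupation joint mtau tauP Xreg mh h0.
    rewrite -(@integral_comp_law _ _ _ _ _ P' lam setT pi)//; last first.
      by move=> A mA; rewrite setTI; exact: (pi_law A mA).
    apply: integral_version => //.
    apply: filterS3 FE fragE tau_pi => o <- [j [sj le TE XE occE]] <-.
    by rewrite (occE h mh h0) (occupation_parE _ sj le).
  split=> //; apply/integrableP; split=> //.
  rewrite (eq_integral _ _ (fun w _ => gee0_abs (occ0 w))) E1.
  exact: (mean_occupation_lty joint mtau tau0 lt1 mh hM).
move=> g M mg gM; set gp := fun x => Num.max (g x) 0%R; set gn := fun x => Num.max (- g x)%R 0%R.
have [mgp [mgn [gpM gnM]]] := bounded_parts mg gM.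
have [ip Ep] := ref gp M mgp gpM; have [im En] := ref gn M mgn gnM.
rewrite (@integral_version _ _ _ _ _
  (fun w => occupation gp w (tau w)%:E - occupation gn w (tau w)%:E)).
- by rewrite integralB// Ep En.
- by apply: emeasurable_funB; [have [] := integrableP _ _ _ ip|have [] := integrableP _ _ _ im].
- by apply: filterS tauP => w ->; exact: occupation_signed.
Qed.

End reference.

Theorem proposition6p2 (R : realType) (k : time_kind)
  (S : ptopologicalType) (S_standard : standard_borel R S)
  (K : R.-pker (borel S) ~> path_space R k S) (K_strong_markov : strong_markov K)
  (U : set S) (U_open : open U)
  (exit_time_rv : forall (mu : probability (borel S) R) (t : R),
    completed_event (law_from K mu) [set w | exit_time U w <= t%:E])
  (rho : probability (borel S) R) (rho_qsd : is_qsd U K rho)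
  (rho_unique : forall nu : probability (borel S) R, is_qsd U K nu ->
    forall A, measurable A -> nu A = rho A)
  (rho_attracts : qsd_attracts U K rho)
  (exit_finite : {ae law_from K rho, forall w, exit_time U w < +oo})
  (N : nat) (N_gt0 : (0 < N)%N)
  (Dt : time R k) (Dt_gt0 : (0 < time_val Dt)%R)
  (d : measure_display) (Omega : measurableType d) (P : probability Omega R)
  (Y : 'I_N -> Omega -> path_space R k S)
  (Y_measurable : forall r, measurable_fun setT (Y r))
  (Y_law : forall r A, measurable A -> P (Y r @^-1` A) = law_from K rho A)
  (Y_indep : forall A : 'I_N -> set (path_space R k S), (forall r, measurable (A r)) ->
    P (\bigcap_(r in setT) (Y r @^-1` A r)) = \prod_(r < N) P (Y r @^-1` A r))
  (t_wall : 'I_N -> nat -> Omega -> R)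
  (t_wall_measurable : forall r m, measurable_fun setT (t_wall r m))
  (t_wall_ge0 : forall r m o, (0 <= t_wall r m o)%R)
  (t_wall_indep : independent P
    (generated setT (fun rm : 'I_N * nat => t_wall rm.1 rm.2)) (generated setT Y))
  (t_wall_nondecreasing : {ae P, forall o, forall r (m n : nat), (m <= n)%N ->
    (t_wall r m o <= t_wall r n o)%R})
  (rm : Omega -> nat -> 'I_N * nat)
  (rm_enumerates : {ae P, forall o,
    unique (enumerates (fun r m => t_wall r m o)) (rm o)}) :
  exists (d' : measure_display) (Omega' : measurableType d')
    (P' : probability Omega' R) (pi : Omega' -> Omega)
    (X : nat -> Omega' -> path_space R k S),
    let X0 j o := X j o (time_zero R k) : borel S in
    let survived (j : nat) : set Omega' :=
      [set o | forall i, (i < j)%N -> (time_val Dt)%:E < exit_time U (X i o)] in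
    (measurable_fun setT pi /\
      forall A, measurable A -> P' (pi @^-1` A) = P A) /\
    {ae P', forall o, forall (j : nat) (t : time R k),
      (time_val t <= time_val Dt)%R ->
      X j o t = Y (rm (pi o) j).1 (pi o)
                  (time_add (time_muln Dt (rm (pi o) j).2) t)} /\
    (forall j, [/\ measurable_fun setT (X j), markov_process K P' (X j) &
                   same_transition_law K P' (X j)]) /\
    (forall j, (0 < j)%N ->
      cond_independent P' (X0 j) (generated [set j] X) (generated `I_j X)) /\
    (forall C : set (borel S), measurable C -> P' (X0 0%N @^-1` C) = rho C) /\
    (forall j, (0 < j)%N -> 0 < mu_ext P' (survived j) ->
      forall C : set (borel S), measurable C ->
        (cond_prob P' (X0 j @^-1` C) (survived j))%:E = rho C) /\
    equal_in_law P' (law_from K rho)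
      (fun o => (T_par U Dt (X ^~ o), X_par U Dt (X ^~ o)))
      (fun w => (exit_time U w, exit_state U w)) /\
    (forall g : S -> R, measurable_fun setT (g : borel S -> R) ->
      (exists M : R, forall x, (`|g x| <= M)%R) ->
      \int[P']_o occupation_par U Dt (X ^~ o) g =
      \int[law_from K rho]_w occupation g w (exit_time U w)).
Proof.
have joint := measurable_joint_eval K_strong_markov.
have [tau [mtau tau0 tauP lt1 [lawE occE]]] := exit_reference S_standard K_strong_markov
  U_open exit_time_rv rho_qsd exit_finite Dt_gt0.
have [d' [W' [P' [pi [X [[mpi pi_law] [XE [Xm [Xci Xreg]]]]]]]]] :=
  parallel_construction S_standard K_strong_markov U_open exit_time_rv rho_qsd
    (Ordinal N_gt0) Dt Y_measurable Y_law Y_indep t_wall_measurable t_wall_indep.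
exists d', W', P', pi, X => X0 survived.
have start (C : set (borel S)) : measurable C ->
    measurable [set w : path_space R k S | C (w (time_zero R k))].
  by move=> mC; rewrite -[Z in measurable Z]setTI; exact: measurable_eval.
(* Both parts of (b) follow from this formula: [j = 0] gives the law of the first start, and
   division by the case of the whole space gives the conditional laws. *)
have survived_start j (C : set (borel S)) : measurable C ->
    mu_ext P' (X0 j @^-1` C `&` survived j) = (survival Dt (law_from K rho) tau ^+ j)%:E * rho C.
  move=> mC; rewrite -(law_from_start K_strong_markov rho mC).
  rewrite -(alive_law mtau tauP Xreg j (start C mC)).
  apply: (proj2 (completed_event_ae _ _)).
    apply: measurableI; first exact: (measurable_alive mtau Xreg).
    by rewrite -[Z in measurable Z]setTI; have [m _ _] := Xm j; apply: m => //; exact: start.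
  apply: filterS (survived_alive tauP Xreg) => o h.
  by split=> -[h1 h2]; split=> //; apply/(h j).
split; first by [].
split.
  have pull (p : Omega -> Prop) : {ae P, forall o, p o} -> {ae P', forall o, p (pi o)}.
    by apply: ae_pullback => // A mA A0; rewrite -A0; exact: (pi_law A mA).
  (* Almost surely the given enumeration [rm] is the one selected by the construction, by
     uniqueness. *)
  apply: filterS2 (pull _ t_wall_nondecreasing) (pull _ rm_enumerates) => o nd [en _] j t tD.
  by rewrite (XE o j t tD) (fragment_index_unique (Ordinal N_gt0) nd en).
split; first exact: Xm.
split; first by move=> j _; exact: Xci.
have rhoT : rho setT = 1 by exact: probability_setT.
have survivedE j : mu_ext P' (survived j) = (survival Dt (law_from K rho) tau ^+ j)%:E.
  have := survived_start j _ measurableT.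
  by rewrite preimage_setT setTI rhoT mule1.
split.
  move=> C mC; have := survived_start 0%N C mC.
  rewrite expr0 mul1e (_ : survived 0%N = setT) ?setIT; last by apply/seteqP; split.
  rewrite measurable_mu_extE//.
  by rewrite -[Z in measurable Z]setTI; have [m _ _] := Xm 0%N; exact: (m measurableT _ (start C mC)).
split.
  move=> j _ + C mC; rewrite /cond_prob survived_start// survivedE lte_fin => q0.
  have rC : (fine (rho C))%:E = rho C by rewrite fineK// fin_num_measure.
  by rewrite -[in LHS]rC -EFinM/= mulrAC mulfV ?mul1r// gt_eqF.
split.
  move=> B mB; have [c1 e1] := regenerative_exit_law joint mtau tauP Xreg lt1 mB.
  by have [c2 e2] := lawE B mB; split=> //; rewrite e2; exact: e1.
move=> g mg [M gM]; rewrite (occE g M mg gM).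
exact: (regenerative_occupation joint mtau tau0 tauP Xreg lt1 mg gM).
Qed.
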